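(* Let $X_0=(u_0,v_0)^\top\in\mathbb H^1$. Suppose $\|\mathbf Q^{1/2}\|_{\mathcal L_2(\dot{\mathbb H},\dot{\mathbb H})}<\infty$ and there are $k\in\mathbb N^+$, $c_2\ge0$ and polynomials $b_1,b_2,b_3$ of degree $2k+1$, $2k$, $k$ respectively such that for all $u,\widetilde u\in\dot{\mathbb H}^1$ $$\|f(u)\|_{\dot{\mathbb H}}\le b_1(\|u\|_{\dot{\mathbb H}^1}),\qquad \|f(u)-f(\widetilde u)\|_{\dot{\mathbb H}}\le b_2(\|u\|_{\dot{\mathbb H}^1},\|\widetilde u\|_{\dot{\mathbb H}^1})\|u-\widetilde u\|_{\dot{\mathbb H}^1},$$ $$\|g(\Theta u)\|_{\mathcal L_2(\mathbf Q^{1/2}(\dot{\mathbb H}),\dot{\mathbb H})}\le c_2(1+\|u\|_{L^{2k+2}}^{k+1}+\|u\|_{\dot{\mathbb H}^1}),$$ $$\|g(\Theta u)-g(\Theta\widetilde u)\|_{\mathcal L_2(\mathbf Q^{1/2}(\dot{\mathbb H}),\dot{\mathbb H})}\le b_3(\|u\|_{\dot{\mathbb H}^1},\|\widetilde u\|_{\dot{\mathbb H}^1})\|u-\widetilde u\|_{\dot{\mathbb H}^1},$$ and that there are constants $c_3,c_4,\delta_0>0$ such that the potential $F(u)=\int_{\mathcal O}\widetilde F(u(x))\,dx$ satisfies $f(u)=\widetilde F'(u)$ and $F(u)+\delta_0\ge c_3\|u\|_{\dot{\mathbb H}}^2+c_4\|u\|_{L^{2k+2}}^{2k+2}$. Let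 $N\in\mathbb N^+$ and $\tau=T/N$. Then both numerical schemes defined in the context (the midpoint SAV scheme and the exponential Euler SAV scheme) preserve the discrete averaged modified energy evolution law: for $n\in\{0,1,\dots,N-1\}$, $$\mathbb E[V(u_{n+1},v_{n+1},q_{n+1})]=\mathbb E[V(u_n,v_n,q_n)]+\frac\tau2\,\mathbb E\Big[\mathrm{Tr}\big(g(\Theta u_n)\mathbf Q^{\frac12}(g(\Theta u_n)\mathbf Q^{\frac12})^*\big)\Big],$$ where $V(u_n,v_n,q_n)=\frac12\|u_n\|_{\dot{\mathbb H}^1}^2+\frac12\|v_n\|_{L^2}^2+q_n^2$.
   Context: **Setting.** Let $d\le3$, $T>0$, and let $\mathcal O\subset\mathbb R^d$ be a bounded convex domain with polygonal boundary. $\Lambda=\sum_{i=1}^d\partial_{x_i}^2$ is the Laplacian with homogeneous Dirichlet boundary condition, $-\Lambda$ having eigenvalues $0<\lambda_1\le\lambda_2\le\cdots$ and an orthonormal eigenbasis $\{e_i\}$ of $L^2=L^2(\mathcal O;\mathbb R)$; $L^p=L^p(\mathcal O;\mathbb R)$. For $r\in\mathbb R$, $\dot{\mathbb H}^r=\mathcal D((-\Lambda)^{r/2})$ with norm $\|x\|_{\dot{\mathbb H}^r}=\|(-\Lambda)^{r/2}x\|_{L^2}$; $\dot{\mathbb H}=\dot{\mathbb H}^0=L^2$; $\mathbb H^r=\dot{\mathbb H}^r\times\dot{\mathbb H}^{r-1}$ with the product norm. On a filtered probability space $(\Omega,\mathcal F,\{\mathcal F_t\}_{t\ge0},\mathbb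 P)$, $W(t)=\sum_{k\ge1}\mathbf Q^{1/2}e_k\beta_k(t)$ is a $\mathbf Q$-Wiener process, with $\beta_k$ i.i.d. real Brownian motions and $\mathbf Q$ a symmetric positive definite operator on $L^2$ of finite trace. $\mathcal L_2(U,H)$ denotes the Hilbert–Schmidt operators from $U$ to $H$; on $\mathcal L_2(\mathbf Q^{1/2}(\dot{\mathbb H}),\dot{\mathbb H})$ the norm is $\|G\|^2=\sum_i\|G\mathbf Q^{1/2}e_i\|_{L^2}^2=\mathrm{Tr}(G\mathbf Q^{1/2}(G\mathbf Q^{1/2})^* )$. Put $\Theta u=(u,\partial_{x_1}u,\dots,\partial_{x_d}u)$; $f:\dot{\mathbb H}^1\to\dot{\mathbb H}$ and $g:\dot{\mathbb H}^1\otimes\dot{\mathbb H}^{\otimes d}\to\mathcal L_2(\mathbf Q^{1/2}(\dot{\mathbb H}),\dot{\mathbb H})$. The schemes approximate the stochastic wave equation $du=v\,dt$, $dv=\Lambda u\,dt-f(u)\,dt+g(\Theta u)\,dW$ on $(0,T]$ with initial value $X_0=(u_0,v_0)^\top$, where $u_0,v_0$ are $\mathcal F_0$-measurable. **Auxiliary variable.** The scalar auxiliary variable is $q=\sqrt{F(u)+\delta_0}$, with the constant $\delta_0$ such that $F(u)+\delta_0\ge c>0$ for all $u\in\dot{\mathbb H}^1$, for some constant $c$; $q_n$ below is its numerical counterpart. **Schemes.** Let $t_n=n\tau$ and $\delta W_n=W(t_{n+1})-W(t_n)$. The schemes start from $u_0,v_0$ and an initial value $q_0$ of the discrete auxiliary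 variable (not further prescribed in the statement). In both schemes either $\widehat u_n=u_n$ for all $n$, or $\widehat u_n=\frac{3u_n-u_{n-1}}2$ for all $n$ with $u_{-1}=u_0$; and, for $n=0,\dots,N-1$, $$q_{n+1}=q_n+\frac{\langle f(\widehat u_n),u_{n+1}-u_n\rangle_{L^2}}{2\sqrt{F(\widehat u_n)+\delta_0}}.$$ *Midpoint SAV scheme:* $$u_{n+1}=u_n+\tfrac\tau2(v_n+v_{n+1})+\tfrac\tau2g(\Theta u_n)\delta W_n,$$ $$v_{n+1}=v_n+\tfrac\tau2\Lambda(u_n+u_{n+1})-\tau\frac{f(\widehat u_n)}{\sqrt{F(\widehat u_n)+\delta_0}}\frac{q_n+q_{n+1}}2+g(\Theta u_n)\delta W_n.$$ *Exponential Euler SAV scheme:* with $X_n=(u_n,v_n)^\top$, $A=\begin{bmatrix}0&I\\ \Lambda&0\end{bmatrix}$ and $E(t)=e^{tA}$, $$X_{n+1}=E(\tau)X_n+A^{-1}(E(\tau)-I)\Big(0,-\tfrac{f(\widehat u_n)}{\sqrt{F(\widehat u_n)+\delta_0}}\tfrac{q_n+q_{n+1}}2\Big)^\top+E(\tau)(0,g(\Theta u_n)\delta W_n)^\top.$$ *)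

(* Defs.v *)
From HB Require Import structures.
From mathcomp Require Import all_boot all_order all_algebra.
From mathcomp Require Import all_classical all_reals all_analysis.
From mathcomp Require Import lra.
From mathcomp Require mpoly.

Set Implicit Arguments.
Unset Strict Implicit.
Unset Printing Implicit Defensive.

Import Order.TTheory GRing.Theory Num.Theory.
Import numFieldNormedType.Exports.

Local Open Scope classical_set_scope.
Local Open Scope ring_scope.

Section euclidean_space.
Variable R : realType.

Definition pushforward_measure d1 d2 (T1 : measurableType d1)
    (T2 : measurableType d2) (m : {measure set T1 -> \bar R}) (f : T1 -> T2)
    (mf : measurable_fun setT f) : {measure set T2 -> \bar R} :=
  measure_function_pushforward__canonical__measure_function_Measure m mf.

Definition cons_coord (n : nat) (p : n.-tuple R * R) : n.+1.-tuple R :=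
  [the n.+1.-tuple R of p.2 :: p.1].

Lemma measurable_cons_coord n : measurable_fun setT (@cons_coord n).
Proof.
by apply: measurable_cons; [exact: measurable_snd|exact: measurable_fst].
Qed.

(* The n-fold product of the Lebesgue measure, on the product sigma-algebra. *)
Fixpoint lebesgue_tuple (n : nat) : {measure set (n.-tuple R) -> \bar R} :=
  match n with
  | 0 => dirac [tuple]
  | n'.+1 => pushforward_measure (lebesgue_tuple n' \x lebesgue_measure)%E
               (@measurable_cons_coord n')
  end.

Definition euclid (d : nat) := g_sigma_algebraType (@open 'rV[R]_d).

Definition euclid_of_tuple (d : nat) (t : d.-tuple R) : euclid d :=
  \row_(i < d) tnth t i.

Lemma open_measurable_tuple d (U : set 'rV[R]_d) : open U ->
  measurable (@euclid_of_tuple d @^-1` U).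
Proof.
move=> oU.
pose box (c : d.-tuple rat * rat) : set (d.-tuple R) :=
  \big[setI/setT]_(i < d) ((fun t : d.-tuple R => tnth t i) @^-1`
     `]ratr (tnth c.1 i) - ratr c.2, ratr (tnth c.1 i) + ratr c.2[).
have mbox c : measurable (box c).
  apply: big_ind => // [|i _]; first exact: measurableI.
  by rewrite -[X in measurable X]setTI; apply: (@measurable_tnth _ R d i).
have boxP c t : box c t <-> (forall i,
    ratr (tnth c.1 i) - ratr c.2 < tnth t i < ratr (tnth c.1 i) + ratr c.2).
  rewrite /box; split.
    by move=> /[swap] i; rewrite (bigD1 i)//= in_itv/= => -[].
  move=> h; apply: (big_ind (fun A : set _ => A t)) => // i _ /=.
  by rewrite in_itv/=; exact: h.
suff -> : @euclid_of_tuple d @^-1` U =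
    \bigcup_(c : d.-tuple rat * rat)
      (if `[< box c `<=` @euclid_of_tuple d @^-1` U >] then box c else set0).
  apply: countable_bigcupT_measurable; first exact: countableP.
  by move=> c; case: ifP.
apply/seteqP; split => t /=; last by case=> c _; case: asboolP => // + bt; apply.
move=> Ut; have := open_nbhs_nbhs (conj oU Ut).
move=> /nbhs_ballP[e /= e0 eU].
have [r] : exists r : rat, ratr r \in `]0, e / 2[.
  by apply: rat_in_itvoo; rewrite divr_gt0.
rewrite in_itv/= => /andP[r0 re].
have qP i : exists q : rat, ratr q \in `]tnth t i - ratr r, tnth t i + ratr r[.
  by apply: rat_in_itvoo; rewrite ltrBlDr -addrA ltrDl addr_gt0.
have [q qE] := choice qP.
exists ([tuple q i | i < d], r) => //.
have bt : box ([tuple q i | i < d], r) t.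
  apply/boxP => i /=; rewrite tnth_mktuple.
  have := qE i; rewrite in_itv/= => /andP[a b].
  by rewrite ltrBlDr b -ltrBlDr a.
case: asboolP => // -[] s /boxP bs; apply: eU.
split=> // i j; rewrite !mxE /=.
rewrite /ball /=.
have /= := bs j; have := qE j; rewrite tnth_mktuple in_itv/=.
move=> /andP[a b] /andP[x y].
by rewrite distrC ltr_distl; apply/andP; split; lra.
Qed.

Lemma measurable_euclid_of_tuple d : measurable_fun setT (@euclid_of_tuple d).
Proof.
apply: (@measurability _ _ _ (euclid d) setT _ (@open 'rV[R]_d) erefl).
move=> _ [U oU <-]; rewrite setTI; exact: open_measurable_tuple.
Qed.

Definition lebesgue_euclid (d : nat) : {measure set (euclid d) -> \bar R} :=
  pushforward_measure (lebesgue_tuple d) (@measurable_euclid_of_tuple d).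

Record polygonal_domain (d : nat) := PolygonalDomain {
  domain_set :> set 'rV[R]_d ;
  domain_nonempty : domain_set !=set0 ;
  domain_open : open domain_set ;
  domain_bounded : bounded_set domain_set ;
  domain_convex : convex_set domain_set ;
  (* the boundary lies in finitely many hyperplanes {x | h.1 . x = h.2} *)
  domain_polygonal : exists2 H : seq ('rV[R]_d * R),
    (forall h, h \in H -> h.1 != 0) &
    closure domain_set `\` domain_set `<=`
      [set x | exists2 h, h \in H & \sum_(i < d) h.1 ord0 i * x ord0 i = h.2] }.

Lemma measurable_domain d (O : polygonal_domain d) :
  measurable (domain_set O : set (euclid d)).
Proof. by apply: sub_sigma_algebra; exact: domain_open. Qed.

Definition domain_measure d (O : polygonal_domain d) :
    {measure set (euclid d) -> \bar R} :=
  mrestr (lebesgue_euclid d) (measurable_domain O).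

End euclidean_space.

(* Elements of L^2(O) are represented by square-integrable functions; the
   equality of L^2(O) is "=ae". *)
Notation L2 O := (LfunType (domain_measure O) (lee1n 2)).

Section lebesgue_space.
Variables (R : realType) (d : nat) (O : polygonal_domain R d).
Local Notation mu := (domain_measure O).

Definition eq_L2 (x y : L2 O) : Prop :=
  (x : euclid R d -> R) = (y : euclid R d -> R) %[ae mu].

Definition inner (x y : L2 O) : R := \int[mu]_z (x z * y z).

Definition norm_L2 (x : L2 O) : R := fine ('N[mu]_2%:E[EFin \o x])%E.

Definition norm_Lp (p : nat) (x : L2 O) : \bar R :=
  ('N[mu]_(p%:R)%:E[EFin \o x])%E.

Definition partial (i : 'I_d) (phi : 'rV[R]_d -> R) : 'rV[R]_d -> R :=
  fun x => 'D_(delta_mx ord0 i) phi x.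

Definition smooth (phi : 'rV[R]_d -> R) : Prop :=
  forall s : seq 'I_d, continuous (foldr partial phi s) /\
    forall i x, derivable (foldr partial phi s) x (delta_mx ord0 i).

Definition test_function (phi : 'rV[R]_d -> R) : Prop :=
  smooth phi /\ exists K : set 'rV[R]_d,
    [/\ compact K, K `<=` O & forall x, ~ K x -> phi x = 0].

Definition weak_partial (i : 'I_d) (u w : L2 O) : Prop :=
  forall phi, test_function phi ->
    \int[mu]_x (u x * partial i phi x) = - \int[mu]_x (w x * phi x).

Definition L2_cvg (phi : nat -> 'rV[R]_d -> R) (u : L2 O) : Prop :=
  ('N[mu]_2%:E[EFin \o (phi n \- u)%R])%E @[n --> \oo] --> 0%E.

Definition H10 (u : L2 O) : Prop :=
  exists phi : nat -> 'rV[R]_d -> R,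
    [/\ forall n, test_function (phi n), L2_cvg phi u &
        forall i, exists2 w, weak_partial i u w &
                             L2_cvg (fun n => partial i (phi n)) w].

Definition dirichlet_eigenpair (l : R) (e : L2 O) : Prop :=
  H10 e /\ forall phi, test_function phi ->
    \int[mu]_x (e x * \sum_(i < d) partial i (partial i phi) x)
    = - l * \int[mu]_x (e x * phi x).

Record dirichlet_eigenbasis (lam : nat -> R) (e : nat -> L2 O) : Prop := {
  eigenvalue_gt0 : forall i, 0 < lam i ;
  eigenvalue_nondecreasing : forall i j, (i <= j)%N -> lam i <= lam j ;
  eigenpairs : forall i, dirichlet_eigenpair (lam i) (e i) ;
  eigenbasis_orthonormal : forall i j, inner (e i) (e j) = (i == j)%:R ;
  eigenbasis_total : forall x : L2 O,
    norm_L2 (x - \sum_(i < n) inner x (e i) *: e i) @[n --> \oo] --> (0 : R) }.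

(* Theta u = (u, d_1 u, ..., d_d u) *)
Definition grad (i : 'I_d) (u : L2 O) : L2 O := xget 0 [set w | weak_partial i u w].
Definition Theta (u : L2 O) : L2 O * ('I_d -> L2 O) := (u, grad ^~ u).

End lebesgue_space.

Notation "x =ae y" := (eq_L2 x y) (at level 70, no associativity) : ring_scope.

Section operators.
Variables (R : realType) (d : nat) (O : polygonal_domain R d).
Local Notation H := (L2 O).
Variables (lam : nat -> R) (e : nat -> H).

(* y = (- Lambda)^(r/2) x *)
Definition frac_power (r : R) (x y : H) : Prop :=
  forall i, inner y (e i) = lam i `^ (r / 2) * inner x (e i).

(* For r >= 0. *)
Definition dotH (r : R) (x : H) : Prop := exists y, frac_power r x y.
Definition powL (r : R) (x : H) : H := xget 0 [set y | frac_power r x y].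
Definition norm_dotH (r : R) (x : H) : R := norm_L2 (powL r x).

(* Meaningful on the domain dotH 2. *)
Definition laplacian (x : H) : H := - powL 2 x.

Definition bounded_linear (K : H -> H) : Prop :=
  (forall a x y, K (a *: x + y) =ae a *: K x + K y) /\
  exists C, forall x, norm_L2 (K x) <= C * norm_L2 x.

Definition symmetric_op (K : H -> H) : Prop :=
  forall x y, inner (K x) y = inner x (K y).

Definition trace (K : H -> H) : \bar R :=
  (\sum_(0 <= i <oo) (inner (K (e i)) (e i))%:E)%E.

Definition adjoint (K : H -> H) (y : H) : H :=
  xget 0 [set z | forall x, inner (K x) y = inner x z].

Definition hs_norm (K : H -> H) : \bar R :=
  sqrte (\sum_(0 <= i <oo) (norm_L2 (K (e i)) ^+ 2)%:E)%E.

Record covariance_operator (Q : H -> H) : Prop := {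
  covariance_bounded : bounded_linear Q ;
  covariance_symmetric : symmetric_op Q ;
  covariance_posdef : forall x, ~ (x =ae 0) -> 0 < inner (Q x) x ;
  covariance_trace : (trace Q < +oo)%E }.

Record square_root (Q Qh : H -> H) : Prop := {
  square_root_bounded : bounded_linear Qh ;
  square_root_symmetric : symmetric_op Qh ;
  square_root_nonneg : forall x, 0 <= inner (Qh x) x ;
  square_root_sqr : forall x, Qh (Qh x) =ae Q x }.

(* G is in L_2(Q^(1/2)(H), H), where Qh = Q^(1/2). Only the values of G on the
   range of Qh matter. Since Q^(1/2)(H) is normed by |Q^(-1/2) x|, G is bounded
   and linear on it iff G o Qh is so on H. *)
Definition hilbert_schmidt_Q (Qh G : H -> H) : Prop :=
  bounded_linear (G \o Qh) /\ (hs_norm (G \o Qh) < +oo)%E.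

(* The energy space HH^1 = dotH^1 x L^2 and the wave operator
   A (u, v) = (v, Lambda u), with domain dotH^2 x dotH^1. *)
Definition HH1 (X : H * H) : Prop := dotH 1 X.1.
Definition norm_HH1 (X : H * H) : R :=
  Num.sqrt (norm_dotH 1 X.1 ^+ 2 + norm_L2 X.2 ^+ 2).
Definition eq_HH (X Y : H * H) : Prop := X.1 =ae Y.1 /\ X.2 =ae Y.2.
Definition wave_dom (X : H * H) : Prop := dotH 2 X.1 /\ dotH 1 X.2.
Definition wave_op (X : H * H) : H * H := (X.2, laplacian X.1).

(* E t = e^(t A): the strongly continuous group on HH^1 generated by A *)
Record wave_group (E : R -> H * H -> H * H) : Prop := {
  wave_group_stable : forall t X, HH1 X -> HH1 (E t X) ;
  wave_group_linear : forall t a X Y, HH1 X -> HH1 Y ->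
    eq_HH (E t (a *: X + Y)) (a *: E t X + E t Y) ;
  wave_group_bounded : forall t, exists C, forall X, HH1 X ->
    norm_HH1 (E t X) <= C * norm_HH1 X ;
  wave_group0 : forall X, HH1 X -> eq_HH (E 0 X) X ;
  wave_groupD : forall s t X, HH1 X -> eq_HH (E (s + t) X) (E s (E t X)) ;
  wave_group_continuous : forall X, HH1 X ->
    norm_HH1 (E t X - X) @[t --> (0 : R)] --> (0 : R) ;
  wave_group_generator : forall X Y, HH1 X -> HH1 Y ->
    (norm_HH1 (h^-1 *: (E h X - X) - Y) @[h --> (0 : R)^'] --> (0 : R)
     <-> wave_dom X /\ eq_HH Y (wave_op X)) }.

End operators.

Section probability.
Variables (R : realType) (dO : measure_display) (Om : measurableType dO).
Variable P : probability Om R.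

Record filtration (Fil : R -> set (set Om)) : Prop := {
  filtration_sigma : forall t, 0 <= t -> sigma_algebra setT (Fil t) ;
  filtration_sub : forall t, 0 <= t -> Fil t `<=` measurable ;
  filtration_mono : forall s t, 0 <= s -> s <= t -> Fil s `<=` Fil t }.

Definition measurable_wrt (G : set (set Om)) (X : Om -> R) : Prop :=
  forall A : set R, measurable A -> G (X @^-1` A).

(* Independence of a sequence of classes of events that all contain setT, so
   that initial segments of indices are enough. *)
Definition mutually_independent (G : nat -> set (set Om)) : Prop :=
  forall n (A : nat -> set Om), (forall k, (k < n)%N -> G k (A k)) ->
    P (\bigcap_(k < n) A k) = (\prod_(k < n) P (A k))%E.

Definition sigma_generated (I : Type) (D : set I) (X : I -> Om -> R) :
    set (set Om) :=
  <<s [set B | exists i (A : set R), [/\ D i, measurable A & B = X i @^-1` A]] >>.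

Record brownian_motion (B : R -> Om -> R) : Prop := {
  brownian_measurable : forall t, 0 <= t -> measurable_fun setT (B t) ;
  brownian0 : {ae P, forall w, B 0 w = 0} ;
  brownian_continuous : {ae P, forall w, {within `[0, +oo[, continuous (B ^~ w)}} ;
  brownian_gaussian : forall s t (A : set R), 0 <= s -> s < t -> measurable A ->
    P ((fun w => B t w - B s w) @^-1` A) = normal_prob 0 (Num.sqrt (t - s)) A ;
  brownian_increments : forall r : nat -> R, 0 <= r 0%N ->
    (forall k, r k <= r k.+1) ->
    mutually_independent (fun k =>
      sigma_generated [set: unit] (fun _ w => B (r k.+1) w - B (r k) w)) }.

Record wiener_coordinates (Fil : R -> set (set Om)) (beta : nat -> R -> Om -> R) :
    Prop := {
  wiener_brownian : forall k, brownian_motion (beta k) ;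
  wiener_independent :
    mutually_independent (fun k => sigma_generated `[0, +oo[ (beta k)) ;
  wiener_adapted : forall k t, 0 <= t -> measurable_wrt (Fil t) (beta k t) ;
  wiener_increments : forall s t (A B : set Om), 0 <= s -> s <= t -> Fil s A ->
    sigma_generated [set: nat] (fun k w => beta k t w - beta k s w) B ->
    P (A `&` B) = (P A * P B)%E }.

End probability.

Section schemes.
Variables (R : realType) (d : nat) (O : polygonal_domain R d).
Local Notation H := (L2 O).
Local Notation mu := (domain_measure O).
Variables (lam : nat -> R) (e : nat -> H) (Qh : H -> H).
Variables (dO : measure_display) (Om : measurableType dO) (P : probability Om R).
Variable beta : nat -> R -> Om -> R.

(* weak measurability, i.e. Borel measurability since L^2(O) is separable *)
Definition measurable_L2_wrt (G : set (set Om)) (X : Om -> H) : Prop :=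
  forall y, measurable_wrt G (fun w => inner (X w) y).

(* Z = G (W(t) - W(s)), where W = \sum_k (Qh e_k) beta_k. As G w is defined on the
   range of Qh only, which W(t) - W(s) leaves, this is the L^2(O)-sum of
   (beta_k(t) - beta_k(s)) G (Qh e_k). *)
Definition noise_increment (G : Om -> H -> H) (s t : R) (Z : Om -> H) : Prop :=
  {ae P, forall w,
    norm_L2 (Z w - \sum_(k < m) (beta k t w - beta k s w) *: G w (Qh (e k)))
      @[m --> \oo] --> (0 : R)}.

Definition potential (Ft : R -> R) (u : H) : R := \int[mu]_x (Ft (u x)).

Variables (f : H -> H) (g : H * ('I_d -> H) -> H -> H) (Ft : R -> R) (delta0 : R).
Variables (tau : R) (N : nat) (extrapolate : bool).
Variables (u v : nat -> Om -> H) (q : nat -> Om -> R).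

(* 0.-1 = 0 encodes u_(-1) = u_0 *)
Definition uhat (n : nat) (w : Om) : H :=
  if extrapolate then 2^-1 *: (3 *: u n w - u n.-1 w) else u n w.

Definition sav_root (n : nat) (w : Om) : R :=
  Num.sqrt (potential Ft (uhat n w) + delta0).

Definition sav_force (n : nat) (w : Om) : H :=
  ((q n w + q n.+1 w) / 2 / sav_root n w) *: f (uhat n w).

Definition sav_update (n : nat) (w : Om) : Prop :=
  q n.+1 w = q n w + inner (f (uhat n w)) (u n.+1 w - u n w) / (2 * sav_root n w).

Definition noise_step (n : nat) (Z : Om -> H) : Prop :=
  noise_increment (fun w => g (Theta (u n w))) (n%:R * tau) (n.+1%:R * tau) Z.

Definition random_states : Prop := forall n, (n <= N)%N ->
  [/\ forall w, HH1 lam e (u n w, v n w),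
      measurable_L2_wrt measurable (u n), measurable_L2_wrt measurable (v n) &
      measurable_wrt measurable (q n)].

(* The terms of the second equation other than Lambda (u_n + u_(n+1)) are in
   L^2(O), so this equation forces u_n + u_(n+1) to be in dotH^2. *)
Definition midpoint_SAV : Prop := random_states /\
  forall n, (n < N)%N -> exists2 Z : Om -> H, noise_step n Z &
    {ae P, forall w,
      [/\ sav_update n w,
          u n.+1 w =ae
            u n w + (tau / 2) *: (v n w + v n.+1 w) + (tau / 2) *: Z w,
          dotH lam e 2 (u n w + u n.+1 w) &
          v n.+1 w =ae
            v n w + (tau / 2) *: laplacian lam e (u n w + u n.+1 w)
            - tau *: sav_force n w + Z w]}.

(* Y = A^-1 (E(tau) - I) (0, - force) is expressed by A Y = (E(tau) - I) (0, - force). *)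
Definition exponential_SAV (E : R -> H * H -> H * H) : Prop := random_states /\
  forall n, (n < N)%N -> exists2 Z : Om -> H, noise_step n Z &
    {ae P, forall w,
      sav_update n w /\ exists Y : H * H,
        [/\ wave_dom lam e Y,
            eq_HH (wave_op lam e Y)
              (E tau (0, - sav_force n w) - (0, - sav_force n w)) &
            eq_HH (u n.+1 w, v n.+1 w)
              (E tau (u n w, v n w) + Y + E tau (0, Z w))]}.

End schemes.

Section energy.
Variables (R : realType) (d : nat) (O : polygonal_domain R d).
Variables (lam : nat -> R) (e : nat -> L2 O).

Definition modified_energy (u v : L2 O) (q : R) : R :=
  norm_dotH lam e 1 u ^+ 2 / 2 + norm_L2 v ^+ 2 / 2 + q ^+ 2.

End energy.

(* Bivariate polynomials come from multinomials, whose notations clash with those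
   of the analysis library when both are imported. *)
Section bivariate.
Variable R : realType.

Definition total_degree (b : mpoly.mpoly 2 R) : nat :=
  (\max_(m <- mpoly.msupp b) mpoly.mdeg m)%N.

Definition eval2 (b : mpoly.mpoly 2 R) (x y : R) : R :=
  mpoly.meval (fun i : 'I_2 => if i == ord0 then x else y) b.

End bivariate.

(* Main.v *)
Require Import Defs.
From HB Require Import structures.
From mathcomp Require Import all_boot all_order all_algebra.
From mathcomp Require Import all_classical all_reals all_analysis.
From mathcomp Require Import measurable_realfun.
From mathcomp Require Import ring lra.
From mathcomp Require mpoly.

Set Implicit Arguments.
Unset Strict Implicit.
Unset Printing Implicit Defensive.

Import Order.TTheory GRing.Theory Num.Theory.
Import numFieldNormedType.Exports.

Local Open Scope classical_set_scope.
Local Open Scope ring_scope.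


(** Write u, v, q for the state before a step, u', v', q' for the state after it and
    Z for the noise increment g (Theta u) (W(t') - W(t)). For almost every outcome both
    schemes satisfy

      |u'|_1^2 + |v'|^2 + 2 q'^2 = |u|_1^2 + |v + Z|^2 + 2 q^2.

    The midpoint scheme does so by Green's formula (midpoint_step_energy). The
    exponential scheme is, after a translation by the potential of its force, an
    application of the wave group to (u, v + Z), and the wave group is an isometry of
    the energy space because its generator is skew (wave_isometry,
    exponential_step_energy). In both cases the work of the force is q'^2 - q^2: this is
    what the auxiliary variable is made for (sav_work).

    It remains to see that the mean of |v + Z|^2 is the mean of |v|^2 plus tau times the
    mean of sum_k |g (Theta u) Q^(1/2) e_k|^2 (second_moment). For finitely many modes
    this holds because the increments of the Brownian motions are centred,
    uncorrelated, of variance tau and independent of u and v. Infinitely many modes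
    are reached by Fatou's lemma, first where |v| and the coefficients are bounded and
    then in general by monotone convergence, so that infinite means are covered too.
    The sum over k is the trace in the statement (trace_adjoint).

    The independence requires that u and v be measurable with respect to the past, up to
    null events. Here the schemes are implicit: u' and v' depend on q', and q' on u'.
    The equations are affine in the scalar (q + q') / (2 r) that multiplies the force, r
    being the square root of the shifted potential, and the response of u' to the
    force f has a nonpositive work against f. Eliminating u' thus leaves a scalar linear
    equation with a positive leading coefficient, whose solution is measurable
    (multiplier_ae_measurable). The coefficients f, g and the potential are measurable
    functions of the state because Fourier sums converge in the energy norm
    (coord_measurable_lipschitz, measurable_potential). *)

(** * The inner product of L^2 *)

Section inner_product.
Variables (R : realType) (d : nat) (O : polygonal_domain R d).
Local Notation H := (L2 O).
Local Notation mu := (domain_measure O).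
Implicit Types x y z : H.

Lemma integrable_mul x y : mu.-integrable setT (EFin \o (fun t => x t * y t)).
Proof.
apply/Lfun1_integrable; exact: (Lfun2_mul_Lfun1 (LfunP x) (LfunP y)).
Qed.

Lemma innerC x y : inner x y = inner y x.
Proof. by apply: eq_Rintegral => t _; rewrite mulrC. Qed.

Lemma innerPl a x y z : inner (a *: x + y) z = a * inner x z + inner y z.
Proof.
rewrite /inner -RintegralZl//; last exact: integrable_mul.
rewrite -RintegralD//; first last.
- exact: integrable_mul.
- have : mu.-integrable setT (EFin \o (fun t => (a *: x) t * z t)) by exact: integrable_mul.
  by apply: eq_integrable => // t _ /=; rewrite -mulrA.
by apply: eq_Rintegral => t _ /=; rewrite mulrDl -mulrA.
Qed.

Lemma inner0l x : inner 0 x = 0.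
Proof.
have := innerPl (-1) 0 0 x; rewrite scaler0 addr0 mulN1r addNr; exact.
Qed.

Lemma innerDl x y z : inner (x + y) z = inner x z + inner y z.
Proof. by rewrite -{1}[x]scale1r innerPl mul1r. Qed.

Lemma innerZl a x y : inner (a *: x) y = a * inner x y.
Proof. by rewrite -[a *: x]addr0 innerPl inner0l addr0. Qed.

Lemma innerNl x y : inner (- x) y = - inner x y.
Proof. by rewrite -scaleN1r innerZl mulN1r. Qed.

Lemma innerBl x y z : inner (x - y) z = inner x z - inner y z.
Proof. by rewrite innerDl innerNl. Qed.

Lemma inner0r x : inner x 0 = 0. Proof. by rewrite innerC inner0l. Qed.
Lemma innerDr x y z : inner x (y + z) = inner x y + inner x z.
Proof. by rewrite ![inner x _]innerC innerDl. Qed.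
Lemma innerZr a x y : inner x (a *: y) = a * inner x y.
Proof. by rewrite ![inner x _]innerC innerZl. Qed.
Lemma innerNr x y : inner x (- y) = - inner x y.
Proof. by rewrite ![inner x _]innerC innerNl. Qed.
Lemma innerBr x y z : inner x (y - z) = inner x y - inner x z.
Proof. by rewrite ![inner x _]innerC innerBl. Qed.

Lemma inner_suml I (r : seq I) (Q : pred I) (F : I -> H) x :
  inner (\sum_(i <- r | Q i) F i) x = \sum_(i <- r | Q i) inner (F i) x.
Proof. by elim/big_rec2: _ => [|i y1 y2 _ <-]; rewrite ?inner0l ?innerDl. Qed.

Lemma inner_sumr I (r : seq I) (Q : pred I) (F : I -> H) x :
  inner x (\sum_(i <- r | Q i) F i) = \sum_(i <- r | Q i) inner x (F i).
Proof. by rewrite innerC inner_suml; apply: eq_bigr => i _; rewrite innerC. Qed.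

Lemma inner_ge0 x : 0 <= inner x x.
Proof. by apply: Rintegral_ge0 => t _; rewrite -expr2 sqr_ge0. Qed.

Lemma norm_L2_ge0 x : 0 <= norm_L2 x.
Proof. by rewrite fine_ge0// Lnorm_ge0. Qed.

Lemma norm_L2_EFin x : ((norm_L2 x)%:E = 'N[mu]_2%:E[EFin \o x])%E.
Proof. exact: finite_norm_fine. Qed.

Lemma norm_L2_sqr x : norm_L2 x ^+ 2 = inner x x.
Proof.
apply/EFin_inj; rewrite -powR_mulrn ?norm_L2_ge0// -poweR_EFin norm_L2_EFin.
rewrite powR_Lnorm ?pnatr_eq0// /inner /Rintegral fineK; last first.
  by apply: integrable_fin_num => //; exact: integrable_mul.
by apply: eq_integral => t _ /=; rewrite powR_mulrn// real_normK ?num_real// expr2.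
Qed.

Lemma inner_sqr_EFin x : ((inner x x)%:E = \int[mu]_t (x t ^+ 2)%:E)%E.
Proof.
rewrite /inner /Rintegral fineK; last first.
  by apply: integrable_fin_num => //; exact: integrable_mul.
by apply: eq_integral => t _; rewrite expr2.
Qed.

Lemma norm_L2E x : norm_L2 x = Num.sqrt (inner x x).
Proof. by rewrite -norm_L2_sqr sqrtr_sqr ger0_norm ?norm_L2_ge0. Qed.

Lemma cauchy_schwarz_sqr x y : inner x y ^+ 2 <= inner x x * inner y y.
Proof.
have h (t : R) : 0 <= inner x x * t ^+ 2 + inner x y * 2 * t + inner y y.
  have := inner_ge0 (t *: x + y).
  by rewrite innerPl !innerDr !innerZr [inner y x]innerC; nra.
have [x0|x0] := eqVneq (inner x x) 0.
  rewrite x0 mul0r; have [->|xy] := eqVneq (inner x y) 0; first by rewrite expr0n.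
  have := h (- (inner y y + 1) / (2 * inner x y)).
  have -> : inner x y * 2 * (- (inner y y + 1) / (2 * inner x y)) = - (inner y y + 1).
    by field.
  by rewrite x0; lra.
have xx : 0 < inner x x by rewrite lt_neqAle eq_sym x0 inner_ge0.
have := h (- inner x y / inner x x).
have -> : inner x x * (- inner x y / inner x x) ^+ 2 + inner x y * 2 * (- inner x y / inner x x)
   + inner y y = (inner x x * inner y y - inner x y ^+ 2) / inner x x by field.
by rewrite pmulr_lge0 ?invr_gt0// subr_ge0.
Qed.

Lemma cauchy_schwarz x y : `|inner x y| <= norm_L2 x * norm_L2 y.
Proof.
rewrite -(@ler_pXn2r _ 2)// ?nnegrE ?mulr_ge0 ?norm_L2_ge0//.
by rewrite real_normK ?num_real// exprMn !norm_L2_sqr cauchy_schwarz_sqr.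
Qed.

Lemma norm_L2D x y : norm_L2 (x + y) <= norm_L2 x + norm_L2 y.
Proof. exact: ler_LnormD. Qed.

Lemma norm_L2N x : norm_L2 (- x) = norm_L2 x.
Proof. by rewrite !norm_L2E innerNl innerNr opprK. Qed.

Lemma norm_L2Z a x : norm_L2 (a *: x) = `|a| * norm_L2 x.
Proof.
rewrite !norm_L2E innerZl innerZr mulrA sqrtrM; last by rewrite -expr2 sqr_ge0.
by rewrite -expr2 sqrtr_sqr.
Qed.

Lemma norm_L2_0 : norm_L2 (0 : H) = 0.
Proof. by rewrite norm_L2E inner0l sqrtr0. Qed.

Lemma norm_L2_distC x y : norm_L2 (x - y) = norm_L2 (y - x).
Proof. by rewrite -norm_L2N opprB. Qed.

Lemma norm_L2B_le x y : `|norm_L2 x - norm_L2 y| <= norm_L2 (x - y).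
Proof.
have h (u v : H) : norm_L2 u <= norm_L2 (u - v) + norm_L2 v.
  by rewrite -[X in norm_L2 X <= _](subrK v u); exact: norm_L2D.
rewrite ler_norml; have := h x y; have := h y x; rewrite (norm_L2_distC y x); lra.
Qed.

Lemma eq_L2_norm x y : x =ae y <-> norm_L2 (x - y) = 0.
Proof.
split=> [xy|/fine_Lnormr_eq0].
  apply/eqP; rewrite -sqrf_eq0 norm_L2_sqr; apply/eqP/EFin_inj.
  rewrite inner_sqr_EFin.
  rewrite (ae_eq_integral (cst 0%E)) ?integral0//=.
    by apply/measurable_EFinP; apply: measurable_funX; exact: measurable_funP.
  apply: filterS xy => t xyt _ /=.
  have xy0 : (x - y) t = 0 by rewrite -[LHS]/(x t - y t) xyt// subrr.
  by rewrite /= -[X in (X ^+ 2)%:E]/((x - y) t) xy0 expr0n.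
apply: filterS => t h _; apply/eqP; rewrite -subr_eq0; apply/eqP.
by have <- : (x - y) t = x t - y t by []; exact: h.
Qed.

Lemma eq_L2_sym x y : x =ae y -> y =ae x.
Proof. by move/eq_L2_norm => h; apply/eq_L2_norm; rewrite norm_L2_distC. Qed.

Lemma eq_L2_refl x : x =ae x.
Proof. by apply/eq_L2_norm; rewrite subrr norm_L2_0. Qed.

Lemma eq_L2_inner x x' y : x =ae x' -> inner x y = inner x' y.
Proof.
move=> /eq_L2_norm xx; apply/eqP; rewrite -subr_eq0 -innerBl -normr_le0.
by rewrite (le_trans (cauchy_schwarz _ _))// xx mul0r.
Qed.

Lemma eq_L2_normE x x' : x =ae x' -> norm_L2 x = norm_L2 x'.
Proof. by move=> h; rewrite !norm_L2E !(eq_L2_inner _ h) innerC (eq_L2_inner _ h). Qed.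

Lemma cvg_inner (x_ : nat -> H) x y :
  norm_L2 (x_ n - x) @[n --> \oo] --> (0 : R) ->
  inner (x_ n) y @[n --> \oo] --> inner x y.
Proof.
move=> h; apply/cvgrPdist_le => eps e0.
have ey : 0 < eps / (norm_L2 y + 1) by rewrite divr_gt0// ltr_wpDl ?norm_L2_ge0.
have /cvgrPdist_le/(_ _ ey) := h; apply: filterS => n.
rewrite sub0r normrN ger0_norm ?norm_L2_ge0// => le.
rewrite distrC -innerBl (le_trans (cauchy_schwarz _ _))//.
rewrite ler_pdivlMr in le; last by rewrite ltr_wpDl ?norm_L2_ge0.
by apply: le_trans le; rewrite ler_wpM2l ?norm_L2_ge0// lerDl.
Qed.

Lemma cvg_norm_L2 (x_ : nat -> H) x :
  norm_L2 (x_ n - x) @[n --> \oo] --> (0 : R) ->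
  norm_L2 (x_ n) @[n --> \oo] --> norm_L2 x.
Proof.
move=> h; apply/cvgrPdist_le => eps e0.
have /cvgrPdist_le/(_ _ e0) := h; apply: filterS => n.
rewrite sub0r normrN ger0_norm ?norm_L2_ge0// => le.
by rewrite distrC (le_trans (norm_L2B_le _ _)).
Qed.

End inner_product.

(** * Almost everywhere limits in L^2 *)

Section lower_limits.
Context dT (T : measurableType dT) (R : realType).

Lemma limn_einf_le_eventually (u : nat -> \bar R) (b : \bar R) m :
  (forall n, (m <= n)%N -> (u n <= b)%E) -> (limn_einf u <= b)%E.
Proof.
move=> ub; rewrite limn_einf_lim; apply: lime_le; first exact: is_cvg_einfs.
near=> n; apply: (@le_trans _ _ (u n)); last by apply: ub; near: n; exact: nbhs_infty_ge.
by apply: ereal_inf_lbound; exists n => /=.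
Unshelve. all: by end_near. Qed.

Lemma limn_einf_ge0 (u : nat -> \bar R) : (forall n, 0 <= u n)%E -> (0 <= limn_einf u)%E.
Proof.
move=> u0; rewrite limn_einf_lim; apply: lime_ge; first exact: is_cvg_einfs.
by near=> n; apply: le_ereal_inf_tmp => _ [m /= nm <-].
Unshelve. all: by end_near. Qed.

Lemma measurable_limn_einf (u : nat -> T -> \bar R) :
  (forall n, measurable_fun setT (u n)) -> measurable_fun setT (fun w => limn_einf (u ^~ w)).
Proof.
move=> mu; apply: (emeasurable_fun_cvg (fun n w => einfs (u ^~ w) n)).
  by move=> n; apply: measurable_fun_einfs.
by move=> w _; rewrite limn_einf_lim; exact: is_cvg_einfs.
Qed.

Lemma limn_einf_sqr (u : nat -> R) (l : R) : u n @[n --> \oo] --> l ->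
  limn_einf (fun n => (u n ^+ 2)%:E) = (l ^+ 2)%:E.
Proof.
move=> ul; have /cvg_limn_einf_sup[] // : (u n ^+ 2)%:E @[n --> \oo] --> (l ^+ 2)%:E.
apply: cvg_EFin; first exact: nearW.
rewrite expr2 [X in X @ _ --> _](_ : _ = (fun n => u n * u n)); first exact: cvgM.
by apply/funext => n /=; rewrite expr2.
Qed.

End lower_limits.

Section almost_everywhere_limits.
Variables (R : realType) (d : nat) (O : polygonal_domain R d).
Local Notation H := (L2 O).
Local Notation mu := (domain_measure O).

Lemma square_integrable_L2 (h : euclid R d -> R) : measurable_fun setT h ->
  (\int[mu]_t (h t ^+ 2)%:E < +oo)%E -> exists x : H, (x : _ -> R) = h.
Proof.
move=> mh hoo.
have hL : h \in Lfun mu 2%:E.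
  rewrite inE; apply/andP; split; rewrite inE//=.
  rewrite /finite_norm unlock; apply: poweR_lty; apply: le_lt_trans hoo.
  by under eq_integral do rewrite /= powR_mulrn// real_normK ?num_real//.
by exists (Lfun_Sub (lee1n 2) hL); exact: Lfun_valP.
Qed.

Lemma fatou_L2 (X : nat -> H) (h : euclid R d -> R) (B : R) :
  measurable_fun setT h -> {ae mu, forall t, X n t @[n --> \oo] --> h t} ->
  (forall n, inner (X n) (X n) <= B) -> (\int[mu]_t (h t ^+ 2)%:E <= B%:E)%E.
Proof.
move=> mh Xh XB.
have mX n : measurable_fun setT (fun t => ((X n t) ^+ 2)%:E).
  by apply/measurable_EFinP; apply: measurable_funX; exact: measurable_funP.
apply: (@le_trans _ _ (\int[mu]_t limn_einf (fun n => ((X n t) ^+ 2)%:E))%E).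
  apply: ae_ge0_le_integral => //.
  - by move=> t _; rewrite lee_fin sqr_ge0.
  - by apply/measurable_EFinP; apply: measurable_funX.
  - by move=> t _; apply: limn_einf_ge0 => n; rewrite lee_fin sqr_ge0.
  - exact: measurable_limn_einf.
  - by apply: filterS Xh => t Xt _; rewrite (limn_einf_sqr Xt).
apply: le_trans (fatou _ _ _ _) _ => //.
  by move=> n t _; rewrite lee_fin sqr_ge0.
under eq_fun do rewrite -inner_sqr_EFin.
by apply: (@limn_einf_le_eventually _ _ _ 0%N) => n _; rewrite lee_fin.
Qed.

(** The sum of the functions 4^k |D k|^2 has a finite integral. It is therefore
    finite almost everywhere, where it bounds each of its terms. *)
Lemma fast_ae_bound (D : nat -> H) : (forall k, inner (D k) (D k) <= 8^-1 ^+ k) ->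
  {ae mu, forall t, exists C, forall k, `|D k t| <= C * 2^-1 ^+ k}.
Proof.
move=> hD.
have mD k : measurable_fun setT (fun t => (4 ^+ k * D k t ^+ 2)%:E).
  apply/measurable_EFinP; apply: measurable_funM => //.
  by apply: measurable_funX; exact: measurable_funP.
have D0 k t : (0 <= (4 ^+ k * D k t ^+ 2)%:E)%E by rewrite lee_fin mulr_ge0 ?sqr_ge0 ?exprn_ge0.
have : mu.-integrable setT (fun t => \sum_(0 <= k <oo) (4 ^+ k * D k t ^+ 2)%:E)%E.
  apply/integrableP; split.
    by apply: ge0_emeasurable_sum => // k t _ _; exact: D0.
  under eq_integral do rewrite gee0_abs ?nneseries_ge0//.
  rewrite integral_nneseries//.
  apply: (@le_lt_trans _ _ (\sum_(0 <= k <oo) (2^-1 ^+ k)%:E)%E).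
    apply: lee_nneseries => [k _ _|k _]; first exact: integral_ge0.
    under eq_integral do rewrite EFinM.
    rewrite ge0_integralZl_EFin ?exprn_ge0//; first last.
    - by apply/measurable_EFinP; apply: measurable_funX; exact: measurable_funP.
    - by move=> t _; rewrite lee_fin sqr_ge0.
    rewrite -inner_sqr_EFin -EFinM lee_fin.
    rewrite (le_trans (ler_wpM2l _ (hD k))) ?exprn_ge0// -exprMn.
    by rewrite (_ : 4 * 8^-1 = 2^-1 :> R)//; lra.
  rewrite (_ : (fun n : nat => _) = EFin \o (series (geometric 1 (2^-1 : R)))); last first.
    apply/funext => n /=; rewrite /series/= sumEFin; congr EFin.
    by rewrite big_mkord; rewrite big_mkord; apply: eq_bigr => i _; rewrite mul1r.
  by rewrite EFin_lim ?ltry//; apply: is_cvg_geometric_series; rewrite ger0_norm; lra.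
move=> /integrable_ae -/(_ measurableT); apply: filterS => t /(_ I).
set S := (X in X \is a fin_num) => Sfin.
exists (Num.sqrt (fine S)) => k.
have kS : 4 ^+ k * D k t ^+ 2 <= fine S.
  rewrite -lee_fin fineK// /S.
  by rewrite (@nneseriesD1 _ _ k)//= leeDl// nneseries_ge0.
rewrite exprVn ler_pdivlMr ?exprn_gt0// -[leLHS]ger0_norm ?mulr_ge0 ?exprn_ge0//.
have S0 : 0 <= fine S by rewrite (le_trans _ kS)// mulr_ge0 ?sqr_ge0 ?exprn_ge0.
rewrite -sqrtr_sqr ler_sqrt//; apply: le_trans kS.
rewrite exprMn real_normK ?num_real// mulrC -exprM mulnC exprM.
by rewrite (_ : 2 ^+ 2 = 4 :> R)//; lra.
Qed.

Lemma geometric_telescope_cvg (s : nat -> R) (C : R) :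
  (forall k, `|s k.+1 - s k| <= C * 2^-1 ^+ k) -> cvgn s.
Proof.
move=> h.
have /cvg_ex[l hl] : cvgn (series (fun k => s k.+1 - s k)).
  apply: normed_cvg; apply: (@series_le_cvg _ _ (geometric C 2^-1)).
  - by move=> n; exact: normr_ge0.
  - by move=> n; apply: le_trans (h n); exact: normr_ge0.
  - exact: h.
  - by apply: (@is_cvg_geometric_series _ C); rewrite ger0_norm; lra.
apply/cvg_ex; exists (s 0%N + l).
rewrite [X in X @ _ --> _](_ : _ = cst (s 0%N) \+ series (fun k => s k.+1 - s k)); last first.
  by apply/funext => n; rewrite /= seriesEnat/= telescope_sumr// addrC subrK.
exact: (cvgD (cvg_cst (s 0%N)) hl).
Qed.
End almost_everywhere_limits.

(** * Fourier series in the eigenbasis *)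

Section eigenbasis.
Variables (R : realType) (d : nat) (O : polygonal_domain R d).
Local Notation H := (L2 O).
Local Notation mu := (domain_measure O).
Variables (lam : nat -> R) (e : nat -> H).
Hypothesis he : dirichlet_eigenbasis lam e.
Implicit Types x y : H.

Definition lincomb (n : nat) (c : nat -> R) : H := \sum_(i < n) c i *: e i.
Definition fourier_sum (n : nat) x : H := lincomb n (fun i => inner x (e i)).

Lemma lincomb0 c : lincomb 0 c = 0.
Proof. by rewrite /lincomb big_ord0. Qed.

Lemma lincombS n c : lincomb n.+1 c = c n *: e n + lincomb n c.
Proof. by rewrite /lincomb big_ord_recr/= addrC. Qed.

Lemma fourier_sum_cvg x : norm_L2 (fourier_sum n x - x) @[n --> \oo] --> (0 : R).
Proof.
by under eq_fun do rewrite norm_L2_distC; exact: (eigenbasis_total he).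
Qed.

Lemma inner_lincomb n c y : inner (lincomb n c) y = \sum_(i < n) c i * inner (e i) y.
Proof. by rewrite inner_suml; apply: eq_bigr => i _; rewrite innerZl. Qed.

Lemma coord_lincomb n c j : inner (lincomb n c) (e j) = if (j < n)%N then c j else 0.
Proof.
rewrite inner_lincomb; under eq_bigr do rewrite (eigenbasis_orthonormal he).
case: ifPn => [jn|]; last rewrite -leqNgt => nj.
  rewrite (bigD1 (Ordinal jn))//= eqxx mulr1 big1 ?addr0// => i ij.
  rewrite (_ : _ == _ = false) ?mulr0//; apply/negbTE; apply: contraNneq ij => ij.
  by apply/eqP/val_inj.
rewrite big1// => i _; rewrite (_ : _ == _ = false) ?mulr0//.
by rewrite ltn_eqF// (leq_trans (ltn_ord i)).
Qed.

Lemma inner_lincomb2 n c c' : inner (lincomb n c) (lincomb n c') = \sum_(i < n) c i * c' i.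
Proof.
rewrite inner_lincomb; apply: eq_bigr => i _.
by rewrite innerC coord_lincomb ltn_ord.
Qed.

Lemma lincombB n m c : (n <= m)%N ->
  lincomb m c - lincomb n c = lincomb m (fun i => if (i < n)%N then 0 else c i).
Proof.
move=> nm; rewrite /lincomb (big_ord_widen m (fun i => c i *: e i) nm).
rewrite [X in _ - X]big_mkcond -sumrB; apply: eq_bigr => i _.
by case: ifP => _; rewrite ?subrr ?subr0 ?scale0r.
Qed.

Lemma parseval x y :
  \sum_(i < n) inner x (e i) * inner y (e i) @[n --> \oo] --> inner x y.
Proof.
have := @cvg_inner _ _ _ _ _ y (fourier_sum_cvg x).
by under eq_fun do (rewrite inner_lincomb; under eq_bigr do rewrite (innerC _ y)).
Qed.

Lemma bessel x n : \sum_(i < n) inner x (e i) ^+ 2 <= inner x x.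
Proof.
have := @parseval x x; set u := (X in X @ _ --> _) => cu.
have -> : \sum_(i < n) inner x (e i) ^+ 2 = u n.
  by apply: eq_bigr => i _; rewrite expr2.
rewrite -(cvg_lim _ cu)//; apply: nondecreasing_cvgn_le; last by apply/cvg_ex; exists (inner x x).
apply/nondecreasing_seqP => k; rewrite /u big_ord_recr/= lerDl -expr2.
exact: sqr_ge0.
Qed.

Lemma parseval_nneseries x :
  (\sum_(0 <= i <oo) (inner x (e i) ^+ 2)%:E = (inner x x)%:E)%E.
Proof.
apply: cvg_lim => //; under eq_fun do rewrite sumEFin.
apply: cvg_EFin; first exact: nearW.
rewrite (_ : _ \o _ = fun n => \sum_(i < n) inner x (e i) * inner x (e i)).
  exact: parseval.
by apply/funext => n /=; rewrite big_mkord; apply: eq_bigr => i _; rewrite expr2.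
Qed.

Lemma coord_inj x y : (forall i, inner x (e i) = inner y (e i)) -> x =ae y.
Proof.
move=> h; apply/eq_L2_norm/eqP; rewrite -sqrf_eq0 norm_L2_sqr; apply/eqP.
have := @parseval (x - y) (x - y).
under eq_fun do under eq_bigr do rewrite innerBl h subrr mul0r.
by move/cvg_lim => <-//; under eq_fun do rewrite big1//; rewrite lim_cst.
Qed.

Lemma coord_ext x y : x =ae y -> forall i, inner x (e i) = inner y (e i).
Proof. by move=> h i; exact: eq_L2_inner. Qed.

(** The partial sums form a Cauchy sequence. Along a subsequence with fast tails they
    converge almost everywhere, which gives a function; Fatou's lemma shows that it
    is the limit in L^2 as well. *)
Theorem riesz_fischer (c : nat -> R) (M : R) :
  (forall n, \sum_(i < n) c i ^+ 2 <= M) -> exists x, forall i, inner x (e i) = c i.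
Proof.
move=> cM; pose s n := \sum_(i < n) c i ^+ 2; pose S n := lincomb n c.
have s_nd : nondecreasing_seq s.
  by apply/nondecreasing_seqP => k; rewrite /s big_ord_recr/= lerDl sqr_ge0.
have cs : cvgn s.
  by apply: nondecreasing_is_cvgn => //; exists M => _ [n _ <-]; exact: cM.
have snorm n m : (n <= m)%N -> inner (S m - S n) (S m - S n) = s m - s n.
  move=> nm; rewrite lincombB// inner_lincomb2 /s.
  rewrite (big_ord_widen m (fun i => c i ^+ 2) nm) [X in _ - X]big_mkcond -sumrB.
  by apply: eq_bigr => i _; case: ifP => _; rewrite ?subrr ?subr0 ?mul0r ?expr2.
have [N hN] : {N : nat -> nat & forall k n, (N k <= n)%N -> limn s - s n <= 8^-1 ^+ k}.
  apply: (@choice _ _ (fun k N => forall n, (N <= n)%N -> limn s - s n <= 8^-1 ^+ k)) => k.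
  have e0 : 0 < (8^-1 : R) ^+ k by rewrite exprn_gt0.
  have /cvgrPdist_le/(_ _ e0)[N _ hN] := cs.
  by exists N => n /hN; apply: le_trans; exact: ler_norm.
(* Nondecreasing, and at least k and N k. *)
pose phi k := (k + \sum_(j < k.+1) N j)%N.
have phi_le k l : (k <= l)%N -> (phi k <= phi l)%N.
  move=> kl; rewrite leq_add//.
  rewrite -!(big_mkord xpredT N) (@big_cat_nat _ _ _ k.+1 0 l.+1)//=.
  exact: leq_addr.
have phi_bound k l : (k <= l)%N -> s (phi l) - s (phi k) <= 8^-1 ^+ k.
  move=> kl; apply: le_trans (hN k (phi k) _).
    by rewrite lerD2r; apply: nondecreasing_cvgn_le.
  by rewrite /phi big_ord_recr/= addnA leq_addl.
have Dbound k l : (k <= l)%N -> inner (S (phi l) - S (phi k)) (S (phi l) - S (phi k)) <= 8^-1 ^+ k.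
  by move=> kl; rewrite snorm ?phi_le// phi_bound.
have ae_cvg : {ae mu, forall t, cvgn (fun k => S (phi k) t)}.
  have := fast_ae_bound (D := fun k => S (phi k.+1) - S (phi k)) (fun k => Dbound k k.+1 (leqnSn k)).
  apply: filterS => t [C hC]; apply: (@geometric_telescope_cvg _ _ C) => k.
  exact: hC.
pose h t := fine (limn_esup (fun k => (S (phi k) t)%:E)).
have mS k : measurable_fun setT (S (phi k)) by exact: measurable_funP.
have mh : measurable_fun setT h.
  apply: (@measurableT_comp _ _ _ _ _ _ fine); first exact: fine_measurable.
  by apply: measurable_fun_limn_esup => k; apply/measurable_EFinP.
have Sh : {ae mu, forall t, S (phi k) t @[k --> \oo] --> h t}.
  apply: filterS ae_cvg => t /cvg_ex[l tl]; rewrite /h.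
  have /cvg_limn_einf_sup[_ ->] : (S (phi k) t)%:E @[k --> \oo] --> l%:E.
    by apply: cvg_EFin => //; exact: nearW.
  exact: tl.
have tail k : (\int[mu]_t ((h t - S (phi k) t) ^+ 2)%:E <= (8^-1 ^+ k)%:E)%E.
  apply: (@fatou_L2 _ _ _ (fun l => S (phi (l + k)%N) - S (phi k))).
  - exact: measurable_funB.
  - apply: filterS Sh => t ht; apply: cvgB; last exact: cvg_cst.
    by rewrite -(cvg_shiftn k) in ht; exact: ht.
  - by move=> l; apply: Dbound; exact: leq_addl.
(* Only the distance of h to the partial sums is controlled, not h itself. *)
have [z zE] : exists z : H, (z : _ -> R) = (fun t => h t - S (phi 0%N) t).
  apply: square_integrable_L2; first exact: measurable_funB.
  by rewrite (le_lt_trans (tail 0%N))// ltry.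
exists (z + S (phi 0%N)) => i.
have zS : norm_L2 (S (phi k) - (z + S (phi 0%N))) @[k --> \oo] --> (0 : R).
  have bound k : inner (S (phi k) - (z + S (phi 0%N))) (S (phi k) - (z + S (phi 0%N))) <= 8^-1 ^+ k.
    rewrite -lee_fin inner_sqr_EFin; apply: le_trans (tail k).
    under eq_integral => t _.
      have -> : (S (phi k) - (z + S (phi 0%N))) t = - (h t - S (phi k) t).
        rewrite -[LHS]/(S (phi k) t - (z t + S (phi 0%N) t)) zE; ring.
      rewrite sqrrN; over.
    by [].
  have c8 : Num.sqrt ((8^-1 : R) ^+ k) @[k --> \oo] --> (0 : R).
    rewrite -sqrtr0; apply: continuous_cvg; first exact: sqrt_continuous.
    by apply: cvg_expr; rewrite ger0_norm; lra.
  apply: (squeeze_cvgr _ (cvg_cst 0) c8); near=> k.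
  by rewrite norm_L2_ge0 norm_L2E ler_wsqrtr.
have cz : inner (S (phi k)) (e i) @[k --> \oo] --> inner (z + S (phi 0%N)) (e i).
  exact: cvg_inner zS.
apply: (cvg_unique _ cz) => //; apply: cvg_near_cst; near=> k.
rewrite coord_lincomb ifT// /phi (@leq_trans k)//; last exact: leq_addr.
by near: k; exact: nbhs_infty_gt.
Unshelve. all: by end_near. Qed.
End eigenbasis.

(** * Fractional powers of the Laplacian *)

(** The inner product of dotH^1, whose norm is norm_dotH 1. Locking keeps
    unification away from the choice operator inside powL. *)
HB.lock Definition inner1 (R : realType) (d : nat) (O : polygonal_domain R d)
    (lam : nat -> R) (e : nat -> L2 O) (x y : L2 O) : R :=
  inner (powL lam e 1 x) (powL lam e 1 y).

Section fractional_powers.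
Variables (R : realType) (d : nat) (O : polygonal_domain R d).
Local Notation H := (L2 O).
Local Notation mu := (domain_measure O).
Variables (lam : nat -> R) (e : nat -> H).
Hypothesis he : dirichlet_eigenbasis lam e.
Implicit Types x y : H.
Local Notation lincomb := (lincomb e).
Local Notation fourier_sum := (fourier_sum e).
Local Notation dotH := (dotH lam e).
Local Notation powL := (powL lam e).
Local Notation norm_dotH := (norm_dotH lam e).

Lemma lam_powR1 i : lam i `^ (2 / 2) = lam i.
Proof. by rewrite divff// powRr1// ltW// (eigenvalue_gt0 he). Qed.

Lemma lam_powR12_sqr i : (lam i `^ (1 / 2)) ^+ 2 = lam i.
Proof.
rewrite expr2 -powRD -?splitr ?powRr1// ?(ltW (eigenvalue_gt0 he i))//.
by rewrite gt_eqF ?implybT// (eigenvalue_gt0 he).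
Qed.

(** By Riesz-Fischer, a fractional power of x exists as soon as the coordinates
    that it must have are square summable. *)
Lemma dotHP r x : dotH r x <->
  exists M, forall n, \sum_(i < n) (lam i `^ (r / 2) * inner x (e i)) ^+ 2 <= M.
Proof.
split=> [[y hy]|[M hM]]; last first.
  by have [y hy] := riesz_fischer he (c := fun i => lam i `^ (r / 2) * inner x (e i)) hM; exists y.
exists (inner y y) => n; rewrite (le_trans _ (bessel he y n))//.
by apply: ler_sum => i _; rewrite hy.
Qed.

Lemma powL_coord r x i : dotH r x -> inner (powL r x) (e i) = lam i `^ (r / 2) * inner x (e i).
Proof. by move=> /(xgetPex 0); exact. Qed.

Lemma dotHPl r a x y : dotH r x -> dotH r y -> dotH r (a *: x + y).
Proof.
move=> [x' hx] [y' hy]; exists (a *: x' + y') => i.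
by rewrite !innerPl hx hy; ring.
Qed.

Lemma dotH0 r : dotH r 0.
Proof. by exists 0 => i; rewrite !inner0l mulr0. Qed.

Lemma dotHZ r a x : dotH r x -> dotH r (a *: x).
Proof. by move=> hx; rewrite -[_ *: _]addr0; apply: dotHPl => //; exact: dotH0. Qed.

Lemma dotHD r x y : dotH r x -> dotH r y -> dotH r (x + y).
Proof. by move=> hx hy; rewrite -[x]scale1r; exact: dotHPl. Qed.

Lemma dotHN r x : dotH r x -> dotH r (- x).
Proof. by move=> hx; rewrite -scaleN1r; exact: dotHZ. Qed.

Lemma dotHB r x y : dotH r x -> dotH r y -> dotH r (x - y).
Proof. by move=> hx hy; apply: dotHD => //; exact: dotHN. Qed.

Lemma dotH_lincomb r n c : dotH r (lincomb n c).
Proof.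
exists (lincomb n (fun i => lam i `^ (r / 2) * c i)) => i.
by rewrite !(coord_lincomb he); case: ifP; rewrite ?mulr0.
Qed.

Lemma dotH_e r i : dotH r (e i).
Proof.
exists (lam i `^ (r / 2) *: e i) => j; rewrite innerZl (eigenbasis_orthonormal he).
by case: eqVneq => [->|]; rewrite ?mulr0.
Qed.

Lemma dotH_sum r n (F : 'I_n -> H) : (forall j, dotH r (F j)) -> dotH r (\sum_(j < n) F j).
Proof.
by move=> hF; elim/big_ind: _ => [|x y|j _]; [exact: dotH0|exact: dotHD|exact: hF].
Qed.

Lemma dotH_ext r x y : dotH r x -> x =ae y -> dotH r y.
Proof. by move=> [z hz] xy; exists z => i; rewrite hz (coord_ext e xy). Qed.

Lemma dotH21 x : dotH 2 x -> dotH 1 x.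
Proof.
move=> [y hy]; apply/dotHP; exists ((inner x x + inner y y) / 2) => n.
have h i : (lam i `^ (1 / 2) * inner x (e i)) ^+ 2 <=
    (inner x (e i) ^+ 2 + inner y (e i) ^+ 2) / 2.
  rewrite hy lam_powR1 exprMn lam_powR12_sqr.
  by have := sqr_ge0 (inner x (e i) - lam i * inner x (e i)); nra.
apply: (@le_trans _ _ (\sum_(i < n) (inner x (e i) ^+ 2 + inner y (e i) ^+ 2) / 2)).
  by apply: ler_sum => i _; exact: h.
rewrite -mulr_suml big_split/= ler_pM2r// lerD//; exact: (bessel he).
Qed.

Local Notation inner1 := (inner1 lam e).

Lemma norm_dotH1_sqr x : norm_dotH 1 x ^+ 2 = inner1 x x.
Proof. by rewrite inner1.unlock -norm_L2_sqr. Qed.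

Lemma parseval1 x y : dotH 1 x -> dotH 1 y ->
  \sum_(i < n) lam i * (inner x (e i) * inner y (e i)) @[n --> \oo] --> inner1 x y.
Proof.
move=> hx hy; rewrite inner1.unlock.
have := @parseval _ _ _ _ _ he (powL 1 x) (powL 1 y).
under eq_fun do under eq_bigr do rewrite !powL_coord// mulrACA -expr2 lam_powR12_sqr.
exact.
Qed.

Lemma inner1C x y : inner1 x y = inner1 y x.
Proof. by rewrite inner1.unlock innerC. Qed.

Lemma powLPl r a x y : dotH r x -> dotH r y -> powL r (a *: x + y) =ae a *: powL r x + powL r y.
Proof.
move=> hx hy; apply: (coord_inj he) => i.
by rewrite powL_coord ?innerPl ?powL_coord//; [ring|exact: dotHPl].
Qed.

Lemma inner1Pl a x y z : dotH 1 x -> dotH 1 y ->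
  inner1 (a *: x + y) z = a * inner1 x z + inner1 y z.
Proof. by move=> hx hy; rewrite inner1.unlock (eq_L2_inner _ (powLPl a hx hy)) innerPl. Qed.

Lemma powL0 r : powL r 0 =ae 0.
Proof.
by apply: (coord_inj he) => i; rewrite powL_coord ?inner0l ?mulr0//; exact: dotH0.
Qed.

Lemma inner1Zl a x z : dotH 1 x -> inner1 (a *: x) z = a * inner1 x z.
Proof.
move=> hx; have := inner1Pl a z hx (dotH0 1).
have -> : inner1 0 z = 0 by rewrite inner1.unlock (eq_L2_inner _ (powL0 1)) inner0l.
have -> : a *: x + 0 = a *: x by rewrite addr0.
by move=> ->; rewrite addr0.
Qed.

Lemma inner1Dl x y z : dotH 1 x -> dotH 1 y -> inner1 (x + y) z = inner1 x z + inner1 y z.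
Proof. by move=> hx hy; rewrite -[X in inner1 (X + _) _]scale1r inner1Pl// mul1r. Qed.

Lemma inner1Nl x z : dotH 1 x -> inner1 (- x) z = - inner1 x z.
Proof. by move=> hx; rewrite -scaleN1r inner1Zl// mulN1r. Qed.

Lemma inner1Bl x y z : dotH 1 x -> dotH 1 y -> inner1 (x - y) z = inner1 x z - inner1 y z.
Proof. by move=> hx hy; rewrite inner1Dl ?inner1Nl//; exact: dotHN. Qed.

Lemma powL_ext r x y : dotH r x -> x =ae y -> powL r x =ae powL r y.
Proof.
move=> hx xy; apply: (coord_inj he) => i.
by rewrite !powL_coord ?(coord_ext e xy)//; exact: dotH_ext xy.
Qed.

Lemma norm_dotH_le2 r x y : dotH r x -> dotH r y ->
  norm_dotH r (x + y) <= norm_dotH r x + norm_dotH r y.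
Proof.
move=> hx hy; rewrite /Defs.norm_dotH -[x]scale1r (eq_L2_normE (powLPl 1 hx hy)).
by rewrite !scale1r norm_L2D.
Qed.

Lemma norm_dotHZ r a x : dotH r x -> norm_dotH r (a *: x) = `|a| * norm_dotH r x.
Proof.
move=> hx; rewrite /Defs.norm_dotH -norm_L2Z; apply: eq_L2_normE.
by apply: (coord_inj he) => i; rewrite innerZl !powL_coord ?innerZl//; [ring|exact: dotHZ].
Qed.

Lemma norm_dotH_ge0 r x : 0 <= norm_dotH r x. Proof. exact: norm_L2_ge0. Qed.

Lemma norm_dotH_sum r n (F : 'I_n -> H) : (forall j, dotH r (F j)) ->
  norm_dotH r (\sum_(j < n) F j) <= \sum_(j < n) norm_dotH r (F j).
Proof.
elim: n F => [|n IH] F hF.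
  by rewrite !big_ord0 /Defs.norm_dotH (eq_L2_normE (powL0 r)) norm_L2_0.
rewrite !big_ord_recr/= (le_trans (norm_dotH_le2 _ _))//; first exact: dotH_sum.
by rewrite lerD2r IH.
Qed.

Lemma norm_dotHB r x y : dotH r x -> dotH r y ->
  `|norm_dotH r x - norm_dotH r y| <= norm_dotH r (x - y).
Proof.
move=> hx hy; have hxy := dotHB hx hy; have hyx := dotHB hy hx.
have h1 := norm_dotH_le2 hxy hy; have h2 := norm_dotH_le2 hyx hx.
rewrite !subrK in h1 h2.
have h3 : norm_dotH r (y - x) = norm_dotH r (x - y).
  by rewrite -opprB -scaleN1r norm_dotHZ// normrN1 mul1r.
move: h1 h2; rewrite h3 ler_norml.
by move: (norm_dotH r x) (norm_dotH r y) (norm_dotH r (x - y)) => p p' p''; lra.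
Qed.

Lemma fourier_sum_cvg_dotH r x : dotH r x -> norm_dotH r (fourier_sum n x - x) @[n --> \oo] --> (0 : R).
Proof.
move=> hx; have := fourier_sum_cvg he (powL r x).
rewrite [X in X @ _ --> _ -> _](_ : _ = fun n => norm_dotH r (fourier_sum n x - x))//.
apply/funext => n; apply/esym/eq_L2_normE/(coord_inj he) => i.
rewrite powL_coord ?innerBl; last by apply: dotHB => //; exact: dotH_lincomb.
rewrite !(coord_lincomb he) powL_coord//.
by case: ifP => _; rewrite ?sub0r ?subrr ?mulr0// mulrN.
Qed.

Lemma laplacian_coord x i : dotH 2 x -> inner (laplacian lam e x) (e i) = - lam i * inner x (e i).
Proof. by move=> hx; rewrite innerNl powL_coord// lam_powR1 mulNr. Qed.

(** Both sides are the sum of the products lam i * x_i * y_i. *)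
Lemma green x y : dotH 2 x -> dotH 1 y -> inner1 x y = - inner (laplacian lam e x) y.
Proof.
move=> hx hy; rewrite innerNl opprK.
apply: (cvg_unique _ (parseval1 (dotH21 hx) hy)) => //.
have := @parseval _ _ _ _ _ he (powL 2 x) y.
by under eq_fun do under eq_bigr do rewrite powL_coord// lam_powR1 -mulrA.
Qed.

Lemma inner1_e x i : dotH 1 x -> inner1 x (e i) = lam i * inner x (e i).
Proof.
move=> hx; rewrite inner1C (green (dotH_e 2 i) hx).
have /eq_L2_inner -> : laplacian lam e (e i) =ae (- lam i) *: e i.
  apply: (coord_inj he) => j; rewrite laplacian_coord ?innerZl; last exact: dotH_e.
  by rewrite (eigenbasis_orthonormal he); case: eqVneq => [->|]; rewrite ?mulr0.
by rewrite innerZl innerC mulNr opprK.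
Qed.

(** The eigenvalues are bounded below by the first one, so that dividing the
    coordinates of x by them keeps these square summable. *)
Lemma inv_laplacian x : exists2 p, dotH 2 p & laplacian lam e p =ae - x.
Proof.
have lam0 i : lam i != 0 by rewrite gt_eqF// (eigenvalue_gt0 he).
have [p hp] : exists p, forall i, inner p (e i) = inner x (e i) / lam i.
  apply: (riesz_fischer he (M := inner x x / lam 0%N ^+ 2)) => n.
  apply: (@le_trans _ _ (\sum_(i < n) inner x (e i) ^+ 2 / lam 0%N ^+ 2)); last first.
    by rewrite -mulr_suml ler_wpM2r ?invr_ge0 ?sqr_ge0// (bessel he).
  apply: ler_sum => i _; rewrite expr_div_n ler_wpM2l ?sqr_ge0//.
  rewrite lef_pV2 ?posrE ?exprn_gt0 ?(eigenvalue_gt0 he)//.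
  have lamW j : lam j \is Num.nneg by rewrite nnegrE ltW// (eigenvalue_gt0 he).
  by rewrite ler_pXn2r//; exact: (eigenvalue_nondecreasing he).
have p2 : dotH 2 p by exists x => i; rewrite hp lam_powR1 mulrC divfK.
exists p => //; apply: (coord_inj he) => i.
by rewrite laplacian_coord// hp innerNl; field.
Qed.

End fractional_powers.

(** * Hilbert-Schmidt operators and traces *)

Section hilbert_schmidt.
Variables (R : realType) (d : nat) (O : polygonal_domain R d).
Local Notation H := (L2 O).
Variables (lam : nat -> R) (e : nat -> H).
Hypothesis he : dirichlet_eigenbasis lam e.
Implicit Types (x y : H) (K : H -> H).
Local Notation lincomb := (lincomb e).
Local Notation fourier_sum := (fourier_sum e).

Lemma hs_norm_bound K : (hs_norm e K < +oo)%E ->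
  exists M, forall n, \sum_(i < n) norm_L2 (K (e i)) ^+ 2 <= M.
Proof.
rewrite /hs_norm; set S := (X in sqrte X) => hS.
have S0 : (0 <= S)%E by apply: nneseries_ge0 => i _ _; rewrite lee_fin sqr_ge0.
have Sfin : S \is a fin_num.
  by rewrite -sqrte_fin_num// ge0_fin_numE// sqrte_ge0.
exists (fine S) => n; rewrite -lee_fin fineK// -(big_mkord xpredT (fun i => norm_L2 (K (e i)) ^+ 2)).
rewrite -sumEFin; apply: (@nneseries_lim_ge _ (fun i => (norm_L2 (K (e i)) ^+ 2)%:E) xpredT).
by move=> i _; rewrite lee_fin sqr_ge0.
Qed.

Lemma hs_norm_ge K (a : R) i : (hs_norm e K <= a%:E)%E -> norm_L2 (K (e i)) <= a.
Proof.
move=> h; rewrite -lee_fin; apply: le_trans h.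
have -> : (norm_L2 (K (e i)))%:E = sqrte (norm_L2 (K (e i)) ^+ 2)%:E.
  by rewrite /= sqrtr_sqr ger0_norm ?norm_L2_ge0.
rewrite lee_sqrt; last by apply: nneseries_ge0 => j _ _; rewrite lee_fin sqr_ge0.
rewrite (@nneseriesD1 _ _ i)//=; last by move=> j _; rewrite lee_fin sqr_ge0.
by rewrite leeDl// nneseries_ge0// => j _ _; rewrite lee_fin sqr_ge0.
Qed.

Lemma bounded_linear_inner K a x y z : bounded_linear K ->
  inner (K (a *: x + y)) z = a * inner (K x) z + inner (K y) z.
Proof. by move=> [hK _]; rewrite (eq_L2_inner _ (hK a x y)) innerPl. Qed.

Lemma bounded_linear_lincomb K n c z : bounded_linear K ->
  inner (K (lincomb n c)) z = \sum_(i < n) c i * inner (K (e i)) z.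
Proof.
move=> hK; elim: n => [|n IH].
  rewrite lincomb0 big_ord0.
  by have := bounded_linear_inner 1 0 0 z hK; rewrite scaler0 add0r mul1r; lra.
rewrite big_ord_recr/= -IH addrC -bounded_linear_inner//.
by rewrite lincombS.
Qed.

Lemma bounded_linear_expand K x z : bounded_linear K ->
  \sum_(i < n) inner x (e i) * inner (K (e i)) z @[n --> \oo] --> inner (K x) z.
Proof.
move=> hK.
under eq_fun => n do rewrite -(bounded_linear_lincomb n (fun i => inner x (e i)) z hK).
have [_ [C hC]] := hK.
have dE n : inner (K (fourier_sum n x)) z - inner (K x) z = inner (K (fourier_sum n x - x)) z.
  have <- : (-1) *: x + fourier_sum n x = fourier_sum n x - x by rewrite scaleN1r addrC.
  by rewrite bounded_linear_inner// mulN1r addrC.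
apply/cvgrPdist_le => eps e0.
have ey : 0 < eps / (`|C| * norm_L2 z + 1).
  by rewrite divr_gt0// ltr_wpDl ?mulr_ge0 ?norm_L2_ge0.
have /cvgrPdist_le/(_ _ ey) := fourier_sum_cvg he x; apply: filterS => n.
rewrite sub0r normrN ger0_norm ?norm_L2_ge0// => le.
rewrite distrC dE (le_trans (cauchy_schwarz _ _))//.
rewrite ler_pdivlMr in le; last by rewrite ltr_wpDl ?mulr_ge0 ?norm_L2_ge0.
apply: le_trans le; set D := fourier_sum n x - x.
apply: (@le_trans _ _ (`|C| * norm_L2 D * norm_L2 z)).
  rewrite ler_wpM2r ?norm_L2_ge0// (le_trans (hC D))//.
  by rewrite ler_wpM2r ?norm_L2_ge0// ler_norm.
rewrite (_ : _ * _ * _ = norm_L2 D * (`|C| * norm_L2 z)); last by ring.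
by rewrite mulrDr mulr1 lerDl norm_L2_ge0.
Qed.

(** The numbers inner (K (e i)) y are square summable because K is Hilbert-Schmidt,
    so Riesz-Fischer provides an element with these coordinates. *)
Lemma adjointP K x y : bounded_linear K -> (hs_norm e K < +oo)%E ->
  inner (K x) y = inner x (adjoint K y).
Proof.
move=> hK /hs_norm_bound[M hM].
suff : exists z, forall x, inner (K x) y = inner x z.
  by move=> /(xgetPex 0); exact.
have [z hz] : exists z, forall i, inner z (e i) = inner (K (e i)) y.
  apply: (riesz_fischer he (M := M * norm_L2 y ^+ 2)) => n.
  apply: (@le_trans _ _ (\sum_(i < n) norm_L2 (K (e i)) ^+ 2 * norm_L2 y ^+ 2)); last first.
    by rewrite -mulr_suml ler_wpM2r ?sqr_ge0.
  by apply: ler_sum => i _; rewrite !norm_L2_sqr cauchy_schwarz_sqr.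
exists z => {}x; apply: (cvg_unique _ (@bounded_linear_expand _ x y hK)) => //.
by have := @parseval _ _ _ _ _ he x z; under eq_fun do under eq_bigr do rewrite hz.
Qed.

(** The trace and the squared Hilbert-Schmidt norm both sum the squared
    matrix entries of K, by rows and by columns. *)
Lemma trace_adjoint K : bounded_linear K -> (hs_norm e K < +oo)%E ->
  trace e (K \o adjoint K) = (\sum_(0 <= i <oo) (norm_L2 (K (e i)) ^+ 2)%:E)%E.
Proof.
move=> hK hs; rewrite /trace.
under eq_eseriesr => i _.
  rewrite /= adjointP// -(parseval_nneseries he); over.
rewrite nneseries_interchange; last by move=> i j; rewrite lee_fin sqr_ge0.
apply: eq_eseriesr => j _; rewrite norm_L2_sqr -(parseval_nneseries he).
by apply: eq_eseriesr => i _; rewrite innerC -adjointP.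
Qed.

End hilbert_schmidt.

(** * Measurability through Fourier coordinates *)

Lemma cvg_ord_sum (R : realType) (I : Type) (F : set_system I) {FF : Filter F} n
    (f : 'I_n -> I -> R) (l : 'I_n -> R) : (forall j, f j t @[t --> F] --> l j) ->
  \sum_(j < n) f j t @[t --> F] --> \sum_(j < n) l j.
Proof.
elim: n f l => [|n IH] f l fl.
  by rewrite big_ord0; under eq_fun do rewrite big_ord0; exact: cvg_cst.
rewrite big_ord_recr/=; under eq_fun do rewrite big_ord_recr/=.
by apply: cvgD; [apply: IH => j; exact: fl|exact: fl].
Qed.

Section measurability.
Variables (R : realType) (d : nat) (O : polygonal_domain R d).
Local Notation H := (L2 O).
Local Notation mu := (domain_measure O).
Variables (lam : nat -> R) (e : nat -> H).
Hypothesis he : dirichlet_eigenbasis lam e.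
Variables (dT : measure_display) (T : measurableType dT).
Implicit Types (X Y : T -> H).
Local Notation dotH := (dotH lam e).
Local Notation norm_dotH := (norm_dotH lam e).

(** Weak measurability tested on the basis. By Parseval's identity it passes to all
    inner products and to norms. *)
Definition coord_measurable X :=
  forall i, measurable_fun setT (fun w => inner (X w) (e i)).

Lemma coord_measurable_inner X Y : coord_measurable X -> coord_measurable Y ->
  measurable_fun setT (fun w => inner (X w) (Y w)).
Proof.
move=> mX mY; apply: (@measurable_fun_cvg _ _ _ _
  (fun n w => \sum_(i < n) inner (X w) (e i) * inner (Y w) (e i))).
  by move=> n; apply: measurable_sum => i; exact: measurable_funM.
by move=> w _; exact: (@parseval _ _ _ _ _ he).
Qed.

Lemma coord_measurable_cst x : coord_measurable (cst x).
Proof. by move=> i; exact: (@measurable_cst _ _ _ _ setT (inner x (e i))). Qed.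

Lemma coord_measurable_innerl X y : coord_measurable X ->
  measurable_fun setT (fun w => inner (X w) y).
Proof. by move=> mX; apply: coord_measurable_inner => //; exact: coord_measurable_cst. Qed.

Lemma coord_measurable_norm X : coord_measurable X ->
  measurable_fun setT (fun w => norm_L2 (X w)).
Proof.
move=> mX; rewrite (_ : (fun w => _) = (fun w => Num.sqrt (inner (X w) (X w)))); last first.
  by apply/funext => w; exact: norm_L2E.
have msqrt : measurable_fun setT (Num.sqrt : R -> R).
  by apply: continuous_measurable_fun; exact: sqrt_continuous.
exact: (measurableT_comp msqrt (coord_measurable_inner mX mX)).
Qed.

Lemma coord_measurableD X Y : coord_measurable X -> coord_measurable Y ->
  coord_measurable (fun w => X w + Y w).
Proof. by move=> mX mY i; under eq_fun do rewrite innerDl; exact: measurable_funD. Qed.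

Lemma coord_measurableZ (a : T -> R) X : measurable_fun setT a ->
  coord_measurable X -> coord_measurable (fun w => a w *: X w).
Proof. by move=> ma mX i; under eq_fun do rewrite innerZl; exact: measurable_funM. Qed.

Lemma coord_measurableN X : coord_measurable X -> coord_measurable (fun w => - X w).
Proof. by move=> mX i; under eq_fun do rewrite innerNl; exact: measurable_funN. Qed.

Lemma coord_measurableB X Y : coord_measurable X -> coord_measurable Y ->
  coord_measurable (fun w => X w - Y w).
Proof. by move=> mX mY; apply: coord_measurableD => //; exact: coord_measurableN. Qed.

Lemma coord_measurable_sum n (F : 'I_n -> T -> H) :
  (forall i, coord_measurable (F i)) -> coord_measurable (fun w => \sum_(i < n) F i w).
Proof.
by move=> mF i; under eq_fun do rewrite inner_suml; apply: measurable_sum => j; exact: mF.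
Qed.

Lemma coord_measurable_powL r X : (forall w, dotH r (X w)) -> coord_measurable X ->
  coord_measurable (fun w => powL lam e r (X w)).
Proof.
by move=> hX mX i; under eq_fun do rewrite powL_coord//; exact: measurable_funM.
Qed.

Lemma measurable_continuous_row n (Psi : 'rV[R]_n -> R) (c : 'I_n -> T -> R) :
  continuous Psi -> (forall j, measurable_fun setT (c j)) ->
  measurable_fun setT (fun w => Psi (\row_j c j w)).
Proof.
move=> cPsi mc.
have mPsi : measurable_fun setT (Psi : euclid R n -> R).
  apply: (measurability _ (RGenOpens.measurableE R)).
  move=> _ [_ [a [b ->] <-]]; rewrite setTI; apply: sub_sigma_algebra.
  by move/continuousP : cPsi; apply; exact: interval_open.
rewrite (_ : (fun w => _) = Psi \o @euclid_of_tuple R n \o (fun w => [tuple c j w | j < n])).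
  apply: measurableT_comp; first exact: measurableT_comp (@measurable_euclid_of_tuple R n).
  apply/measurable_fun_tnthP => j.
  by rewrite (_ : _ \o _ = c j)//; apply/funext => w /=; rewrite tnth_mktuple.
apply/funext => w /=; congr Psi; apply/rowP => j.
by rewrite !mxE tnth_mktuple.
Qed.

(** A map that is Lipschitz on bounded sets of dotH^1 is Borel for the weak
    L^2-structure: along Fourier sums it is a continuous function of finitely
    many coordinates, and Fourier sums converge in dotH^1. *)
Lemma coord_measurable_lipschitz (Phi : H -> H) (B : R -> R -> R) X :
  (forall r, exists C, forall a b, 0 <= a <= r -> 0 <= b <= r -> B a b <= C) ->
  (forall x y, dotH 1 x -> dotH 1 y ->
     norm_L2 (Phi x - Phi y) <= B (norm_dotH 1 x) (norm_dotH 1 y) * norm_dotH 1 (x - y)) ->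
  (forall w, dotH 1 (X w)) -> coord_measurable X -> coord_measurable (Phi \o X).
Proof.
move=> hB hPhi hX mX i.
(* Used for a neighbourhood filter and along Fourier sums. *)
have seqc (I : Type) (F : set_system I) (FF : Filter F) (Y : I -> H) x : dotH 1 x ->
    (forall t, dotH 1 (Y t)) -> norm_dotH 1 (Y t - x) @[t --> F] --> (0 : R) ->
    inner (Phi (Y t)) (e i) @[t --> F] --> inner (Phi x) (e i).
  move=> hx hY Yx; have [C hC] := hB (norm_dotH 1 x + 1).
  apply/cvgrPdist_le => eps e0.
  have ey : 0 < eps / (`|C| + 1) by rewrite divr_gt0// ltr_wpDl.
  have /cvgrPdist_le h := Yx; have := h _ ltr01; have := h _ ey.
  apply: filterS2 => t; rewrite !sub0r !normrN !(ger0_norm (norm_dotH_ge0 _ _ _ _)) => h1 h2.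
  have nY : norm_dotH 1 (Y t) <= norm_dotH 1 x + 1.
    have := norm_dotHB he (hY t) hx; have := ler_norm (norm_dotH 1 (Y t) - norm_dotH 1 x); lra.
  have e1 : norm_L2 (e i) = 1.
    by rewrite norm_L2E (eigenbasis_orthonormal he) eqxx sqrtr1.
  rewrite distrC -innerBl (le_trans (cauchy_schwarz _ _))// e1 mulr1.
  apply: le_trans (hPhi _ _ (hY t) hx) _.
  rewrite ler_pdivlMr ?ltr_wpDl// in h1; apply: le_trans h1; rewrite mulrC.
  apply: ler_wpM2l; first exact: norm_dotH_ge0.
  apply: (@le_trans _ _ C); last by rewrite (le_trans (ler_norm _))// lerDl.
  by apply: hC; rewrite norm_dotH_ge0/= ?nY// lerDl.
apply: (@measurable_fun_cvg _ _ _ _ (fun n w => inner (Phi (fourier_sum e n (X w))) (e i))).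
  move=> n.
  pose L (c : 'rV[R]_n) : H := \sum_(j < n) c ord0 j *: e j.
  have hL c : dotH 1 (L c).
    by apply: dotH_sum => j; apply: dotHZ; exact: dotH_e he _ _.
  have cL : continuous (fun c => inner (Phi (L c)) (e i)).
    move=> c; apply: (seqc _ (nbhs c) (nbhs_filter c) L (L c)) => //.
    have LB c' : L c' - L c = \sum_(j < n) (c' ord0 j - c ord0 j) *: e j.
      by rewrite -sumrB; apply: eq_bigr => j _; rewrite scalerBl.
    have bnd : (fun c' : 'rV[R]_n =>
        \sum_(j < n) `|c' ord0 j - c ord0 j| * norm_dotH 1 (e j)) @ c --> (0 : R).
      rewrite [X in _ --> X](_ : _ = \sum_(j < n) `|c ord0 j - c ord0 j| * norm_dotH 1 (e j)); last first.
        by rewrite big1// => j _; rewrite subrr normr0 mul0r.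
      apply: (@cvg_ord_sum R _ (nbhs c) _ n
        (fun j (c' : 'rV[R]_n) => `|c' ord0 j - c ord0 j| * norm_dotH 1 (e j))
        (fun j => `|c ord0 j - c ord0 j| * norm_dotH 1 (e j))) => j.
      apply: cvgM; last exact: cvg_cst.
      apply: cvg_norm; apply: cvgB; last exact: cvg_cst.
      exact: coord_continuous.
    have /cvgrPdist_le hb := bnd; apply/cvgrPdist_le => eps /hb; apply: filterS => c'.
    rewrite !sub0r !normrN (ger0_norm (norm_dotH_ge0 _ _ _ _)); apply: le_trans.
    rewrite LB (le_trans _ (ler_norm _))// (le_trans (norm_dotH_sum he _))//.
      by move=> j; apply: dotHZ; exact: dotH_e he _ _.
    by apply: ler_sum => j _; rewrite (norm_dotHZ he)//; exact: dotH_e he _ _.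
  apply: eq_measurable_fun (measurable_continuous_row cL (fun j : 'I_n => mX j)) => w _.
  have rowE : L (\row_j inner (X w) (e j)) = fourier_sum e n (X w).
    by apply: eq_bigr => j _; rewrite mxE.
  by rewrite rowE.
move=> w _; apply: seqc => //; first by move=> n; exact: dotH_lincomb.
by apply: (fourier_sum_cvg_dotH he); exact: hX.
Qed.

End measurability.

Lemma eval2_bound (R : realType) (b : mpoly.mpoly 2 R) (r : R) :
  exists C, forall x y, 0 <= x <= r -> 0 <= y <= r -> eval2 b x y <= C.
Proof.
exists (\sum_(m <- mpoly.msupp b) `|mpoly.mcoeff m b| * \prod_(i < 2) r ^+ (mpoly.fun_of_multinom m i)).
move=> x y /andP[x0 xr] /andP[y0 yr]; rewrite /eval2 mpoly.mevalE.
apply: ler_sum => m _; rewrite (le_trans (ler_norm _))// normrM ler_wpM2l//.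
rewrite normr_prod; apply: ler_prod => i _; rewrite normrX exprn_ge0//=.
by case: ifP => _; rewrite ger0_norm// lerXn2r// nnegrE (le_trans _ xr).
Qed.

(** * Measurability of the potential *)

Section finite_domain.
Variables (R : realType).

Section finite_copy.
Context dT (T : measurableType dT) (k : {measure set T -> \bar R}).
Hypothesis kfin : fin_num_fun k.

(** An alias on which the structure of finite measure can be declared. *)
Definition finite_copy of fin_num_fun k : set T -> \bar R := k.
Local Notation copy := (finite_copy kfin).

Let copy0 : copy set0 = 0%E. Proof. exact: measure0. Qed.
Let copy_ge0 A : (0 <= copy A)%E. Proof. exact: measure_ge0. Qed.
Let copy_additive : semi_sigma_additive copy.
Proof. exact: measure_semi_sigma_additive. Qed.

HB.instance Definition _ := isMeasure.Build _ _ _ copy copy0 copy_ge0 copy_additive.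
HB.instance Definition _ := Measure_isFinite.Build _ _ _ copy kfin.

End finite_copy.

Definition tuple_cube (n : nat) (M : R) : set (n.-tuple R) :=
  [set t | forall i, `|tnth t i| <= M].
Arguments tuple_cube : clear implicits.

Lemma measurable_tuple_cube n M : measurable (tuple_cube n M).
Proof.
have -> : tuple_cube n M =
    \big[setI/setT]_(i < n) ((fun t : n.-tuple R => tnth t i) @^-1` `[- M, M]).
  rewrite predeqE => t; split=> [h|].
    by apply: (big_ind (fun A : set _ => A t)) => // i _ /=; rewrite in_itv/= -ler_norml h.
  by move=> /[swap] i; rewrite (bigD1 i)//= in_itv/= -ler_norml => -[].
apply: big_ind => // [|i _]; first exact: measurableI.
rewrite -[X in measurable X]setTI; exact: (@measurable_tnth _ R n i).
Qed.

Lemma lebesgue_tuple_cube n M : (lebesgue_tuple R n (tuple_cube n M) < +oo)%E.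
Proof.
elim: n => [|n IH] /=.
  by rewrite diracE; case: (_ \in _); rewrite ltry.
rewrite /pushforward.
have -> : @cons_coord R n @^-1` tuple_cube n.+1 M = tuple_cube n M `*` `[- M, M].
  rewrite predeqE => -[t x]; split=> /= [h|[h hx] i].
    split=> [i|]; last by have := h ord0; rewrite in_itv/= -ler_norml.
    by have := h (lift ord0 i); rewrite tnthS.
  case: (unliftP ord0 i) => [j|] ->; first by rewrite tnthS; exact: h.
  by rewrite tnth0 ler_norml; rewrite in_itv in hx.
rewrite product_measure1E//; last exact: measurable_tuple_cube.
have h1 : (lebesgue_measure `[(- M)%R, M] < +oo)%E.
  by rewrite lebesgue_measure_itv; case: ifP; rewrite ?ltry.
by rewrite lte_mul_pinfty// ge0_fin_numE.
Qed.

(** A bounded domain lies in a cube. *)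
Lemma domain_measure_fin d (O : polygonal_domain R d) : fin_num_fun (domain_measure O).
Proof.
apply: lty_fin_num_fun; have [M [_ /(_ (M + 1))]] := domain_bounded O.
rewrite ltrDl => /(_ ltr01) hM.
apply: le_lt_trans (lebesgue_tuple_cube d (M + 1)).
rewrite /domain_measure/= /mrestr setTI /pushforward.
apply: le_measure; rewrite ?inE; [|exact: measurable_tuple_cube|].
  by apply: open_measurable_tuple; exact: domain_open.
move=> t /= Ot i; have := hM _ Ot; apply: le_trans.
rewrite [leRHS]/Num.norm /= mx_normrE; apply/bigmax_geP; right => /=.
by exists (ord0, i); rewrite //= mxE.
Qed.

End finite_domain.

Section potential_measurability.
Variables (R : realType) (d : nat) (O : polygonal_domain R d).
Local Notation H := (L2 O).
Local Notation mu := (domain_measure O).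
Variables (lam : nat -> R) (e : nat -> H).
Hypothesis he : dirichlet_eigenbasis lam e.
Variables (dT : measure_display) (T : measurableType dT).
Variable X : T -> H.
Hypothesis mX : coord_measurable e X.

Let tail m w := inner (X w - fourier_sum e m (X w)) (X w - fourier_sum e m (X w)).

Let tail_small k w : exists m, tail m w <= 8^-1 ^+ k.
Proof.
have e0 : 0 < Num.sqrt ((8^-1 : R) ^+ k) by rewrite sqrtr_gt0 exprn_gt0.
have /cvgrPdist_le/(_ _ e0)[m _ /(_ m (leqnn m))] := eigenbasis_total he (X w).
rewrite sub0r normrN ger0_norm ?norm_L2_ge0// norm_L2E ler_sqrt ?exprn_ge0//.
by exists m.
Qed.

(** The number of modes depends on w, so that for each w the convergence is fast enough
    for fast_ae_bound. *)
Let level k w := ex_minn (tail_small k w).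
Let U k w : H := fourier_sum e (level k w) (X w).

Let level_bound k w : inner (U k w - X w) (U k w - X w) <= 8^-1 ^+ k.
Proof.
rewrite /U /level; case: ex_minnP => m + _; rewrite /tail.
by rewrite -!norm_L2_sqr norm_L2_distC.
Qed.

Let measurable_level k m : measurable [set w | level k w = m].
Proof.
have mD j : measurable [set w | tail j w <= 8^-1 ^+ k].
  have mt : measurable_fun setT (tail j).
    have mB : coord_measurable e (fun w => X w - fourier_sum e j (X w)).
      apply: coord_measurableB => //; apply: coord_measurable_sum => i.
      apply: coord_measurableZ; [exact: mX|exact: coord_measurable_cst].
    exact: (coord_measurable_inner he mB mB).
  rewrite (_ : [set _ | _] = setT `&` tail j @^-1` `]-oo, 8^-1 ^+ k]).
    by apply: mt => //; exact: measurable_itv.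
  by rewrite setTI predeqE => w /=; rewrite in_itv.
have -> : [set w | level k w = m] = [set w | tail m w <= 8^-1 ^+ k] `&`
    \bigcap_(j in [set j | (j < m)%N]) ~` [set w | tail j w <= 8^-1 ^+ k].
  rewrite predeqE => w; split=> /=.
    rewrite /level; case: ex_minnP => l hl hmin <-; split=> // j /= jl hj.
    by have := hmin j hj; rewrite leqNgt jl.
  move=> [hm hj]; rewrite /level; case: ex_minnP => l hl hmin.
  apply/eqP; rewrite eqn_leq hmin//= leqNgt; apply/negP => lm.
  exact: (hj l lm).
apply: measurableI => //; rewrite -[X in measurable X]setCK setC_bigcap.
apply: measurableC; apply: bigcup_measurable => j _.
by rewrite setCK.
Qed.

(** On each level set, U k is a finite sum of products of a coordinate of X with a
    basis function. *)
Let measurable_U k : measurable_fun setT (fun z : T * euclid R d => U k z.1 z.2).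
Proof.
pose h M (z : T * euclid R d) := \sum_(m < M)
   \1_[set w | level k w = m] z.1 * fourier_sum e m (X z.1) z.2.
apply: (@measurable_fun_cvg _ _ _ _ h) => [M|z _].
  apply: measurable_sum => m; apply: measurable_funM.
    by apply: measurableT_comp => //; exact: measurable_indic.
  rewrite (_ : (fun _ => _) = fun z : T * euclid R d =>
      \sum_(i < m) inner (X z.1) (e i) * e i z.2).
    apply: measurable_sum => i; apply: measurable_funM.
      exact: (measurableT_comp (mX i) measurable_fst).
    by apply: (measurableT_comp _ measurable_snd); exact: measurable_funP.
  apply/funext => z; rewrite /fourier_sum /lincomb.
  by elim/big_rec2: _ => // i y1 y2 _ <-.
apply: cvg_near_cst; near=> M; rewrite /h.
have lM : (level k z.1 < M)%N by near: M; exact: nbhs_infty_gt.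
rewrite (bigD1 (Ordinal lM))//= big1 ?addr0 => [|i iM].
  by rewrite indicE mem_set// mul1r.
rewrite indicE memNset ?mul0r//= => /esym il.
by move/eqP: iM; apply; apply: val_inj.
Unshelve. all: by end_near. Qed.

(** The value X w t need not be jointly measurable in (w, t), the representatives
    X w being chosen independently for each w. The approximations U k are jointly
    measurable, and for each w they converge to X w almost everywhere; Tonelli's
    theorem applies to the upper limit of G (U k). *)
Lemma measurable_integral_comp (G : R -> R) : continuous G -> (forall x, 0 <= G x) ->
  measurable_fun setT (fun w => \int[mu]_t (G (X w t))%:E)%E.
Proof.
move=> cG G0.
have mG : measurable_fun setT G by exact: continuous_measurable_fun.
pose h (z : T * euclid R d) := limn_esup (fun k => (G (U k z.1 z.2))%:E).
have mh : measurable_fun setT h.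
  apply: measurable_fun_limn_esup => k; apply/measurable_EFinP.
  exact: (measurableT_comp mG (measurable_U k)).
have h0 z : (0 <= h z)%E.
  rewrite /h limn_esup_lim; apply: lime_ge; first exact: is_cvg_esups.
  near=> n; apply: (@le_trans _ _ (G (U n z.1 z.2))%:E); first by rewrite lee_fin.
  by apply: ereal_sup_ubound; exists n => /=.
rewrite (_ : (fun _ => _) = fubini_F mu h).
  exact: (@measurable_fun_fubini_tonelli_F _ _ _ _ _ (finite_copy (domain_measure_fin O)) h mh h0).
apply/funext => w; apply: ge0_ae_eq_integral => //.
- by apply/measurable_EFinP; apply: (measurableT_comp mG); exact: measurable_funP.
- by apply: (measurableT_comp mh); exact: measurable_pair1.
- by move=> t _; rewrite lee_fin.
have := fast_ae_bound (fun k => level_bound k w).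
apply: filterS => t [C hC] _.
have Ut : U k w t @[k --> \oo] --> X w t.
  have c2 : C * 2^-1 ^+ k @[k --> \oo] --> (0 : R).
    rewrite -[X in _ --> X](mulr0 C); apply: cvgM; first exact: cvg_cst.
    by apply: cvg_expr; rewrite ger0_norm; lra.
  apply/cvgrPdist_le => eps e0.
  have /cvgrPdist_le/(_ _ e0) := c2; apply: filterS => k; rewrite sub0r normrN => h1.
  rewrite distrC; apply: le_trans (hC k) _; exact: le_trans (ler_norm _) h1.
rewrite /h; have /cvg_limn_einf_sup[_ ->] // : (G (U k w t))%:E @[k --> \oo] --> (G (X w t))%:E.
apply: cvg_EFin; first exact: nearW.
exact: (continuous_cvg _ (cG _) Ut).
Unshelve. all: by end_near. Qed.

Lemma measurable_potential (Ft : R -> R) : continuous Ft ->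
  measurable_fun setT (fun w => potential Ft (X w)).
Proof.
move=> cF.
have c0 : continuous (fun _ : R => 0 : R) by move=> x; exact: cst_continuous.
have cp : continuous (fun x => Num.max (Ft x) 0) by apply: (max_fun_continuous cF c0).
have cNF : continuous (fun x => - Ft x) by move=> x; apply: continuousN; exact: cF.
have cn : continuous (fun x => Num.max (- Ft x) 0) by apply: (max_fun_continuous cNF c0).
have m0 x : 0 <= Num.max x 0 :> R by rewrite le_max lexx orbT.
have mp := measurable_integral_comp cp (fun x => m0 (Ft x)).
have mn := measurable_integral_comp cn (fun x => m0 (- Ft x)).
rewrite (_ : (fun _ => _) = fine \o (fun w =>
   \int[mu]_t (Num.max (Ft (X w t)) 0)%:E - \int[mu]_t (Num.max (- Ft (X w t)) 0)%:E)%E).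
  apply: measurableT_comp; first exact: fine_measurable.
  exact: emeasurable_funB.
apply/funext => w /=; rewrite /potential /Rintegral integralE; congr (fine (_ - _))%E.
  by apply: eq_integral => t _; rewrite funeposE EFin_max.
by apply: eq_integral => t _; rewrite funenegE EFin_max.
Qed.

End potential_measurability.

(** * The energy space and the wave operator *)

Lemma discriminant_le (R : realType) (a b c : R) : 0 <= a ->
  (forall t, 0 <= a * t ^+ 2 + b * 2 * t + c) -> b ^+ 2 <= a * c.
Proof.
move=> a0 h; have [x0|x0] := eqVneq a 0.
  rewrite x0 mul0r; have [->|xy] := eqVneq b 0; first by rewrite expr0n.
  have := h (- (c + 1) / (2 * b)).
  have -> : b * 2 * (- (c + 1) / (2 * b)) = - (c + 1) by field.
  by rewrite x0; lra.
have xx : 0 < a by rewrite lt_neqAle eq_sym x0.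
have := h (- b / a).
have -> : a * (- b / a) ^+ 2 + b * 2 * (- b / a) + c = (a * c - b ^+ 2) / a by field.
by rewrite pmulr_lge0 ?invr_gt0// subr_ge0.
Qed.

(** Locked for the same reason as inner1. *)
HB.lock Definition inner_HH1 (R : realType) (d : nat) (O : polygonal_domain R d)
    (lam : nat -> R) (e : nat -> L2 O) (X Y : L2 O * L2 O) : R :=
  inner1 lam e X.1 Y.1 + inner X.2 Y.2.

Section energy_space.
Variables (R : realType) (d : nat) (O : polygonal_domain R d).
Local Notation H := (L2 O).
Variables (lam : nat -> R) (e : nat -> H).
Hypothesis he : dirichlet_eigenbasis lam e.
Implicit Types (x y : H) (X Y Z : H * H).
Local Notation dotH := (dotH lam e).
Local Notation HH1 := (HH1 lam e).
Local Notation norm_HH1 := (norm_HH1 lam e).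
Local Notation inner1 := (inner1 lam e).
Local Notation wave_dom := (wave_dom lam e).
Local Notation wave_op := (wave_op lam e).

Local Notation inner_HH1 := (inner_HH1 lam e).
Local Notation "<< X , Y >>" := (inner_HH1 X Y).

Lemma norm_HH1_sqr X : norm_HH1 X ^+ 2 = << X, X >>.
Proof.
rewrite /Defs.norm_HH1 sqr_sqrtr ?addr_ge0 ?sqr_ge0//.
by rewrite inner_HH1.unlock -norm_dotH1_sqr -norm_L2_sqr.
Qed.

Lemma norm_HH1_ge0 X : 0 <= norm_HH1 X. Proof. exact: sqrtr_ge0. Qed.

Lemma inner_HH1C X Y : << X, Y >> = << Y, X >>.
Proof. by rewrite inner_HH1.unlock inner1C innerC. Qed.

Lemma HH1D X Y : HH1 X -> HH1 Y -> HH1 (X + Y).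
Proof. exact: dotHD. Qed.

Lemma HH1Z a X : HH1 X -> HH1 (a *: X).
Proof. exact: dotHZ. Qed.

Lemma HH1B X Y : HH1 X -> HH1 Y -> HH1 (X - Y).
Proof. exact: dotHB. Qed.

Lemma HH1_ext X Y : HH1 X -> eq_HH X Y -> HH1 Y.
Proof. by move=> hX [h _]; exact: dotH_ext h. Qed.

Lemma inner_HH1Pl a X Y Z : HH1 X -> HH1 Y ->
  << a *: X + Y, Z >> = a * << X, Z >> + << Y, Z >>.
Proof.
move=> hX hY; have h1 := inner1Pl he a Z.1 hX hY; have h2 := innerPl a X.2 Y.2 Z.2.
rewrite inner_HH1.unlock -[(a *: X + Y).1]/(a *: X.1 + Y.1) h1.
by rewrite -[(a *: X + Y).2]/(a *: X.2 + Y.2) h2 mulrDr addrACA.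
Qed.

Lemma HH10 : HH1 0. Proof. exact: dotH0. Qed.

Lemma inner_HH10l Z : << 0, Z >> = 0.
Proof.
have := inner_HH1Pl (-1) Z HH10 HH10.
by rewrite scaler0 addr0 mulN1r addNr.
Qed.

Lemma inner_HH1Zl a X Z : HH1 X -> << a *: X, Z >> = a * << X, Z >>.
Proof.
move=> hX; have := inner_HH1Pl a Z hX HH10.
by rewrite inner_HH10l [_ *: X + 0]addr0 addr0.
Qed.

Lemma inner_HH1Dl X Y Z : HH1 X -> HH1 Y -> << X + Y, Z >> = << X, Z >> + << Y, Z >>.
Proof. by move=> hX hY; have := inner_HH1Pl 1 Z hX hY; rewrite scale1r mul1r. Qed.

Lemma inner_HH1Bl X Y Z : HH1 X -> HH1 Y -> << X - Y, Z >> = << X, Z >> - << Y, Z >>.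
Proof.
move=> hX hY; have := inner_HH1Pl (-1) Z hY hX.
by rewrite scaleN1r mulN1r ![- _ + _]addrC.
Qed.

Lemma inner_HH1Dr X Y Z : HH1 X -> HH1 Y -> << Z, X + Y >> = << Z, X >> + << Z, Y >>.
Proof. by move=> hX hY; rewrite ![<< Z, _ >>]inner_HH1C inner_HH1Dl. Qed.

Lemma inner_HH1Br X Y Z : HH1 X -> HH1 Y -> << Z, X - Y >> = << Z, X >> - << Z, Y >>.
Proof. by move=> hX hY; rewrite ![<< Z, _ >>]inner_HH1C inner_HH1Bl. Qed.

Lemma inner_HH1Zr a X Z : HH1 X -> << Z, a *: X >> = a * << Z, X >>.
Proof. by move=> hX; rewrite ![<< Z, _ >>]inner_HH1C inner_HH1Zl. Qed.

Lemma inner_HH1_extl X X' Z : HH1 X -> eq_HH X X' -> << X, Z >> = << X', Z >>.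
Proof.
move=> hX [h1 h2]; rewrite inner_HH1.unlock (eq_L2_inner _ h2); congr (_ + _).
by rewrite inner1.unlock; apply: eq_L2_inner; exact: (powL_ext he hX h1).
Qed.

Lemma inner_HH1_ext X X' : HH1 X -> eq_HH X X' -> << X, X >> = << X', X' >>.
Proof.
by move=> hX h; rewrite (inner_HH1_extl _ hX h) inner_HH1C (inner_HH1_extl _ hX h).
Qed.

Lemma inner_HH1_ge0 X : 0 <= << X, X >>.
Proof. by rewrite inner_HH1.unlock inner1.unlock addr_ge0// inner_ge0. Qed.

Lemma cauchy_schwarz_HH1 X Y : HH1 X -> HH1 Y -> `|<< X, Y >>| <= norm_HH1 X * norm_HH1 Y.
Proof.
move=> hX hY; rewrite -(@ler_pXn2r _ 2)// ?nnegrE ?mulr_ge0 ?norm_HH1_ge0//.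
rewrite real_normK ?num_real// exprMn !norm_HH1_sqr.
apply: discriminant_le; first exact: inner_HH1_ge0.
move=> t; have := inner_HH1_ge0 (t *: X + Y).
have hZ := HH1Z t hX.
rewrite inner_HH1Pl// !inner_HH1Dr// !inner_HH1Zr// [<< Y, X >>]inner_HH1C; nra.
Qed.

Lemma eq_HH_sym X Y : eq_HH X Y -> eq_HH Y X.
Proof. by move=> [h1 h2]; split; exact: eq_L2_sym. Qed.

Lemma eq_HH_trans X Y Z : eq_HH X Y -> eq_HH Y Z -> eq_HH X Z.
Proof.
by move=> [a1 a2] [b1 b2]; split; apply: (coord_inj he) => i;
   rewrite ?(coord_ext e a1) ?(coord_ext e b1) ?(coord_ext e a2) ?(coord_ext e b2).
Qed.

Lemma eq_HHPl a X X' Y Y' : eq_HH X X' -> eq_HH Y Y' -> eq_HH (a *: X + Y) (a *: X' + Y').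
Proof.
move=> [a1 a2] [b1 b2]; split; apply: (coord_inj he) => i;
  by rewrite /= !innerPl ?(coord_ext e a1) ?(coord_ext e b1) ?(coord_ext e a2) ?(coord_ext e b2).
Qed.

Lemma eq_HHD X X' Y Y' : eq_HH X X' -> eq_HH Y Y' -> eq_HH (X + Y) (X' + Y').
Proof. by move=> h1 h2; have := eq_HHPl 1 h1 h2; rewrite !scale1r. Qed.

Lemma eq_HH_refl X : eq_HH X X.
Proof. by split; exact: eq_L2_refl. Qed.

Lemma norm_HH1_ext X X' : HH1 X -> eq_HH X X' -> norm_HH1 X = norm_HH1 X'.
Proof.
move=> hX h; apply/eqP; rewrite -(@eqrXn2 _ 2)// ?norm_HH1_ge0//.
by rewrite !norm_HH1_sqr (inner_HH1_ext hX h).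
Qed.

Lemma inner_HH1_cvg (I : Type) (F : set_system I) {FF : Filter F} (Y : I -> H * H) Y0 Z :
  HH1 Y0 -> HH1 Z -> (forall t, HH1 (Y t)) -> norm_HH1 (Y t - Y0) @[t --> F] --> (0 : R) ->
  << Y t, Z >> @[t --> F] --> << Y0, Z >>.
Proof.
move=> h0 hZ hY cY; apply/cvgrPdist_le => eps e0.
have ey : 0 < eps / (norm_HH1 Z + 1) by rewrite divr_gt0// ltr_wpDl ?norm_HH1_ge0.
have /cvgrPdist_le/(_ _ ey) := cY; apply: filterS => t.
rewrite !sub0r !normrN (ger0_norm (norm_HH1_ge0 _)) => le.
have hYt : HH1 (Y t - Y0) by exact: HH1B.
rewrite distrC -inner_HH1Bl// (le_trans (cauchy_schwarz_HH1 hYt hZ))//.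
rewrite ler_pdivlMr in le; last by rewrite ltr_wpDl ?norm_HH1_ge0.
by apply: le_trans le; rewrite ler_wpM2l ?norm_HH1_ge0// lerDl.
Qed.

Lemma norm_HH1_cvg (I : Type) (F : set_system I) {FF : Filter F} (Y : I -> H * H) Y0 :
  HH1 Y0 -> (forall t, HH1 (Y t)) -> norm_HH1 (Y t - Y0) @[t --> F] --> (0 : R) ->
  << Y t, Y t >> @[t --> F] --> << Y0, Y0 >>.
Proof.
move=> h0 hY cY.
have -> : (fun t => << Y t, Y t >>) = (fun t =>
    norm_HH1 (Y t - Y0) * norm_HH1 (Y t - Y0) + (2 * << Y t, Y0 >> - << Y0, Y0 >>)).
  apply/funext => t; rewrite -expr2 norm_HH1_sqr (inner_HH1Br _ (hY t) h0).
  by rewrite !(inner_HH1Bl _ (hY t) h0) [<< Y0, Y t >>]inner_HH1C; ring.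
rewrite [X in _ --> X](_ : _ = 0 * 0 + (2 * << Y0, Y0 >> - << Y0, Y0 >>)); last by ring.
apply: cvgD; first exact: cvgM.
apply: cvgB; last exact: cvg_cst.
by apply: cvgM; [exact: cvg_cst|exact: inner_HH1_cvg].
Qed.

Lemma inner_HH1_e1 X i : HH1 X -> << X, (e i, 0) >> = lam i * inner X.1 (e i).
Proof. by move=> hX; rewrite inner_HH1.unlock inner0r addr0 (inner1_e he). Qed.

Lemma inner_HH1_e2 X i : HH1 X -> << X, (0, e i) >> = inner X.2 (e i).
Proof.
move=> hX; rewrite inner_HH1.unlock/= inner1C -[X in inner1 X](scale0r 0).
by rewrite (inner1Zl he) ?mul0r ?add0r//; exact: dotH0.
Qed.

Lemma HH1_coord0 X : HH1 X -> (forall i, << X, (e i, 0) >> = 0 /\ << X, (0, e i) >> = 0) ->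
  eq_HH X 0.
Proof.
move=> hX h; split; apply: (coord_inj he) => i; rewrite inner0l.
  have [/eqP + _] := h i; rewrite inner_HH1_e1// mulf_eq0 gt_eqF ?(eigenvalue_gt0 he)//=.
  by move/eqP.
by have [_] := h i; rewrite inner_HH1_e2.
Qed.

Lemma wave_dom_HH1 X : wave_dom X -> HH1 X.
Proof. by move=> [h _]; exact: dotH21. Qed.

Lemma wave_op_HH1 X : wave_dom X -> HH1 (wave_op X).
Proof. by move=> [_ h]. Qed.

(** Green's formula cancels the two cross terms. *)
Lemma wave_op_skew X : wave_dom X -> << X, wave_op X >> = 0.
Proof.
move=> [h1 h2]; rewrite inner_HH1.unlock/= (green he h1 h2).
by rewrite [inner X.2 _]innerC addNr.
Qed.

Lemma wave_op_inj X Y : wave_dom X -> wave_dom Y -> eq_HH (wave_op X) (wave_op Y) ->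
  eq_HH X Y.
Proof.
move=> [h1 h2] [k1 k2] [/= a b]; split=> //; apply: (coord_inj he) => i.
have := coord_ext e b i; rewrite !(laplacian_coord he)//.
by apply: mulfI; rewrite oppr_eq0 gt_eqF// (eigenvalue_gt0 he).
Qed.

Lemma wave_opB X Y : wave_dom X -> wave_dom Y ->
  wave_dom (X - Y) /\ eq_HH (wave_op (X - Y)) (wave_op X - wave_op Y).
Proof.
move=> [h1 h2] [k1 k2]; split; first by split; exact: dotHB.
split; first exact: eq_L2_refl.
apply: (coord_inj he) => i; rewrite innerBl !(laplacian_coord he)//; last exact: dotHB.
by rewrite /= innerBl; ring.
Qed.

Variable E : R -> H * H -> H * H.
Hypothesis hE : wave_group lam e E.

Lemma wave_groupB t X Y : HH1 X -> HH1 Y -> eq_HH (E t (X - Y)) (E t X - E t Y).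
Proof.
move=> hX hY; have := wave_group_linear hE t (-1) hY hX.
by rewrite !scaleN1r ![- _ + _]addrC.
Qed.

Lemma wave_groupD1 t X Y : HH1 X -> HH1 Y -> eq_HH (E t (X + Y)) (E t X + E t Y).
Proof. by move=> hX hY; have := wave_group_linear hE t 1 hX hY; rewrite !scale1r. Qed.

Lemma wave_group00 t : eq_HH (E t 0) 0.
Proof. by have := wave_groupB t HH10 HH10; rewrite !subrr. Qed.

Lemma wave_groupZ t a X : HH1 X -> eq_HH (E t (a *: X)) (a *: E t X).
Proof.
move=> hX; have := wave_group_linear hE t a hX HH10; rewrite addr0 => h.
apply: eq_HH_trans h _; have := eq_HHPl a (eq_HH_refl (E t X)) (wave_group00 t).
by rewrite addr0.
Qed.

(** E t acts on representatives; being linear and bounded, it respects almost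
    everywhere equality. *)
Lemma wave_group_ext t X Y : HH1 X -> eq_HH X Y -> eq_HH (E t X) (E t Y).
Proof.
move=> hX hXY; have hY := HH1_ext hX hXY; have [C hC] := wave_group_bounded hE t.
have hD := HH1B hX hY.
have n0 : norm_HH1 (X - Y) = 0.
  apply/eqP; rewrite -sqrf_eq0 norm_HH1_sqr inner_HH1Bl// (inner_HH1_extl _ hX hXY).
  by rewrite subrr.
have n1 : norm_HH1 (E t (X - Y)) = 0.
  apply/eqP; rewrite eq_le norm_HH1_ge0 andbT.
  by have := hC _ hD; rewrite n0 mulr0.
have hED := wave_group_stable hE t hD.
have z i : << E t (X - Y), (e i, 0) >> = 0 /\ << E t (X - Y), (0, e i) >> = 0.
  by split; apply/eqP; rewrite -normr_le0; apply: (le_trans (cauchy_schwarz_HH1 hED _));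
    rewrite ?n1 ?mul0r//; [exact: dotH_e|exact: dotH0].
have := HH1_coord0 hED z => h; have := eq_HHD h (eq_HH_refl (E t Y)).
rewrite add0r; apply: eq_HH_trans; apply: eq_HH_sym.
have := eq_HHD (wave_groupB t hX hY) (eq_HH_refl (E t Y)).
by rewrite subrK.
Qed.
End energy_space.

(** * The wave group *)

Section wave_isometry.
Variables (R : realType) (d : nat) (O : polygonal_domain R d).
Local Notation H := (L2 O).
Variables (lam : nat -> R) (e : nat -> H).
Hypothesis he : dirichlet_eigenbasis lam e.
Variable E : R -> H * H -> H * H.
Hypothesis hE : wave_group lam e E.
Implicit Types (x y : H) (X Y Z : H * H).
Local Notation dotH := (dotH lam e).
Local Notation HH1 := (HH1 lam e).
Local Notation norm_HH1 := (norm_HH1 lam e).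
Local Notation wave_dom := (wave_dom lam e).
Local Notation wave_op := (wave_op lam e).
Local Notation "<< X , Y >>" := (inner_HH1 lam e X Y).
Local Notation EHH1 := (wave_group_stable hE).
Local Notation "X =hh Y" := (eq_HH X Y) (at level 70).

Lemma wave_group_bound t :
  exists2 C, 0 <= C & forall Z, HH1 Z -> norm_HH1 (E t Z) <= C * norm_HH1 Z.
Proof.
have [C hC] := wave_group_bounded hE t; exists `|C| => // Z hZ.
by apply: le_trans (hC Z hZ) _; rewrite ler_wpM2r ?norm_HH1_ge0// ler_norm.
Qed.

Lemma wave_group_generator_cvg X : wave_dom X ->
  norm_HH1 (h^-1 *: (E h X - X) - wave_op X) @[h --> (0 : R)^'] --> (0 : R).
Proof.
move=> dX; apply/(wave_group_generator hE) => //.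
- exact: (wave_dom_HH1 he).
- exact: wave_op_HH1.
- by split=> //; exact: eq_HH_refl.
Qed.

(** The group commutes with its generator, hence preserves its domain. *)
Lemma wave_group_dom t X : wave_dom X ->
  wave_dom (E t X) /\ E t (wave_op X) =hh wave_op (E t X).
Proof.
move=> dX; have hX := wave_dom_HH1 he dX; have hAX := wave_op_HH1 dX.
apply/(wave_group_generator hE) => //; [exact: EHH1|exact: EHH1|].
have [C C0 hC] := wave_group_bound t.
have cC : C * norm_HH1 (h^-1 *: (E h X - X) - wave_op X) @[h --> (0 : R)^'] --> (0 : R).
  rewrite -[X in _ --> X](mulr0 C); apply: cvgM; first exact: cvg_cst.
  exact: wave_group_generator_cvg.
apply: (squeeze_cvgr _ (cvg_cst 0) cC); apply: nearW => h.
rewrite norm_HH1_ge0/=.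
have hEh : HH1 (E h X) by exact: EHH1.
have hD : HH1 (h^-1 *: (E h X - X)) by apply: (HH1Z); exact: (HH1B).
have hDA : HH1 (h^-1 *: (E h X - X) - wave_op X) by exact: (HH1B).
have key : E t (h^-1 *: (E h X - X) - wave_op X) =hh
           h^-1 *: (E h (E t X) - E t X) - E t (wave_op X).
  apply: (eq_HH_trans he) (wave_groupB hE _ hD hAX) _.
  apply: (eq_HHD he); last exact: eq_HH_refl.
  apply: (eq_HH_trans he) (wave_groupZ he hE _ _ (HH1B hEh hX)) _.
  rewrite -[X in X =hh _]addr0 -[X in _ =hh X]addr0.
  apply: (eq_HHPl he); last exact: eq_HH_refl.
  apply: (eq_HH_trans he) (wave_groupB hE _ hEh hX) _.
  apply: (eq_HHD he); last exact: eq_HH_refl.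
  apply: (eq_HH_trans he) (eq_HH_sym (wave_groupD hE t h hX)) _.
  by rewrite [t + h]addrC; exact: (wave_groupD hE).
rewrite -(norm_HH1_ext he (EHH1 t hDA) key).
exact: hC.
Qed.

(** Along the flow Z = E t X the squared norm has derivative 2 << A Z, Z >> = 0,
    the generator being skew. *)
Lemma wave_isometry_dom t X : wave_dom X -> << E t X, E t X >> = << X, X >>.
Proof.
move=> dX; have hX := wave_dom_HH1 he dX.
have -> : << X, X >> = << E 0 X, E 0 X >>.
  by apply/esym; apply: (inner_HH1_ext he (EHH1 0 hX)); exact: (wave_group0 hE).
apply: (@is_derive_0_is_cst _ (fun t => << E t X, E t X >>)) => {}t.
have [dZ _] := wave_group_dom t dX; set Z := E t X in dZ.
have hZ := wave_dom_HH1 he dZ; have hAZ := wave_op_HH1 dZ.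
pose D h := h^-1 *: (E h Z - Z).
have hD h : HH1 (D h) by apply: (HH1Z); apply: (HH1B) => //; exact: EHH1.
have cD := wave_group_generator_cvg dZ.
suff : h^-1 *: (<< E (h *: 1 + t) X, E (h *: 1 + t) X >> - << E t X, E t X >>)
    @[h --> (0 : R)^'] --> (0 : R).
  by move=> c0; apply: DeriveDef; [apply/cvg_ex; exists 0|apply: cvg_lim].
have c1 : 2 * << D h, Z >> + h * << D h, D h >> @[h --> (0 : R)^'] --> (0 : R).
  rewrite [X in _ --> X](_ : _ = 2 * << wave_op Z, Z >> + 0 * << wave_op Z, wave_op Z >>); last first.
    by rewrite inner_HH1C (wave_op_skew he dZ) mulr0 mul0r addr0.
  apply: cvgD; apply: cvgM.
  - exact: cvg_cst.
  - exact: (inner_HH1_cvg he hAZ hZ hD cD).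
  - exact: nbhs_dnbhs.
  - exact: (norm_HH1_cvg he hAZ hD cD).
apply: cvg_trans c1; apply: near_eq_cvg; near=> h.
have h0 : h != 0 by near: h; exact: nbhs_dnbhs_neq.
have E1 : << E (h *: 1 + t) X, E (h *: 1 + t) X >> = << E h Z, E h Z >>.
  by rewrite [h *: 1]mulr1; apply: (inner_HH1_ext he (EHH1 _ hX)); exact: (wave_groupD hE).
have E2 : E h Z = h *: D h + Z by rewrite scalerA divff// scale1r subrK.
have hhD : HH1 (h *: D h) by exact: (HH1Z).
rewrite E1 E2 (inner_HH1Pl he _ _ (hD h) hZ) !(inner_HH1Dr he _ hhD hZ).
rewrite !(inner_HH1Zr he _ _ (hD h)) [<< Z, D h >>]inner_HH1C.
rewrite -[RHS]/(_ * _); set a := << D h, D h >>; set b := << D h, Z >>.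
by field.
Unshelve. all: by end_near. Qed.

(** Fourier sums lie in the domain of the generator and approximate X. *)
Theorem wave_isometry t X : HH1 X -> << E t X, E t X >> = << X, X >>.
Proof.
move=> hX; pose Xn n : H * H := (fourier_sum e n X.1, fourier_sum e n X.2).
have dXn n : wave_dom (Xn n) by split; exact: dotH_lincomb.
have hXn n := wave_dom_HH1 he (dXn n).
have cX : norm_HH1 (Xn n - X) @[n --> \oo] --> (0 : R).
  rewrite -[X in _ --> X]sqrtr0.
  apply: (@continuous_cvg _ _ _ _ _ _ Num.sqrt); first exact: sqrt_continuous.
  rewrite -[X in _ --> X](addr0 0) -{1 2}(mulr0 0).
  have c1 := fourier_sum_cvg_dotH he hX; have c2 := fourier_sum_cvg he X.2.
  by apply: cvgD; under eq_fun do rewrite expr2; apply: cvgM.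
have [C C0 hC] := wave_group_bound t.
have cEX : norm_HH1 (E t (Xn n) - E t X) @[n --> \oo] --> (0 : R).
  have cC : C * norm_HH1 (Xn n - X) @[n --> \oo] --> (0 : R).
    by rewrite -[X in _ --> X](mulr0 C); apply: cvgM; first exact: cvg_cst.
  apply: (squeeze_cvgr _ (cvg_cst 0) cC); apply: nearW => n; rewrite norm_HH1_ge0/=.
  have hB := HH1B (hXn n) hX.
  rewrite -(norm_HH1_ext he (EHH1 t hB) (wave_groupB hE t (hXn n) hX)).
  exact: hC.
have l1 : << Xn n, Xn n >> @[n --> \oo] --> << X, X >>.
  exact: (norm_HH1_cvg he hX hXn cX).
have l2 : << E t (Xn n), E t (Xn n) >> @[n --> \oo] --> << E t X, E t X >>.
  exact: (norm_HH1_cvg he (EHH1 t hX) (fun n => EHH1 t (hXn n)) cEX).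
rewrite (_ : (fun n => _) = fun n => << Xn n, Xn n >>) in l2; last first.
  by apply/funext => n; exact: wave_isometry_dom.
exact: (cvg_unique _ l2 l1).
Qed.

Lemma wave_isometry2 t X Y : HH1 X -> HH1 Y -> << E t X, E t Y >> = << X, Y >>.
Proof.
move=> hX hY; have hEX := EHH1 t hX; have hEY := EHH1 t hY.
have h1 := wave_isometry t hX; have h2 := wave_isometry t hY.
have := wave_isometry t (HH1D hX hY).
rewrite (inner_HH1_ext he (EHH1 t (HH1D hX hY)) (wave_groupD1 hE t hX hY)).
rewrite !(inner_HH1Dl he)// !(inner_HH1Dr he)// h1 h2.
rewrite [<< E t Y, E t X >>]inner_HH1C [<< Y, X >>]inner_HH1C; lra.
Qed.

Lemma wave_groupNK t X : HH1 X -> E t (E (- t) X) =hh X.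
Proof.
move=> hX; apply: (eq_HH_trans he) (eq_HH_sym (wave_groupD hE t (- t) hX)) _.
by rewrite subrr; exact: (wave_group0 hE).
Qed.

Lemma wave_group_adjoint t X Y : HH1 X -> HH1 Y -> << E t X, Y >> = << X, E (- t) Y >>.
Proof.
move=> hX hY; rewrite -(wave_isometry2 t hX (EHH1 (- t) hY)) ![<< E t X, _ >>]inner_HH1C.
by apply/esym; apply: (inner_HH1_extl he); [exact/EHH1/EHH1|exact: wave_groupNK].
Qed.

Lemma HH1_e1 i : HH1 (e i, 0). Proof. exact: (dotH_e he). Qed.
Lemma HH1_snd x : HH1 (0, x). Proof. exact: dotH0. Qed.

(** The coordinates of E t X are pairings of X with fixed vectors, which lets E t X
    inherit the measurability of X. *)
Lemma wave_group_coord1 t X i : HH1 X ->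
  inner (E t X).1 (e i) = << X, E (- t) (e i, 0) >> / lam i.
Proof.
move=> hX; rewrite -wave_group_adjoint//; last exact: HH1_e1.
rewrite (inner_HH1_e1 he _ (EHH1 t hX)) [lam i * _]mulrC mulfK//.
by rewrite gt_eqF// (eigenvalue_gt0 he).
Qed.

Lemma wave_group_coord2 t X i : HH1 X ->
  inner (E t X).2 (e i) = << X, E (- t) (0, e i) >>.
Proof.
move=> hX; rewrite -wave_group_adjoint//; last exact: HH1_snd.
by rewrite (inner_HH1_e2 he _ (EHH1 t hX)).
Qed.

(** The potential (p, 0) of a force x solves A (p, 0) = (0, - x). *)
Definition force_potential x : H * H := (xget 0 [set p | dotH 2 p /\ laplacian lam e p =ae - x], 0).

Lemma force_potentialP x : dotH 2 (force_potential x).1 /\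
  laplacian lam e (force_potential x).1 =ae - x.
Proof.
have [p hp1 hp2] := inv_laplacian he x.
by apply: (@xgetPex _ 0 [set p | dotH 2 p /\ laplacian lam e p =ae - x]); exists p.
Qed.

Lemma force_potential_coord x i :
  inner (force_potential x).1 (e i) = inner x (e i) / lam i.
Proof.
have [h1 h2] := force_potentialP x; have := coord_ext e h2 i.
rewrite (laplacian_coord he)// innerNl => /eqP; rewrite mulNr eqr_opp => /eqP <-.
by rewrite [lam i * _]mulrC mulfK// gt_eqF// (eigenvalue_gt0 he).
Qed.

Lemma force_potential_dom x : wave_dom (force_potential x).
Proof. by have [h1 _] := force_potentialP x; split=> //; exact: dotH0. Qed.

Lemma inner_force_potential x X : HH1 X -> << X, force_potential x >> = inner x X.1.
Proof.
move=> hX; have [h1 h2] := force_potentialP x.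
rewrite inner_HH1C inner_HH1.unlock inner0l addr0 (green he h1 hX).
by rewrite (eq_L2_inner _ h2) innerNl opprK.
Qed.

(** The response A^-1 (E t - I) (0, - x), computed as (E t - I) A^-1 (0, - x). *)
Definition wave_response t x : H * H := E t (force_potential x) - force_potential x.

Lemma wave_responseP t x Y : wave_dom Y ->
  wave_op Y =hh E t (0, - x) - (0, - x) -> Y =hh wave_response t x.
Proof.
move=> dY hY; have dp := force_potential_dom x; have hp := wave_dom_HH1 he dp.
have [dEp hEp] := wave_group_dom t dp.
have [dB hB] := wave_opB he dEp dp.
apply: (wave_op_inj he) => //; apply: (eq_HH_trans he) hY _; apply: eq_HH_sym.
apply: (eq_HH_trans he) hB _.
have hA : wave_op (force_potential x) =hh (0, - x).
  by have [_ h2] := force_potentialP x; split; [exact: eq_L2_refl|].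
have hA' : E t (wave_op (force_potential x)) =hh E t (0, - x).
  by apply: (wave_group_ext he hE) hA; exact: wave_op_HH1.
have hN X X' : X =hh X' -> - X =hh - X'.
  move=> h; have := eq_HHPl he (-1) h (eq_HH_refl 0).
  by rewrite !addr0 !scaleN1r.
by apply: (eq_HHD he); [exact: (eq_HH_trans he (eq_HH_sym hEp) hA')|exact: hN].
Qed.

Lemma wave_response_HH1 t x : HH1 (wave_response t x).
Proof.
have hp := wave_dom_HH1 he (force_potential_dom x).
by apply: (HH1B) => //; exact: EHH1.
Qed.

(** With p the potential of x this is << E t p, p >> - << p, p >>, and E t is an
    isometry. *)
Lemma inner_wave_response_le0 t x : inner x (wave_response t x).1 <= 0.
Proof.
have hp := wave_dom_HH1 he (force_potential_dom x).
rewrite -inner_force_potential; last exact: wave_response_HH1.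
rewrite (inner_HH1Bl he) ?subr_le0//; last exact: EHH1.
rewrite (le_trans (ler_norm _))// (le_trans (cauchy_schwarz_HH1 he (EHH1 t hp) hp))//.
have -> : norm_HH1 (E t (force_potential x)) = norm_HH1 (force_potential x).
  apply/eqP; rewrite -(@eqrXn2 _ 2)// ?norm_HH1_ge0//.
  by rewrite !norm_HH1_sqr wave_isometry.
by rewrite -expr2 norm_HH1_sqr.
Qed.

Lemma force_potentialZ a x : force_potential (a *: x) =hh a *: force_potential x.
Proof.
split; last by apply: (coord_inj he) => i; rewrite /= innerZl inner0l mulr0.
apply: (coord_inj he) => i; rewrite force_potential_coord.
by rewrite -[(a *: force_potential x).1]/(a *: (force_potential x).1) !innerZl
  force_potential_coord mulrA.
Qed.

Lemma wave_responseZ t a x : wave_response t (a *: x) =hh a *: wave_response t x.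
Proof.
have hp y := wave_dom_HH1 he (force_potential_dom y).
have h1 := force_potentialZ a x; have h2 := wave_group_ext he hE t (hp _) h1.
have h3 := eq_HH_trans he h2 (wave_groupZ he hE t a (hp x)).
have h4 := eq_HHPl he (-1) h1 h3; rewrite !scaleN1r ![- _ + _]addrC in h4.
by rewrite /wave_response scalerBr.
Qed.

(** With p the potential of the force F, one step of the exponential scheme reads
    X' + p = E t (X + (0, z) + p). The isometry E t preserves the norm, and the cross
    terms with p are the work of the force. *)
Theorem exponential_step_energy t X z F X' Y : HH1 X -> HH1 X' -> wave_dom Y ->
  wave_op Y =hh E t (0, - F) - (0, - F) -> X' =hh E t X + Y + E t (0, z) ->
  << X', X' >> + 2 * inner F (X'.1 - X.1) = << X + (0, z), X + (0, z) >>.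
Proof.
move=> hX hX' dY hY hX'E; set p := force_potential F.
have hp := wave_dom_HH1 he (force_potential_dom F).
have hz := HH1_snd z; have hXz := HH1D hX hz; have hXzp := HH1D hXz hp.
have hYp := wave_responseP dY hY.
have h1 : X' + p =hh E t (X + (0, z) + p).
  apply: (eq_HH_trans he (eq_HHD he hX'E (eq_HH_refl p))).
  have h2 := wave_groupD1 hE t hXz hp; have h3 := wave_groupD1 hE t hX hz.
  have h4 := eq_HHD he h3 (eq_HH_refl (E t p)).
  apply: eq_HH_sym; apply: (eq_HH_trans he h2); apply: (eq_HH_trans he h4).
  have h5 := eq_HHD he (eq_HHD he (eq_HHD he (eq_HH_refl (E t X)) (eq_HH_sym hYp))
    (eq_HH_refl (E t (0, z)))) (eq_HH_refl p).
  apply: (eq_HH_trans he) h5.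
  rewrite /wave_response -/p (_ : _ + _ + _ + p = E t X + E t (0, z) + E t p); first exact: eq_HH_refl.
  by rewrite -!addrA; congr (_ + _); rewrite [- p + _]addrCA addNr addr0 addrC.
have hX'p := HH1D hX' hp.
have h6 : << X' + p, X' + p >> = << X + (0, z) + p, X + (0, z) + p >>.
  by rewrite -(wave_isometry t hXzp); exact: (inner_HH1_ext he hX'p h1).
have sq W : HH1 W -> << W + p, W + p >> = << W, W >> + 2 * inner F W.1 + << p, p >>.
  move=> hW; rewrite (inner_HH1Dl he _ hW hp) !(inner_HH1Dr he _ hW hp).
  rewrite [<< p, W >>]inner_HH1C (inner_force_potential F hW).
  set a := << W, W >>; set b := inner F W.1; set c := << p, p >>; ring.
move: h6; rewrite (sq _ hX') (sq _ hXz) innerBr.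
have -> : (X + (0, z)).1 = X.1 by rewrite -[LHS]/(X.1 + 0) addr0.
set a := << X', X' >>; set b := inner F X'.1; set c := << p, p >>.
by set a' := << X + (0, z), _ >>; set b' := inner F X.1; lra.
Qed.
End wave_isometry.

(** * Gaussian moments and independence *)

Section gaussian_moments.
Variable R : realType.
Local Notation mu := (@lebesgue_measure R).

Lemma integral_oppr (f : R -> \bar R) : measurable_fun setT f -> (forall x, 0 <= f x)%E ->
  (\int[mu]_x f (- x)%R = \int[mu]_x f x)%E.
Proof.
move=> mf f0.
have mN : measurable_fun [set: measurableTypeR R]
    (-%R : measurableTypeR R -> measurableTypeR R).
  exact: oppr_measurable.
have := @ge0_integral_pushforward _ _ _ _ _ _ mN mu setT f measurableT mf (fun x _ => f0 x).
rewrite preimage_setT => <-; apply/esym; apply: eq_measure_integral => A mA _.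
by apply/esym; exact: lebesgue_measureN.
Qed.

Variable s : R.
Hypothesis s0 : 0 < s.
Local Notation p := (normal_pdf 0 s).

Let sn0 : s != 0. Proof. by rewrite gt_eqF. Qed.

Lemma normal_pdf_even x : p (- x) = p x.
Proof. by rewrite !normal_pdfE// /normal_fun !subr0 sqrrN. Qed.

Lemma ge0_integral_normal_prob (f : R -> \bar R) : measurable_fun setT f ->
  (forall x, 0 <= f x)%E ->
  (\int[normal_prob 0 s]_x f x = \int[mu]_x (f x * (p x)%:E))%E.
Proof.
move=> mf f0; have dom : normal_prob 0 s `<< mu by exact: normal_prob_dominates.
rewrite -(Radon_Nikodym_SigmaFinite.change_of_variables dom f0 measurableT mf).
have mp : measurable_fun setT (fun x : R => (p x)%:E).
  by apply/measurable_EFinP; exact: measurable_normal_pdf.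
have iRN := Radon_Nikodym_SigmaFinite.f_integrable dom.
apply: ge0_ae_eq_integral => //.
- by apply: emeasurable_funM => //; exact: (measurable_int mu iRN).
- exact: emeasurable_funM.
- by move=> x _; rewrite mule_ge0//; exact: Radon_Nikodym_SigmaFinite.f_ge0.
- by move=> x _; rewrite mule_ge0// lee_fin normal_pdf_ge0.
apply: ae_eqe_mul2l; apply: integral_ae_eq => // A _ mA.
by rewrite -Radon_Nikodym_SigmaFinite.f_integral.
Qed.

Lemma normal_pdf_derive (x : R) : is_derive x 1 (p : R -> R) (- (x / s ^+ 2) * p x).
Proof.
rewrite normal_pdfE//.
have d1 : is_derive x 1 (fun y : R => - (y - 0) ^+ 2 / (s ^+ 2 *+ 2)) (- (x / s ^+ 2)).
  apply: is_derive_eq; rewrite /GRing.scale/=.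
  by field; rewrite gt_eqF.
have d2 : is_derive x 1 (fun y : R => normal_fun 0 s y) (- (x / s ^+ 2) * normal_fun 0 s x).
  by rewrite mulrC; exact: (is_derive1_comp (is_derive_expR _) d1).
apply: is_derive_eq; rewrite /GRing.scale/=.
by ring.
Qed.

Lemma normal_pdf_tail n : (0 < n)%N -> n%:R * p n%:R <= normal_peak s * (s ^+ 2 *+ 2) / n%:R.
Proof.
move=> n0; have nR : 0 < n%:R :> R by rewrite ltr0n.
rewrite normal_pdfE// /normal_fun subr0.
set y := n%:R ^+ 2 / (s ^+ 2 *+ 2).
have y0 : 0 < y by rewrite divr_gt0 ?exprn_gt0// pmulrn_lgt0// exprn_gt0.
have -> : - n%:R ^+ 2 / (s ^+ 2 *+ 2) = - y by rewrite mulNr.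
have : expR (- y) <= y^-1.
  rewrite expRN lef_pV2 ?posrE ?expR_gt0//; apply: le_trans (expR_ge1Dx y); lra.
rewrite -(ler_pM2l (mulr_gt0 nR (normal_peak_gt0 sn0))) => h.
rewrite mulrA; apply: (le_trans h); rewrite /y invf_div le_eqVlt; apply/orP; left; apply/eqP.
by field; rewrite gt_eqF// pmulrn_lgt0// exprn_gt0.
Qed.

Lemma normal_mass_ray : (\int[mu]_(x in `[0%R, +oo[) (p x)%:E = (2^-1)%:E)%E.
Proof.
have := integral_normal_pdf 0 s.
rewrite (@ge0_symfun_integralT _ p); first last.
- by move=> x; rewrite /= normal_pdf_even.
- exact: continuous_normal_pdf.
- by move=> x; exact: normal_pdf_ge0.
rewrite (_ : [set x | 0 <= x] = `[0, +oo[%classic); last first.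
  by rewrite predeqE => x /=; rewrite in_itv/= andbT.
set I := integral _ _ _.
have I0 : (0 <= I)%E by apply: integral_ge0 => x _; rewrite lee_fin normal_pdf_ge0.
case: I I0 => [r| |]//= _; last by rewrite gt0_muley.
by rewrite -EFinM => -[h]; congr EFin; lra.
Qed.

(** Integration by parts: x p(x) is the derivative of - s^2 p. *)
Lemma normal_second_moment_seg n : (0 < n)%N ->
  (\int[mu]_(x in `[0%R, n%:R]) (x ^+ 2 * p x)%:E =
   (- (s ^+ 2) * (n%:R * p n%:R))%:E + (s ^+ 2)%:E * \int[mu]_(x in `[0%R, n%:R]) (p x)%:E)%E.
Proof.
move=> n0.
have cp : continuous (p : R -> R) by exact: continuous_normal_pdf.
have cxp : continuous (fun x : R => x * p x).
  by move=> x; apply: cvgM; [exact: cvg_id|exact: cp].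
have dG (x : R) : is_derive x 1 (fun y : R => - (s ^+ 2) * p y) (x * p x).
  have := normal_pdf_derive x => h; apply: is_derive_eq; rewrite /GRing.scale/=.
  by field; rewrite gt_eqF.
have cG : continuous (fun y : R => - (s ^+ 2) * p y).
  by move=> x; apply: cvgM; [exact: cvg_cst|exact: cp].
have ibp := @integration_by_parts R id (fun y : R => - (s ^+ 2) * p y) (cst 1) (fun x => x * p x) 0 n%:R.
transitivity (\int[mu]_(x in `[0%R, n%:R]) (id x * (x * p x))%:E)%E.
  by apply: eq_integral => x _; rewrite expr2 mulrA.
rewrite ibp ?ltr0n//; last 6 first.
- by apply: continuous_subspaceT => x; exact: cst_continuous.
- by split=> [x _| |]; [exact: derivable_id|exact: cvg_at_right_filter|exact: cvg_at_left_filter].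
- by move=> x _; rewrite derive1E derive_id.
- by apply: continuous_subspaceT => x; exact: cxp.
- by split=> [x _| |]; [have [] := dG x|exact: cvg_at_right_filter (cG _)|exact: cvg_at_left_filter (cG _)].
- by move=> x _; rewrite derive1E; have [_ ->] := dG x.
rewrite mul0r subr0.
have -> : n%:R * (- (s ^+ 2) * p n%:R) = - (s ^+ 2) * (n%:R * p n%:R) by ring.
congr (_ + _)%E.
under eq_integral do rewrite mul1r mulNr EFinN.
rewrite integral_ge0N//; last by move=> x _; rewrite lee_fin mulr_ge0 ?sqr_ge0 ?normal_pdf_ge0.
rewrite oppeK; under eq_integral do rewrite EFinM.
rewrite ge0_integralZl_EFin ?sqr_ge0//.
- by move=> x _; rewrite lee_fin normal_pdf_ge0.
- by apply/measurable_EFinP; apply: measurable_funTS; exact: measurable_normal_pdf.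
Qed.

Lemma cvg_integral_ray (f : R -> \bar R) : measurable_fun setT f -> (forall x, 0 <= f x)%E ->
  (\int[mu]_(x in `[0%R, n%:R]) f x @[n --> \oo] --> \int[mu]_(x in `[0%R, +oo[) f x)%E.
Proof.
move=> mf f0.
have -> : `[0%R, +oo[%classic = \bigcup_n `[0%R, n%:R : R]%classic.
  rewrite predeqE => x; split=> /=.
    rewrite in_itv/= andbT => x0; exists (Num.truncn x).+1 => //=.
    by rewrite in_itv/= x0 ltW// truncnS_gt.
  by move=> [n _] /=; rewrite !in_itv/= andbT => /andP[].
have h := @ge0_nondecreasing_set_cvg_integral _ (measurableTypeR R) R
  (fun n => `[0%R, n%:R : R]%classic) f mu.
apply: h => //.
- apply/nondecreasing_seqP => n; rewrite subsetEset => x /=; rewrite !in_itv/= => /andP[-> h].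
  by rewrite (le_trans h)// ler_nat.
- by move=> n; exact: measurable_funTS.
Qed.

Lemma normal_second_moment_ray :
  (\int[mu]_(x in `[0%R, +oo[) (x ^+ 2 * p x)%:E = (s ^+ 2 / 2)%:E)%E.
Proof.
have mx2p : measurable_fun setT (fun x : R => (x ^+ 2 * p x)%:E).
  apply/measurable_EFinP; apply: measurable_funM; first exact: measurable_funX.
  exact: measurable_normal_pdf.
have x2p0 x : (0 <= (x ^+ 2 * p x)%:E)%E by rewrite lee_fin mulr_ge0 ?sqr_ge0 ?normal_pdf_ge0.
have mp : measurable_fun setT (fun x : R => (p x)%:E).
  by apply/measurable_EFinP; exact: measurable_normal_pdf.
have p0 x : (0 <= (p x)%:E)%E by rewrite lee_fin normal_pdf_ge0.
have c1 := cvg_integral_ray mx2p x2p0.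
have c2 := cvg_integral_ray mp p0; rewrite normal_mass_ray in c2.
apply: (cvg_unique _ c1) => //.
have c3 : n%:R * p n%:R @[n --> \oo] --> (0 : R).
  have cV : normal_peak s * (s ^+ 2 *+ 2) / n.+1%:R @[n --> \oo] --> (0 : R).
    rewrite -[X in _ --> X](mulr0 (normal_peak s * (s ^+ 2 *+ 2))).
    by apply: cvgM; [exact: cvg_cst|exact: cvg_harmonic].
  rewrite -(cvg_shiftS) /=.
  apply: (squeeze_cvgr _ (cvg_cst 0) cV); apply: nearW => n.
  by rewrite mulr_ge0 ?normal_pdf_ge0//= normal_pdf_tail.
have c4 : ((- (s ^+ 2) * (n%:R * p n%:R))%:E + (s ^+ 2)%:E * \int[mu]_(x in `[0%R, n%:R]) (p x)%:E
    @[n --> \oo] --> (- (s ^+ 2) * 0)%:E + (s ^+ 2)%:E * (2^-1)%:E)%E.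
  apply: cvgeD => //.
    by apply: cvg_EFin; [exact: nearW|apply: cvgM => //; exact: cvg_cst].
  by apply: cvgeZl.
rewrite mulr0 add0e -EFinM in c4.
apply: cvg_trans c4; apply: near_eq_cvg; near=> n.
by rewrite normal_second_moment_seg//; near: n; exact: nbhs_infty_gt.
Unshelve. all: by end_near. Qed.

Lemma normal_second_moment :
  (\int[normal_prob 0 s]_x (x ^+ 2)%:E = (s ^+ 2)%:E)%E.
Proof.
rewrite ge0_integral_normal_prob; first last.
- by move=> x; rewrite lee_fin sqr_ge0.
- by apply/measurable_EFinP; exact: measurable_funX.
under eq_integral do rewrite -EFinM.
rewrite (@ge0_symfun_integralT _ (fun x => x ^+ 2 * p x)).
- rewrite (_ : [set x | 0 <= x] = `[0, +oo[%classic); last first.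
    by rewrite predeqE => x /=; rewrite in_itv/= andbT.
  by rewrite normal_second_moment_ray -EFinM; congr EFin; field.
- by move=> x; rewrite mulr_ge0 ?sqr_ge0 ?normal_pdf_ge0.
- by move=> x; apply: cvgM; [exact: sqr_continuous|exact: continuous_normal_pdf].
- by move=> x /=; rewrite sqrrN normal_pdf_even.
Qed.

Lemma normal_prob_symmetric (f : R -> \bar R) : measurable_fun setT f ->
  (forall x, 0 <= f x)%E ->
  (\int[normal_prob 0 s]_x f (- x)%R = \int[normal_prob 0 s]_x f x)%E.
Proof.
move=> mf f0; have mfN : measurable_fun setT (fun x : R => f (- x)).
  by apply: (measurableT_comp mf); exact: oppr_measurable.
rewrite !ge0_integral_normal_prob// -[RHS]integral_oppr.
- by apply: eq_integral => x _; rewrite normal_pdf_even.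
- by apply: emeasurable_funM => //; apply/measurable_EFinP; exact: measurable_normal_pdf.
- by move=> x; rewrite mule_ge0// lee_fin normal_pdf_ge0.
Qed.

End gaussian_moments.

Section independence.
Context dO (Om : measurableType dO) (R : realType) (P : probability Om R).

(** Independence means that the joint law is a product measure, so that the two
    arguments may be integrated separately. *)
Lemma independent_integral d1 d2 (T1 : measurableType d1) (T2 : measurableType d2)
    (X : Om -> T1) (Y : Om -> T2) (phi : T1 * T2 -> \bar R) :
  measurable_fun setT X -> measurable_fun setT Y ->
  (forall A B, measurable A -> measurable B ->
    P (X @^-1` A `&` Y @^-1` B) = P (X @^-1` A) * P (Y @^-1` B))%E ->
  measurable_fun setT phi -> (forall z, 0 <= phi z)%E ->
  (\int[P]_w phi (X w, Y w) = \int[P]_w \int[P]_w' phi (X w, Y w'))%E.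
Proof.
move=> mX mY XY mphi phi0.
pose X' : {mfun Om >-> T1} := mfun_Sub (mem_set mX : X \in mfun).
pose Y' : {mfun Om >-> T2} := mfun_Sub (mem_set mY : Y \in mfun).
have mZ : measurable_fun setT (fun w => (X w, Y w)) by exact: measurable_fun_pair.
pose Z' : {mfun Om >-> (T1 * T2)%type} := mfun_Sub (mem_set mZ : (fun w => (X w, Y w)) \in mfun).
have <- : (\int[distribution P Z']_z phi z = \int[P]_w phi (X w, Y w))%E.
  by rewrite ge0_integral_pushforward.
have -> : (\int[distribution P Z']_z phi z =
           \int[distribution P X' \x distribution P Y']_z phi z)%E.
  apply/esym; apply: eq_measure_integral => A mA _.
  by apply: product_measure_unique => // B C mB mC; rewrite /distribution/= /pushforward -XY.
rewrite fubini_tonelli1// ge0_integral_pushforward//; first last.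
- by move=> x _; apply: integral_ge0.
- exact: measurable_fun_fubini_tonelli_F.
apply: eq_integral => w _ /=; rewrite /fubini_F ge0_integral_pushforward//.
by apply: (measurableT_comp mphi); exact: measurable_pair1.
Qed.

(** Formulated with positive and negative parts because the symmetry of the noise is
    first known for nonnegative integrands. *)
Lemma symmetric_integral0 (Y : Om -> R) : measurable_fun setT Y ->
  P.-integrable setT (EFin \o Y) ->
  (\int[P]_w (Num.max (Y w) 0)%:E = \int[P]_w (Num.max (- Y w) 0)%:E)%E ->
  (\int[P]_w (Y w)%:E = 0)%E.
Proof.
move=> mY iY sym; rewrite integralE.
have -> : (\int[P]_w (fun w => (Y w)%:E)^\+ w = \int[P]_w (Num.max (Y w) 0)%:E)%E.
  by apply: eq_integral => w _; rewrite funeposE EFin_max.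
have -> : (\int[P]_w (fun w => (Y w)%:E)^\- w = \int[P]_w (Num.max (- Y w) 0)%:E)%E.
  by apply: eq_integral => w _; rewrite funenegE EFin_max.
rewrite sym subee//.
have := integrable_neg_fin_num measurableT iY.
rewrite (_ : integral _ _ _ = \int[P]_w (Num.max (- Y w) 0)%:E)%E//.
by apply: eq_integral => w _; rewrite funenegE /= EFin_max.
Qed.

End independence.

(** * Second moment of a noise increment *)

Section gaussian_noise.
Context dO (Om : measurableType dO) (R : realType) (P : probability Om R).
Variables (xi : nat -> Om -> R) (tau : R).
Hypothesis tau0 : 0 < tau.
Hypothesis mxi : forall k, measurable_fun setT (xi k).
Hypothesis xi_law : forall k (A : set R), measurable A ->
  P (xi k @^-1` A) = normal_prob 0 (Num.sqrt tau) A.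
Hypothesis xi_pair : forall k l (A B : set R), k != l -> measurable A -> measurable B ->
  (P (xi k @^-1` A `&` xi l @^-1` B) = P (xi k @^-1` A) * P (xi l @^-1` B))%E.

Let sqrt_tau0 : 0 < Num.sqrt tau. Proof. by rewrite sqrtr_gt0. Qed.

Lemma noise_integral k (h : R -> \bar R) : measurable_fun setT h -> (forall x, 0 <= h x)%E ->
  (\int[P]_w h (xi k w) = \int[normal_prob 0 (Num.sqrt tau)]_x h x)%E.
Proof.
move=> mh h0.
have mX : measurable_fun setT (xi k : Om -> measurableTypeR R) by exact: mxi.
pose X : {mfun Om >-> measurableTypeR R} :=
  mfun_Sub (mem_set mX : (xi k : Om -> measurableTypeR R) \in mfun).
have <- : (\int[distribution P X]_x h x = \int[P]_w h (xi k w))%E.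
  by rewrite ge0_integral_pushforward.
by apply: eq_measure_integral => A mA _; exact: xi_law.
Qed.

Lemma noise_sqr k : (\int[P]_w (xi k w ^+ 2)%:E = tau%:E)%E.
Proof.
rewrite (@noise_integral k (fun x => (x ^+ 2)%:E)).
- by rewrite normal_second_moment// sqr_sqrtr// ltW.
- by apply/measurable_EFinP; exact: measurable_funX.
- by move=> x; rewrite lee_fin sqr_ge0.
Qed.

Lemma noise_symmetric k (h : R -> \bar R) : measurable_fun setT h -> (forall x, 0 <= h x)%E ->
  (\int[P]_w h (xi k w) = \int[P]_w h (- xi k w)%R)%E.
Proof.
move=> mh h0; rewrite noise_integral// (@noise_integral k (fun x => h (- x)))//.
  by rewrite normal_prob_symmetric.
by apply: (measurableT_comp mh); exact: oppr_measurable.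
Qed.

Lemma integrable_noise_sqr k : P.-integrable setT (EFin \o (fun w => xi k w ^+ 2)).
Proof.
apply/integrableP; split; first by apply/measurable_EFinP; exact: measurable_funX.
under eq_integral do rewrite /= ger0_norm ?sqr_ge0//.
by rewrite noise_sqr ltry.
Qed.

Lemma integrable_noise_mul k l : P.-integrable setT (EFin \o (fun w => xi k w * xi l w)).
Proof.
apply: (@le_integrable _ _ _ P setT measurableT _
  (EFin \o (fun w => xi k w ^+ 2 + xi l w ^+ 2))).
- by apply/measurable_EFinP; exact: measurable_funM.
- move=> w _ /=; rewrite lee_fin ler_norml ger0_norm ?addr_ge0 ?sqr_ge0//.
  have := sqr_ge0 (xi k w + xi l w); have := sqr_ge0 (xi k w - xi l w).
  by have := sqr_ge0 (xi k w); have := sqr_ge0 (xi l w); move=> *; nra.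
- have := integrableD measurableT (integrable_noise_sqr k) (integrable_noise_sqr l).
  by apply: eq_integrable.
Qed.

Lemma integrable_noise k : P.-integrable setT (EFin \o xi k).
Proof.
apply: (@le_integrable _ _ _ P setT measurableT _
  (EFin \o (fun w => 1 + xi k w ^+ 2))).
- exact/measurable_EFinP.
- move=> w _ /=; rewrite lee_fin ler_norml ger0_norm ?addr_ge0 ?sqr_ge0//.
  have := sqr_ge0 (xi k w + 1); have := sqr_ge0 (xi k w - 1).
  by have := sqr_ge0 (xi k w); move=> *; nra.
- have i1 : P.-integrable setT (EFin \o cst 1).
    by apply: finite_measure_integrable_cst.
  have := integrableD measurableT i1 (integrable_noise_sqr k).
  by apply: eq_integrable.
Qed.

Let measurable_pos (a : R) : measurable_fun setT (fun x : R => (Num.max (a * x) 0)%:E).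
Proof. by apply/measurable_EFinP; apply: measurable_maxr => //; exact: measurable_funM. Qed.

Let pos_ge0 (x : R) : (0 <= (Num.max x 0)%:E)%E.
Proof. by rewrite lee_fin le_max lexx orbT. Qed.

Lemma noise_mean k : (\int[P]_w (xi k w)%:E = 0)%E.
Proof.
apply: symmetric_integral0 => //; first exact: integrable_noise.
have := noise_symmetric k (measurable_pos 1) (fun x => pos_ge0 (1 * x)).
by under eq_integral do rewrite mul1r; under [RHS]eq_integral do rewrite mul1r.
Qed.

(** For k <> l, independence splits the integral into iterated ones, and the symmetry
    of xi l exchanges the positive and the negative part of the product. *)
Lemma noise_mul k l : (\int[P]_w (xi k w * xi l w)%:E = (if k == l then tau else 0)%:E)%E.
Proof.
case: eqVneq => [<-|kl].
  by rewrite -(noise_sqr k); apply: eq_integral => w _; rewrite expr2.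
apply: symmetric_integral0; [exact: measurable_funM|exact: integrable_noise_mul|].
have mmax (a : R) : measurable_fun setT (fun z : R * R => (Num.max (a * (z.1 * z.2)) 0)%:E).
  apply/measurable_EFinP; apply: measurable_maxr => //; apply: measurable_funM => //.
  by apply: measurable_funM; [exact: measurable_fst|exact: measurable_snd].
have ind (a : R) : (\int[P]_w (Num.max (a * (xi k w * xi l w)) 0)%:E =
    \int[P]_w \int[P]_w' (Num.max (a * (xi k w * xi l w')) 0)%:E)%E.
  exact: (@independent_integral _ _ _ P _ _ _ _ (xi k) (xi l)
    (fun z => (Num.max (a * (z.1 * z.2)) 0)%:E) (mxi k) (mxi l)
    (fun A B mA mB => xi_pair kl mA mB) (mmax a) (fun z => pos_ge0 _)).
have := ind 1; under eq_integral do rewrite mul1r; move=> ->.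
have := ind (-1); under eq_integral do rewrite mulN1r; move=> ->.
apply: eq_integral => w _.
have := noise_symmetric l (measurable_pos (xi k w)) (fun x => pos_ge0 (xi k w * x)).
under eq_integral do rewrite -[xi k w * _]mul1r; move=> ->.
by apply: eq_integral => w' _; rewrite mulN1r mulrN.
Qed.

(** The integrand is the squared norm of a vector that is affine in the noise; only its
    diagonal terms contribute. *)
Lemma noise_quadratic m (a : R) (b : 'I_m -> R) (c : 'I_m -> 'I_m -> R) :
  (\int[P]_w (a + \sum_(k < m) b k * xi k w
      + \sum_(k < m) \sum_(l < m) c k l * (xi k w * xi l w))%:E =
   (a + tau * \sum_(k < m) c k k)%:E)%E.
Proof.
have ia : P.-integrable setT (fun _ => a%:E) by exact: finite_measure_integrable_cst.
have ib k : P.-integrable setT (fun w => (b k * xi k w)%:E).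
  by under eq_fun do rewrite EFinM; apply: integrableZl => //; exact: integrable_noise.
have ic k l : P.-integrable setT (fun w => (c k l * (xi k w * xi l w))%:E).
  by under eq_fun do rewrite EFinM; apply: integrableZl => //; exact: integrable_noise_mul.
have ibs : P.-integrable setT (fun w => (\sum_(k < m) (b k * xi k w)%:E)%E).
  by apply: integrable_sum => // k _; exact: ib.
have ics k : P.-integrable setT (fun w => (\sum_(l < m) (c k l * (xi k w * xi l w))%:E)%E).
  by apply: integrable_sum => // l _; exact: ic.
have icss : P.-integrable setT (fun w =>
    (\sum_(k < m) \sum_(l < m) (c k l * (xi k w * xi l w))%:E)%E).
  by apply: integrable_sum => // k _; exact: ics.
under eq_integral => w _.
  rewrite !EFinD -!sumEFin.
  under [X in (_ + X)%E]eq_bigr do rewrite -sumEFin.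
  over.
rewrite integralD//; last exact: integrableD.
rewrite integralD// integral_sum// integral_sum//.
rewrite (_ : (\int[P]_x a%:E)%E = a%:E); last first.
  by rewrite integral_cst//= (_ : P setT = 1%E) ?mule1//; exact: probability_setT.
rewrite (_ : (\sum_(k < m) _)%E = 0%:E :> \bar R); last first.
  rewrite big1// => k _; under eq_integral do rewrite EFinM.
  by rewrite integralZl//; [rewrite noise_mean mule0|exact: integrable_noise].
rewrite adde0 EFinD; congr (_ + _)%E.
rewrite mulr_sumr -sumEFin; apply: eq_bigr => k _.
rewrite integral_sum// (bigD1 k)//= [X in (_ + X)%E]big1 ?adde0.
  under eq_integral do rewrite EFinM.
  by rewrite integralZl ?noise_mul ?eqxx -?EFinM 1?mulrC//; exact: integrable_noise_mul.
move=> l lk; under eq_integral do rewrite EFinM.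
rewrite integralZl//; last exact: integrable_noise_mul.
by rewrite noise_mul eq_sym -val_eqE in lk *; rewrite (negbTE lk) mule0.
Qed.

End gaussian_noise.

Section second_moment.
Variables (R : realType) (d : nat) (O : polygonal_domain R d).
Local Notation H := (L2 O).
Variables (lam : nat -> R) (e : nat -> H).
Hypothesis he : dirichlet_eigenbasis lam e.
Context dO (Om : measurableType dO) (P : probability Om R).
Variables (xi : nat -> Om -> R) (tau : R).
Hypothesis tau0 : 0 < tau.
Hypothesis mxi : forall k, measurable_fun setT (xi k).
Hypothesis xi_law : forall k (A : set R), measurable A ->
  P (xi k @^-1` A) = normal_prob 0 (Num.sqrt tau) A.
Hypothesis xi_pair : forall k l (A B : set R), k != l -> measurable A -> measurable B ->
  (P (xi k @^-1` A `&` xi l @^-1` B) = P (xi k @^-1` A) * P (xi l @^-1` B))%E.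
Variable G : set (set Om).
Hypothesis Gsigma : sigma_algebra setT G.
Hypothesis Gmeas : G `<=` measurable.
Hypothesis Gindep : forall A B, G A -> sigma_generated [set: nat] xi B ->
  (P (A `&` B) = P A * P B)%E.

Local Notation TG := (g_sigma_algebraType G).
Let genX : set (set Om) := [set B | exists i (A : set R),
  [/\ [set: nat] i, measurable A & B = xi i @^-1` A]].
Local Notation TX := (g_sigma_algebraType genX).

Lemma measurable_TG (A : set Om) : measurable (A : set TG) <-> G A.
Proof. by rewrite -[measurable _]/(<<s G >> A) sigma_algebra_id. Qed.

Lemma TG_measurable_fun (f : Om -> R) :
  measurable_fun setT (f : TG -> R) -> measurable_fun setT f.
Proof.
move=> mf _ A mA; rewrite setTI; apply: Gmeas; apply/measurable_TG.
by have := mf measurableT A mA; rewrite setTI.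
Qed.

Lemma TG_coord_measurable (X : Om -> H) :
  coord_measurable e (X : TG -> H) -> coord_measurable e X.
Proof. by move=> mX i; exact: TG_measurable_fun. Qed.

Definition noise_sum (K : nat -> Om -> H) m w : H := \sum_(k < m) xi k w *: K k w.

Lemma noise_sum_measurable (K : nat -> Om -> H) m :
  (forall k, coord_measurable e (K k : TG -> H)) ->
  coord_measurable e (noise_sum K m).
Proof.
move=> mK; apply: coord_measurable_sum => k; apply: coord_measurableZ => //.
exact: TG_coord_measurable.
Qed.

Let norm_sqr_sum (v : H) (K : nat -> H) (x : nat -> R) m :
  norm_L2 (v + \sum_(k < m) x k *: K k) ^+ 2 =
  norm_L2 v ^+ 2 + \sum_(k < m) (2 * inner v (K k)) * x k
  + \sum_(k < m) \sum_(l < m) inner (K k) (K l) * (x k * x l).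
Proof.
rewrite !norm_L2_sqr innerDl !innerDr [inner (\sum_(_ < _) _) v]innerC.
rewrite inner_suml.
under [X in _ + (_ + X)]eq_bigr do rewrite innerZl inner_sumr mulr_sumr.
under [X in _ + (_ + X)]eq_bigr do under eq_bigr do rewrite innerZr.
rewrite inner_sumr -!addrA; congr (_ + _); rewrite !addrA; congr (_ + _).
  by rewrite -big_split/=; apply: eq_bigr => k _; rewrite innerZr; ring.
by apply: eq_bigr => k _; apply: eq_bigr => l _; ring.
Qed.

(** Since the noise is independent of G, it can be integrated first, with v and K
    frozen; it is centred with orthogonal components. *)
Lemma second_moment_finite (v : Om -> H) (K : nat -> Om -> H) m :
  coord_measurable e (v : TG -> H) -> (forall k, coord_measurable e (K k : TG -> H)) ->
  (\int[P]_w (norm_L2 (v w + noise_sum K m w) ^+ 2)%:E =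
   \int[P]_w (norm_L2 (v w) ^+ 2 + tau * \sum_(k < m) norm_L2 (K k w) ^+ 2)%:E)%E.
Proof.
move=> mv mK.
pose phi (z : TG * TX) := (norm_L2 (v z.1 + \sum_(k < m) xi k z.2 *: K k z.1) ^+ 2)%:E.
have mphi : measurable_fun setT phi.
  apply/measurable_EFinP; apply: measurable_funX; apply: (coord_measurable_norm he).
  apply: coord_measurableD.
    by move=> i; exact: (measurableT_comp (mv i) measurable_fst).
  apply: coord_measurable_sum => k; apply: coord_measurableZ.
    have mk : measurable_fun setT (xi k : TX -> R).
      move=> _ A mA; rewrite setTI; apply: sub_sigma_algebra.
      by exists k, A.
    exact: (measurableT_comp mk measurable_snd).
  by move=> i; exact: (measurableT_comp (mK k i) measurable_fst).
have mG : measurable_fun setT (id : Om -> TG).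
  by move=> _ A mA; rewrite setTI; apply: Gmeas; exact/measurable_TG.
have mX : measurable_fun setT (id : Om -> TX).
  move=> _ A mA; rewrite setTI; move: A mA; apply: smallest_sub.
    exact: sigma_algebra_measurable.
  by move=> _ [k [A [_ mA ->]]]; rewrite -[X in measurable X]setTI; exact: mxi.
have ind (A : set TG) (B : set TX) : measurable A -> measurable B ->
    (P (id @^-1` A `&` id @^-1` B) = P (id @^-1` A) * P (id @^-1` B))%E.
  by move=> /measurable_TG GA mB; exact: Gindep.
have := @independent_integral _ Om _ P _ _ TG TX id id phi mG mX ind mphi.
rewrite /phi/= => -> //; last by move=> z; rewrite lee_fin sqr_ge0.
apply: eq_integral => w _.
under eq_integral => w' _ do rewrite (norm_sqr_sum (v w) (K ^~ w) (xi ^~ w') m).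
rewrite (noise_quadratic tau0 mxi xi_law xi_pair).
by congr ((_ + _ * _)%:E); apply: eq_bigr => k _; rewrite norm_L2_sqr.
Qed.

Section bounded.
Variables (v : Om -> H) (K : nat -> Om -> H) (Nz : Om -> R) (M : R).
Hypothesis mv : coord_measurable e (v : TG -> H).
Hypothesis mK : forall k, coord_measurable e (K k : TG -> H).
Hypothesis vM : forall w, norm_L2 (v w) ^+ 2 <= M.
Hypothesis KM : forall w n, \sum_(k < n) norm_L2 (K k w) ^+ 2 <= M.
Hypothesis mNz : measurable_fun setT Nz.
Hypothesis NzE : {ae P, forall w, exists z : H,
  norm_L2 (z - noise_sum K m w) @[m --> \oo] --> (0 : R) /\
  Nz w = norm_L2 (v w + z) ^+ 2}.

Let kap n w := \sum_(k < n) norm_L2 (K k w) ^+ 2.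

Let mkap n : measurable_fun setT (kap n).
Proof.
apply: measurable_sum => k; apply: measurable_funX.
by apply: (coord_measurable_norm he); exact: TG_coord_measurable.
Qed.

Let kap0 n w : 0 <= kap n w.
Proof. by apply: sumr_ge0 => k _; exact: sqr_ge0. Qed.

Let v2 := fine (\int[P]_w (norm_L2 (v w) ^+ 2)%:E)%E.
Let t n := fine (\int[P]_w (kap n w)%:E)%E.

Let le_intM (f : Om -> R) : measurable_fun setT f -> (forall w, 0 <= f w <= M) ->
  (\int[P]_w (f w)%:E)%E = (fine (\int[P]_w (f w)%:E)%E)%:E /\
  fine (\int[P]_w (f w)%:E)%E <= M.
Proof.
move=> mf fM.
have h : (\int[P]_w (f w)%:E <= M%:E)%E.
  apply: (@le_trans _ _ (\int[P]_w (cst M%:E w)))%E.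
    apply: ge0_le_integral => //.
    - by move=> w _; rewrite lee_fin; have /andP[] := fM w.
    - exact/measurable_EFinP.
    - by move=> w _; rewrite lee_fin; have /andP[] := fM w.
  by rewrite integral_cst//= (_ : P setT = 1%E) ?mule1//; exact: probability_setT.
have h0 : (0 <= \int[P]_w (f w)%:E)%E.
  by apply: integral_ge0 => w _; rewrite lee_fin; have /andP[] := fM w.
have fin : (\int[P]_w (f w)%:E)%E \is a fin_num.
  by rewrite ge0_fin_numE// (le_lt_trans h)// ltry.
by rewrite fineK//; split=> //; rewrite -lee_fin fineK.
Qed.

Let mv2 : measurable_fun setT (fun w => norm_L2 (v w) ^+ 2).
Proof.
apply: measurable_funX; apply: (coord_measurable_norm he); exact: TG_coord_measurable.
Qed.

Let v2E : (\int[P]_w (norm_L2 (v w) ^+ 2)%:E)%E = v2%:E.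
Proof. by have [] := le_intM mv2 (fun w => introT andP (conj (sqr_ge0 _) (vM w))). Qed.

Let tE n : (\int[P]_w (kap n w)%:E)%E = (t n)%:E.
Proof. by have [] := le_intM (mkap n) (fun w => introT andP (conj (kap0 n w) (KM w n))). Qed.

Let t_ub n : t n <= M.
Proof. by have [] := le_intM (mkap n) (fun w => introT andP (conj (kap0 n w) (KM w n))). Qed.

Let kap_nd w : nondecreasing_seq (kap ^~ w).
Proof. by apply/nondecreasing_seqP => n; rewrite /kap big_ord_recr/= lerDl sqr_ge0. Qed.

Let t_nd : nondecreasing_seq t.
Proof.
move=> n m nm; rewrite -lee_fin -!tE; apply: ge0_le_integral => //.
- by move=> w _; rewrite lee_fin.
- exact/measurable_EFinP.
- exact/measurable_EFinP.
- by move=> w _; rewrite lee_fin; exact: kap_nd.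
Qed.

Let t_cvg : cvgn t.
Proof. by apply: nondecreasing_is_cvgn => //; exists M => _ [n _ <-]; exact: t_ub. Qed.

Let moment n : (\int[P]_w (norm_L2 (v w + noise_sum K n w) ^+ 2)%:E = (v2 + tau * t n)%:E)%E.
Proof.
rewrite second_moment_finite//.
under eq_integral do rewrite EFinD.
rewrite ge0_integralD//; first last.
- by apply/measurable_EFinP; apply: measurable_funM => //; exact: mkap.
- by move=> w _; rewrite lee_fin mulr_ge0 ?kap0// ltW.
- exact/measurable_EFinP.
- by move=> w _; rewrite lee_fin sqr_ge0.
rewrite v2E; under [X in (_ + X)%E]eq_integral => w _ do rewrite [(tau * _)%:E]EFinM.
rewrite ge0_integralZl_EFin//; first last.
- by rewrite ltW.
- by apply/measurable_EFinP; exact: mkap.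
- by move=> w _; rewrite lee_fin; exact: (kap0 n w).
by rewrite -[X in (_ + _ * X)%E]/(\int[P]_w (kap n w)%:E)%E tE -EFinM.
Qed.

(** The tail is a noise sum whose first m coefficients vanish. *)
Let tail_moment n m : (m <= n)%N ->
  (\int[P]_w (norm_L2 (noise_sum K n w - noise_sum K m w) ^+ 2)%:E = (tau * (t n - t m))%:E)%E.
Proof.
move=> mn.
pose K' k w : H := if (k < m)%N then 0 else K k w.
have mK' k : coord_measurable e (K' k : TG -> H).
  have -> : K' k = if (k < m)%N then cst 0 else K k by apply/funext => w; rewrite /K'; case: ifP.
  by case: ifP => _; [exact: (@coord_measurable_cst R d O e _ TG 0)|exact: mK].
have -> : (fun w => (norm_L2 (noise_sum K n w - noise_sum K m w) ^+ 2)%:E) =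
          (fun w => (norm_L2 (0 + noise_sum K' n w) ^+ 2)%:E).
  apply/funext => w; rewrite add0r; congr ((norm_L2 _ ^+ 2)%:E).
  rewrite /noise_sum (big_ord_widen n (fun i => xi i w *: K i w) mn).
  rewrite [X in _ - X]big_mkcond -sumrB; apply: eq_bigr => i _.
  by rewrite /K'; case: ifP => _; rewrite ?subrr ?subr0 ?scaler0.
rewrite (@second_moment_finite (cst 0))//; last exact: (@coord_measurable_cst R d O e _ TG 0).
have -> : (fun w => (norm_L2 (cst (0 : H) w) ^+ 2 + tau * \sum_(k < n) norm_L2 (K' k w) ^+ 2)%:E)
        = (fun w => (tau%:E * ((kap n w)%:E - (kap m w)%:E))%E).
  apply/funext => w; rewrite norm_L2_0 expr0n/= add0r EFinM; congr (_ * _)%E.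
  rewrite -EFinB; congr EFin; rewrite /kap (big_ord_widen n (fun i => norm_L2 (K i w) ^+ 2) mn).
  rewrite [X in _ - X]big_mkcond -sumrB; apply: eq_bigr => i _.
  by rewrite /K'; case: ifP => _; rewrite ?subrr ?subr0 ?norm_L2_0 ?expr0n.
have ik j : P.-integrable setT (EFin \o kap j).
  apply/integrableP; split; first exact/measurable_EFinP.
  by under eq_integral do rewrite /= ger0_norm//; rewrite tE ltry.
rewrite integralZl//; last exact: (integrableB measurableT (ik n) (ik m)).
by rewrite (integralB measurableT (ik n) (ik m)) !tE -EFinB -EFinM.
Qed.

Let mS n : measurable_fun setT (fun w => norm_L2 (v w + noise_sum K n w) ^+ 2).
Proof.
apply: measurable_funX; apply: (coord_measurable_norm he); apply: coord_measurableD.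
  exact: TG_coord_measurable.
exact: noise_sum_measurable.
Qed.

Let mT n m : measurable_fun setT (fun w => norm_L2 (noise_sum K n w - noise_sum K m w) ^+ 2).
Proof.
apply: measurable_funX; apply: (coord_measurable_norm he).
by apply: coord_measurableB; exact: noise_sum_measurable.
Qed.

Let Nz_ge0 : {ae P, forall w, 0 <= Nz w}.
Proof. by apply: filterS NzE => w [z [_ ->]]; exact: sqr_ge0. Qed.

Let Np w := Num.max (Nz w) 0.
Let mNp : measurable_fun setT Np. Proof. exact: measurable_maxr. Qed.

Let NzNp : (\int[P]_w (Nz w)%:E = \int[P]_w (Np w)%:E)%E.
Proof.
apply: ae_eq_integral => //; [exact/measurable_EFinP|exact/measurable_EFinP|].
by apply: filterS Nz_ge0 => w h _; rewrite /Np max_l.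
Qed.

(** Fatou's lemma along the noise sums. *)
Let upper : (\int[P]_w (Np w)%:E <= (v2 + tau * limn t)%:E)%E.
Proof.
have mSE n : measurable_fun setT (fun w => (norm_L2 (v w + noise_sum K n w) ^+ 2)%:E).
  exact/measurable_EFinP.
have S0 n w : (0 <= (norm_L2 (v w + noise_sum K n w) ^+ 2)%:E)%E by rewrite lee_fin sqr_ge0.
apply: (@le_trans _ _ (\int[P]_w limn_einf (fun n => (norm_L2 (v w + noise_sum K n w) ^+ 2)%:E))%E).
  apply: ae_ge0_le_integral => //.
  - by move=> w _; rewrite lee_fin /Np le_max lexx orbT.
  - exact/measurable_EFinP.
  - by move=> w _; exact: limn_einf_ge0.
  - exact: measurable_limn_einf.
  apply: filterS2 Nz_ge0 NzE => w Nz0 [z [zS NzE']] _; rewrite /Np max_l// NzE'.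
  have cS : norm_L2 (v w + noise_sum K n w) @[n --> \oo] --> norm_L2 (v w + z).
    apply: cvg_norm_L2; under eq_fun do rewrite opprD addrACA subrr add0r norm_L2_distC.
    exact: zS.
  by rewrite (limn_einf_sqr cS).
apply: le_trans (fatou _ _ _ _) _ => //.
under eq_fun do rewrite moment.
apply: (@limn_einf_le_eventually _ _ _ 0%N) => n _.
by rewrite lee_fin lerD2l ler_wpM2l ?(ltW tau0)// nondecreasing_cvgn_le.
Qed.

(** By Fatou's lemma the mean squared distance from the limit to the m-th noise sum is
    at most a tail of the second moments, hence small for large m. *)
Let lower : ((v2 + tau * limn t)%:E <= \int[P]_w (Np w)%:E)%E.
Proof.
have Np0 w : (0 <= (Np w)%:E)%E by rewrite lee_fin /Np le_max lexx orbT.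
have Npfin : (\int[P]_w (Np w)%:E)%E \is a fin_num.
  by rewrite ge0_fin_numE ?integral_ge0// (le_lt_trans upper)// ltry.
set a := fine (\int[P]_w (Np w)%:E)%E.
have aE : (\int[P]_w (Np w)%:E)%E = a%:E by rewrite fineK.
have a0 : 0 <= a by rewrite fine_ge0// integral_ge0.
rewrite aE lee_fin; apply/ler_addgt0Pr => eps eps0.
pose dl := eps / (a + 2).
have a2 : 0 < a + 2 by lra.
have dl0 : 0 < dl by rewrite divr_gt0.
have c0 : 0 < tau * (1 + dl^-1) by rewrite mulr_gt0// addr_gt0// invr_gt0.
have [m hm] : exists m, limn t - t m <= dl / (tau * (1 + dl^-1)).
  have e1 : 0 < dl / (tau * (1 + dl^-1)) by rewrite divr_gt0.
  have /cvgrPdist_le/(_ _ e1)[m _ /(_ m (leqnn m))] := t_cvg.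
  by exists m; rewrite (le_trans (ler_norm _)).
have tm : 0 <= limn t - t m by rewrite subr_ge0; exact: nondecreasing_cvgn_le.
rewrite ler_pdivlMr// in hm.
pose Dm w := limn_einf (fun n => (norm_L2 (noise_sum K n w - noise_sum K m w) ^+ 2)%:E).
have mTE n : measurable_fun setT (fun w => (norm_L2 (noise_sum K n w - noise_sum K m w) ^+ 2)%:E).
  exact/measurable_EFinP.
have T0 n w : (0 <= (norm_L2 (noise_sum K n w - noise_sum K m w) ^+ 2)%:E)%E.
  by rewrite lee_fin sqr_ge0.
have mDm : measurable_fun setT Dm by exact: measurable_limn_einf.
have Dm0 w : (0 <= Dm w)%E by exact: limn_einf_ge0.
have DmI : (\int[P]_w Dm w <= (tau * (limn t - t m))%:E)%E.
  apply: le_trans (fatou _ _ _ _) _ => //.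
  apply: (@limn_einf_le_eventually _ _ _ m) => n mn.
  rewrite tail_moment// lee_fin ler_wpM2l ?(ltW tau0)// lerD2r.
  exact: nondecreasing_cvgn_le.
have key : ((v2 + tau * t m)%:E <= (1 + dl)%:E * a%:E + (1 + dl^-1)%:E * \int[P]_w Dm w)%E.
  have mNpE : measurable_fun setT (fun w => (Np w)%:E) by exact/measurable_EFinP.
  have d1 : (0 <= (1 + dl)%:E)%E by rewrite lee_fin addr_ge0// ltW.
  have d2 : (0 <= (1 + dl^-1)%:E)%E by rewrite lee_fin addr_ge0// invr_ge0 ltW.
  rewrite -moment -aE.
  have <- : (\int[P]_w ((1 + dl)%:E * (Np w)%:E) = (1 + dl)%:E * \int[P]_w (Np w)%:E)%E.
    by rewrite ge0_integralZl.
  have <- : (\int[P]_w ((1 + dl^-1)%:E * Dm w) = (1 + dl^-1)%:E * \int[P]_w Dm w)%E.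
    by rewrite ge0_integralZl.
  have mf1 : measurable_fun setT (fun w => (1 + dl)%:E * (Np w)%:E)%E by exact: emeasurable_funM.
  have mf2 : measurable_fun setT (fun w => (1 + dl^-1)%:E * Dm w)%E by exact: emeasurable_funM.
  rewrite -ge0_integralD//; first last.
  - by move=> w _; rewrite mule_ge0.
  - by move=> w _; rewrite mule_ge0.
  apply: ae_ge0_le_integral => //.
  - by move=> w _; rewrite lee_fin sqr_ge0.
  - exact/measurable_EFinP.
  - by move=> w _; rewrite adde_ge0// mule_ge0.
  - exact: emeasurable_funD.
  apply: filterS2 Nz_ge0 NzE => w Nz0 [z [zS NzE']] _; rewrite /Np max_l// NzE'.
  have DmE : Dm w = (norm_L2 (z - noise_sum K m w) ^+ 2)%:E.
    have cS : norm_L2 (noise_sum K n w - noise_sum K m w) @[n --> \oo] --> norm_L2 (z - noise_sum K m w).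
      apply: cvg_norm_L2; under eq_fun do rewrite opprB addrA subrK norm_L2_distC.
      exact: zS.
    by rewrite /Dm (limn_einf_sqr cS).
  rewrite DmE -!EFinM -EFinD lee_fin.
  (* (x + y)^2 <= (1 + dl) x^2 + (1 + 1/dl) y^2 *)
  have tri : norm_L2 (v w + noise_sum K m w) <= norm_L2 (v w + z) + norm_L2 (z - noise_sum K m w).
    have -> : v w + noise_sum K m w = (v w + z) + (noise_sum K m w - z).
      by rewrite addrACA subrr addr0.
    by rewrite (norm_L2_distC z); exact: norm_L2D.
  set x := norm_L2 (v w + z) in tri *; set y := norm_L2 (z - _) in tri *.
  have x0 : 0 <= x by exact: norm_L2_ge0.
  have y0 : 0 <= y by exact: norm_L2_ge0.
  apply: (@le_trans _ _ ((x + y) ^+ 2)).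
    by rewrite lerXn2r// nnegrE ?norm_L2_ge0// addr_ge0.
  have : 0 <= dl * (x - dl^-1 * y) ^+ 2 by rewrite mulr_ge0 ?sqr_ge0// ltW.
  have -> : dl * (x - dl^-1 * y) ^+ 2 = dl * x ^+ 2 - 2 * x * y + dl^-1 * y ^+ 2.
    by field; rewrite gt_eqF.
  by move=> h; nra.
have key2 : v2 + tau * t m <= (1 + dl) * a + (1 + dl^-1) * (tau * (limn t - t m)).
  rewrite -lee_fin; apply: (le_trans key).
  rewrite [leRHS]EFinD [((1 + dl) * a)%:E]EFinM [((1 + dl^-1) * _)%:E]EFinM.
  apply: leeD => //; apply: lee_wpmul2l => //.
  by rewrite lee_fin addr_ge0// invr_ge0 ltW.
have h1 : (1 + dl^-1) * (tau * (limn t - t m)) <= dl by rewrite mulrA mulrC [_ * tau]mulrC.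
have h2 : tau * (limn t - t m) <= dl.
  apply: le_trans h1; rewrite ler_peMl// ?mulr_ge0// ?(ltW tau0)//.
  by rewrite lerDl invr_ge0 ltW.
have h3 : dl * (a + 2) = eps by rewrite divfK// gt_eqF.
have : v2 + tau * limn t = v2 + tau * t m + tau * (limn t - t m) by ring.
by move=> ->; lra.
Qed.

Lemma second_moment_bounded :
  (\int[P]_w (Nz w)%:E = \int[P]_w ((norm_L2 (v w) ^+ 2)%:E +
     tau%:E * \sum_(0 <= k <oo) (norm_L2 (K k w) ^+ 2)%:E))%E.
Proof.
have K0 k w : (0 <= (norm_L2 (K k w) ^+ 2)%:E)%E by rewrite lee_fin sqr_ge0.
have mKk k : measurable_fun setT (fun w => (norm_L2 (K k w) ^+ 2)%:E).
  apply/measurable_EFinP; apply: measurable_funX; apply: (coord_measurable_norm he).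
  exact: TG_coord_measurable.
rewrite NzNp; have -> : (\int[P]_w (Np w)%:E)%E = (v2 + tau * limn t)%:E.
  by apply/eqP; rewrite eq_le upper lower.
rewrite ge0_integralD//; first last.
- apply: emeasurable_funM => //; apply: ge0_emeasurable_sum => //.
- by move=> w _; rewrite mule_ge0 ?nneseries_ge0// lee_fin ltW.
- exact/measurable_EFinP.
- by move=> w _; rewrite lee_fin sqr_ge0.
rewrite v2E ge0_integralZl//; first last.
- by rewrite lee_fin ltW.
- by move=> w _; exact: nneseries_ge0.
- exact: ge0_emeasurable_sum.
rewrite integral_nneseries// EFinD EFinM; congr (_ + _ * _)%E.
apply/esym; apply: cvg_lim => //.
have -> : (fun n => \sum_(0 <= k < n) \int[P]_w (norm_L2 (K k w) ^+ 2)%:E)%E = EFin \o t.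
  apply/funext => n; rewrite /= -tE /kap big_mkord.
  by under [RHS]eq_integral do rewrite -sumEFin; rewrite ge0_integral_sum.
by apply: cvg_EFin; [exact: nearW|exact: t_cvg].
Qed.

End bounded.

(** Ito's isometry for one increment, as an identity in [0, +oo]. The variable Nz
    stands for the squared norm of v + z, where the noise z is an almost sure limit.
    The bounded case is applied on the G-measurable events where the squared norms of
    v and K are at most M. *)
Theorem second_moment (v : Om -> H) (K : nat -> Om -> H) (Nz : Om -> R) :
  coord_measurable e (v : TG -> H) -> (forall k, coord_measurable e (K k : TG -> H)) ->
  (forall w, exists M, forall n, \sum_(k < n) norm_L2 (K k w) ^+ 2 <= M) ->
  measurable_fun setT Nz -> (forall w, 0 <= Nz w) ->
  {ae P, forall w, exists z : H,
    norm_L2 (z - noise_sum K m w) @[m --> \oo] --> (0 : R) /\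
    Nz w = norm_L2 (v w + z) ^+ 2} ->
  (\int[P]_w (Nz w)%:E = \int[P]_w (norm_L2 (v w) ^+ 2)%:E +
     tau%:E * \int[P]_w (\sum_(0 <= k <oo) (norm_L2 (K k w) ^+ 2)%:E))%E.
Proof.
move=> mv mK KM mNz Nz0 NzE.
have K0 k w : (0 <= (norm_L2 (K k w) ^+ 2)%:E)%E by rewrite lee_fin sqr_ge0.
have mvG : measurable_fun setT ((fun w => norm_L2 (v w) ^+ 2) : TG -> R).
  by apply: measurable_funX; exact: (coord_measurable_norm he).
have mKG k : measurable_fun setT ((fun w => norm_L2 (K k w) ^+ 2) : TG -> R).
  by apply: measurable_funX; exact: (coord_measurable_norm he).
pose A M : set Om := [set w | norm_L2 (v w) ^+ 2 <= M%:R] `&`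
   \bigcap_n [set w | \sum_(k < n) norm_L2 (K k w) ^+ 2 <= M%:R].
have le_meas (h : Om -> R) (c : R) : measurable_fun setT (h : TG -> R) ->
    measurable ([set w | h w <= c] : set TG).
  move=> mh; rewrite (_ : [set w | _] = setT `&` h @^-1` `]-oo, c]).
    by apply: mh => //; exact: measurable_itv.
  by rewrite setTI predeqE => w /=; rewrite in_itv.
have mAG M : measurable (A M : set TG).
  apply: measurableI; first exact: le_meas.
  by apply: bigcapT_measurable => n; apply: le_meas; exact: measurable_sum.
have mA M : measurable (A M) by apply: Gmeas; exact/measurable_TG.
have ndA : nondecreasing_seq A.
  move=> M M' MM'; rewrite subsetEset => w [h1 h2]; split.
    by rewrite /= (le_trans h1)// ler_nat.
  by move=> n _; rewrite /= (le_trans (h2 n I))// ler_nat.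
have UA : \bigcup_M A M = setT.
  rewrite predeqE => w; split=> // _.
  have [M hM] := KM w; exists (Num.truncn (Num.max M (norm_L2 (v w) ^+ 2))).+1 => //.
  have h : Num.max M (norm_L2 (v w) ^+ 2) <=
      (Num.truncn (Num.max M (norm_L2 (v w) ^+ 2))).+1%:R by rewrite ltW// truncnS_gt.
  split; first by rewrite /= (le_trans _ h)// le_max lexx orbT.
  by move=> n _; rewrite /= (le_trans (hM n))// (le_trans _ h)// le_max lexx.
pose rhs w := ((norm_L2 (v w) ^+ 2)%:E + tau%:E * \sum_(0 <= k <oo) (norm_L2 (K k w) ^+ 2)%:E)%E.
have mser : measurable_fun setT (fun w => \sum_(0 <= k <oo) (norm_L2 (K k w) ^+ 2)%:E)%E.
  by apply: ge0_emeasurable_sum => // k _; apply/measurable_EFinP; exact: TG_measurable_fun.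
have mv2 : measurable_fun setT (fun w => (norm_L2 (v w) ^+ 2)%:E).
  by apply/measurable_EFinP; exact: TG_measurable_fun.
have mrhs : measurable_fun setT rhs.
  by apply: emeasurable_funD => //; exact: emeasurable_funM.
have rhs0 w : (0 <= rhs w)%E.
  by rewrite adde_ge0 ?mule_ge0 ?nneseries_ge0// lee_fin ?sqr_ge0// ltW.
have onA M : (\int[P]_(w in A M) (Nz w)%:E = \int[P]_(w in A M) rhs w)%E.
  rewrite integral_mkcond [RHS]integral_mkcond.
  pose v' w : H := \1_(A M) w *: v w.
  pose K' k w : H := \1_(A M) w *: K k w.
  have m1 : measurable_fun setT (\1_(A M) : TG -> R) by exact: measurable_indic.
  have mv' : coord_measurable e (v' : TG -> H) by exact: coord_measurableZ.
  have mK' k : coord_measurable e (K' k : TG -> H) by exact: coord_measurableZ.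
  have i01 w : \1_(A M) w = 1 :> R \/ \1_(A M) w = 0 :> R.
    by rewrite indicE; case: (_ \in _); [left|right].
  have nK' k w : norm_L2 (K' k w) ^+ 2 = \1_(A M) w * norm_L2 (K k w) ^+ 2.
    by rewrite norm_L2Z exprMn; have [->|->] := i01 w; rewrite ?normr1 ?normr0 ?expr1n ?expr0n.
  have nv' w : norm_L2 (v' w) ^+ 2 = \1_(A M) w * norm_L2 (v w) ^+ 2.
    by rewrite norm_L2Z exprMn; have [->|->] := i01 w; rewrite ?normr1 ?normr0 ?expr1n ?expr0n.
  have := @second_moment_bounded v' K' (fun w => \1_(A M) w * Nz w) M%:R mv' mK'.
  have -> : (fun w => ((fun w => (Nz w)%:E) \_ (A M)) w) = (fun w => (\1_(A M) w * Nz w)%:E).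
    by apply/funext => w; rewrite patchE indicE; case: ifP => _; rewrite ?mul1r ?mul0r.
  move=> ->.
  - apply: eq_integral => w _; rewrite patchE nv'.
    under eq_eseriesr do rewrite nK'.
    rewrite indicE; case: ifP => _; first by rewrite mul1r; under eq_eseriesr do rewrite mul1r.
    rewrite mul0r; under eq_eseriesr do rewrite mul0r.
    by rewrite eseries0// mule0 adde0.
  - move=> w; rewrite nv' indicE; case: (boolP (w \in A M)) => [|_]; last by rewrite mul0r ler0n.
    by rewrite inE mul1r => -[].
  - move=> w n; under eq_bigr do rewrite nK'.
    rewrite -mulr_sumr indicE; case: (boolP (w \in A M)) => [|_]; last by rewrite mul0r ler0n.
    by rewrite inE mul1r => -[_]; exact.
  - by apply: measurable_funM => //; exact: measurable_indic.
  - apply: filterS NzE => w [z [zS ->]]; exists (\1_(A M) w *: z).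
    have nsE m : noise_sum K' m w = \1_(A M) w *: noise_sum K m w.
      rewrite /noise_sum scaler_sumr; apply: eq_bigr => k _.
      by rewrite /K' !scalerA mulrC.
    split.
      have -> : (fun m => norm_L2 (\1_(A M) w *: z - noise_sum K' m w)) =
          (fun m => `|\1_(A M) w| * norm_L2 (z - noise_sum K m w)).
        by apply/funext => m; rewrite nsE -scalerBr norm_L2Z.
      rewrite -[X in _ --> X](mulr0 `|\1_(A M) w|).
      by apply: cvgM; [exact: cvg_cst|exact: zS].
    rewrite /v' -scalerDr norm_L2Z exprMn.
    by have [->|->] := i01 w; rewrite ?normr1 ?normr0 ?expr1n ?expr0n.
have c1 := @ge0_nondecreasing_set_cvg_integral _ _ _ A (EFin \o Nz) P ndA mA.
have c2 := @ge0_nondecreasing_set_cvg_integral _ _ _ A rhs P ndA mA.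
rewrite UA in c1 c2.
have e1 : (\int[P]_w (Nz w)%:E = \int[P]_w rhs w)%E.
  have c1' : (\int[P]_(w in A i) (Nz w)%:E @[i --> \oo] --> \int[P]_w (Nz w)%:E)%E.
    apply: c1 => [i|i w _]; last by rewrite /= lee_fin.
    by apply: measurable_funTS; exact/measurable_EFinP.
  have c2' : (\int[P]_(w in A i) rhs w @[i --> \oo] --> \int[P]_w rhs w)%E.
    by apply: c2 => [i|i w _]; [exact: measurable_funTS|exact: rhs0].
  rewrite (_ : (fun i => _) = (fun i => \int[P]_(w in A i) rhs w)%E) in c1'.
    exact: (cvg_unique _ c1' c2').
  by apply/funext => i; exact: onA.
rewrite e1 /rhs ge0_integralD//; first last.
- exact: emeasurable_funM.
- by move=> w _; rewrite mule_ge0 ?nneseries_ge0// lee_fin ltW.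
- by move=> w _; rewrite lee_fin sqr_ge0.
rewrite ge0_integralZl//; last by rewrite lee_fin ltW.
by move=> w _; exact: nneseries_ge0.
Qed.

End second_moment.

(** * The completed filtration and the Wiener increments *)

Section completion.
Context dO (Om : measurableType dO) (R : realType) (P : probability Om R).
Implicit Types (F G : set (set Om)) (A B : set Om).

(** The iterates of the schemes are only prescribed almost surely, so they can be
    measurable with respect to such an enlargement only. *)
Definition completion F : set (set Om) := [set A | measurable A /\
  exists2 B, F B & P.-negligible ((A `\` B) `|` (B `\` A))].

Lemma sub_completion F : F `<=` measurable -> F `<=` completion F.
Proof.
move=> Fm A FA; split; first exact: Fm.
by exists A => //; rewrite setDv setU0; exact: negligible_set0.
Qed.

Lemma completion_measurable F : completion F `<=` measurable.
Proof. by move=> A []. Qed.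

Lemma completion_mono F G : F `<=` G -> completion F `<=` completion G.
Proof. by move=> FG A [mA [B FB AB]]; split=> //; exists B => //; exact: FG. Qed.

Lemma completion_sigma F : sigma_algebra setT F -> sigma_algebra setT (completion F).
Proof.
move=> [F0 FC FU]; split.
- by split=> //; exists set0 => //; rewrite setDv setU0; exact: negligible_set0.
- move=> A [mA [B FB AB]]; split; first by rewrite setTD; exact: measurableC.
  exists (setT `\` B); first exact: FC.
  apply: negligibleS AB => w /=; rewrite /setD/=.
  by case=> -[[_ h] k]; [right|left]; split=> //; apply: contrapT => k'; apply: k.
- move=> A hA; split; first by apply: bigcupT_measurable => n; have [] := hA n.
  have hB' n : exists B, F B /\ P.-negligible ((A n `\` B) `|` (B `\` A n)).
    by have [_ [B FB nB]] := hA n; exists B.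
  have [B hB] := choice hB'.
  exists (\bigcup_n B n); first by apply: FU => n; have [] := hB n.
  have := negligible_bigcup (fun n => (hB n).2); apply: negligibleS => w.
  case=> -[[n _ hn] h]; exists n => //; [left|right]; split=> // h'; apply: h; exists n => //.
Qed.

Lemma negligible_eq_measure A B : measurable A -> measurable B ->
  P.-negligible ((A `\` B) `|` (B `\` A)) -> P A = P B.
Proof.
move=> mA mB; wlog suff : A B mA mB / P.-negligible ((A `\` B) `|` (B `\` A)) -> (P A <= P B)%E.
  by move=> h AB; apply/eqP; rewrite eq_le h//= h// setUC.
move=> [N [mN N0 ABN]]; apply: (@le_trans _ _ (P (B `|` N))).
  apply: le_measure; rewrite ?inE//; first exact: measurableU.
  move=> w Aw; have [Bw|nBw] := pselect (B w); first by left.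
  by right; apply: ABN; left.
rewrite -[leRHS]adde0; apply: (le_trans (measureU2 P mB mN)).
by apply: leeD => //; rewrite -N0; exact: lexx.
Qed.

(** Null events do not affect independence. *)
Lemma completion_independent F (S : set (set Om)) :
  F `<=` measurable -> S `<=` measurable ->
  (forall A B, F A -> S B -> (P (A `&` B) = P A * P B)%E) ->
  forall A B, completion F A -> S B -> (P (A `&` B) = P A * P B)%E.
Proof.
move=> Fm Sm FS A B [mA [A' FA' AA']] SB.
have mA' := Fm _ FA'; have mB := Sm _ SB.
rewrite (negligible_eq_measure mA mA' AA') -FS//.
apply: negligible_eq_measure; [exact: measurableI|exact: measurableI|].
apply: negligibleS AA' => w [[[h1 h2] h3]|[[h1 h2] h3]]; [left|right]; split=> // h4.
  by apply: h3.
by apply: h3.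
Qed.

Lemma completion_ae_eq F (X Y : Om -> R) : measurable_fun setT X ->
  measurable_wrt (completion F) Y -> {ae P, forall w, X w = Y w} ->
  measurable_wrt (completion F) X.
Proof.
move=> mX mY XY A mA; have [mYA [B FB YB]] := mY A mA; split.
  by rewrite -[X in measurable X]setTI; exact: mX.
exists B => //; have := negligibleU YB XY; apply: negligibleS => w /=.
have [e|ne] := pselect (X w = Y w); last by right.
by rewrite e; left.
Qed.

Lemma measurable_wrtP G (X : Om -> R) : sigma_algebra setT G ->
  measurable_wrt G X <-> measurable_fun setT (X : g_sigma_algebraType G -> R).
Proof.
move=> sG; split=> [h _ A mA|h A mA].
  by rewrite setTI; apply/measurable_TG => //; exact: h.
by apply/(measurable_TG sG); have := h measurableT A mA; rewrite setTI.
Qed.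

Lemma measurable_wrt_sub F G (X : Om -> R) : F `<=` G -> measurable_wrt F X -> measurable_wrt G X.
Proof. by move=> FG h A mA; apply: FG; exact: h. Qed.

End completion.

Section wiener_noise.
Context dO (Om : measurableType dO) (R : realType) (P : probability Om R).
Variables (Fil : R -> set (set Om)) (beta : nat -> R -> Om -> R).
Hypothesis hFil : filtration Fil.
Hypothesis hbeta : wiener_coordinates P Fil beta.
Variables (s t : R).
Hypothesis s0 : 0 <= s.
Hypothesis st : s < t.

Let t0 : 0 <= t. Proof. exact: le_trans (ltW st). Qed.

Definition increment k w := beta k t w - beta k s w.

Lemma measurable_increment k : measurable_fun setT (increment k).
Proof.
by apply: measurable_funB; apply: (brownian_measurable (wiener_brownian hbeta k)).
Qed.

Lemma increment_law k (A : set R) : measurable A ->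
  P (increment k @^-1` A) = normal_prob 0 (Num.sqrt (t - s)) A.
Proof. exact: (brownian_gaussian (wiener_brownian hbeta k)). Qed.

Let increment_generated k (A : set R) : measurable A ->
  sigma_generated `[0, +oo[ (beta k) (increment k @^-1` A).
Proof.
move=> mA.
pose gen : set (set Om) := [set B | exists i (A : set R),
  [/\ `[0, +oo[%classic i, measurable A & B = beta k i @^-1` A]].
have mb r : 0 <= r -> measurable_fun setT (beta k r : g_sigma_algebraType gen -> R).
  move=> r0 _ B mB; rewrite setTI; apply: sub_sigma_algebra.
  by exists r, B; split=> //=; rewrite in_itv/= r0.
have mi : measurable_fun setT (increment k : g_sigma_algebraType gen -> R).
  by apply: measurable_funB; exact: mb.
by have := mi measurableT A mA; rewrite setTI.
Qed.

Lemma increment_pair k l (A B : set R) : k != l -> measurable A -> measurable B ->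
  (P (increment k @^-1` A `&` increment l @^-1` B) =
   P (increment k @^-1` A) * P (increment l @^-1` B))%E.
Proof.
move=> kl mA mB; pose n := (maxn k l).+1.
have kn : (k < n)%N by rewrite ltnS leq_maxl.
have ln : (l < n)%N by rewrite ltnS leq_maxr.
(* No condition on the coordinates other than k and l. *)
pose C i : set Om := if i == k then increment k @^-1` A
                     else if i == l then increment l @^-1` B else setT.
have Ck : C k = increment k @^-1` A by rewrite /C eqxx.
have Cl : C l = increment l @^-1` B by rewrite /C eq_sym (negbTE kl) eqxx.
have := wiener_independent hbeta (n := n) (A := C).
have -> : \bigcap_(i < n) C i = increment k @^-1` A `&` increment l @^-1` B.
  rewrite predeqE => w; split=> [h|[h1 h2] i _].
    by split; [have := h k kn; rewrite Ck|have := h l ln; rewrite Cl].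
  by rewrite /C; case: ifP => // _; case: ifP.
move=> -> => [|i _]; last first.
  rewrite /C; case: eqP => [->|_]; first exact: increment_generated.
  case: eqP => [->|_]; first exact: increment_generated.
  by rewrite -(preimage_setT (increment i)); apply: increment_generated.
rewrite (bigD1 (Ordinal kn))//= Ck; congr (_ * _)%E.
rewrite (bigD1 (Ordinal ln))/=; last by rewrite eq_sym -val_eqE/= kl.
rewrite Cl big1 ?mule1// => i /andP[ik il].
rewrite /C -!val_eqE/= in ik il *; rewrite (negbTE ik) (negbTE il).
exact: probability_setT.
Qed.

Lemma increment_adapted k : measurable_wrt (completion P (Fil t)) (increment k).
Proof.
have sF := filtration_sigma hFil t0; have sG := completion_sigma P sF.
have sub := sub_completion P (filtration_sub hFil t0).
apply/(measurable_wrtP _ sG).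
have mt := wiener_adapted hbeta k t0.
have ms : measurable_wrt (Fil t) (beta k s).
  move=> A mA; apply: (filtration_mono hFil s0 (ltW st)); exact: (wiener_adapted hbeta).
apply: measurable_funB; apply/(measurable_wrtP _ sG); apply: measurable_wrt_sub sub _ => //.
Qed.

Lemma increment_independent (A B : set Om) : completion P (Fil s) A ->
  sigma_generated [set: nat] increment B -> (P (A `&` B) = P A * P B)%E.
Proof.
apply: completion_independent; first exact: (filtration_sub hFil s0).
  apply: smallest_sub; first exact: sigma_algebra_measurable.
  move=> _ [k [C [_ mC ->]]]; rewrite -[X in measurable X]setTI.
  exact: measurable_increment.
by move=> A' B' FA' SB'; apply: (wiener_increments hbeta s0 (ltW st)).
Qed.

End wiener_noise.

(** * Energy balance of one step *)

Section energy_step.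
Variables (R : realType) (d : nat) (O : polygonal_domain R d).
Local Notation H := (L2 O).
Variables (lam : nat -> R) (e : nat -> H).
Hypothesis he : dirichlet_eigenbasis lam e.
Implicit Types (f z u v x F : H).
Local Notation dotH := (dotH lam e).
Local Notation norm1 := (norm_dotH lam e 1).
Local Notation lap := (laplacian lam e).

(** The work of the force equals the increase of the auxiliary energy: this is the
    point of the scalar auxiliary variable. *)
Lemma sav_work f x (q q' r : R) : r != 0 -> q' = q + inner f x / (2 * r) ->
  inner (((q + q') / 2 / r) *: f) x = q' ^+ 2 - q ^+ 2.
Proof.
move=> r0 ->; rewrite innerZl; set a := inner f x; by field.
Qed.

(** The scheme gives v' - (v + z) and v' + (v + z). Their inner product is the change
    of kinetic energy; by Green's formula the Laplacian contributes the change of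
    elastic energy, and the force contributes its work. *)
Lemma midpoint_step_energy (tau : R) u v u' v' z F : tau != 0 ->
  dotH 1 u -> dotH 1 u' -> dotH 2 (u + u') ->
  u' =ae u + (tau / 2) *: (v + v') + (tau / 2) *: z ->
  v' =ae v + (tau / 2) *: lap (u + u') - tau *: F + z ->
  norm1 u' ^+ 2 + norm_L2 v' ^+ 2 + 2 * inner F (u' - u) =
  norm1 u ^+ 2 + norm_L2 (v + z) ^+ 2.
Proof.
move=> tau0 hu hu' hS eu ev.
have e1 : v' - (v + z) =ae (tau / 2) *: lap (u + u') - tau *: F.
  apply: (coord_inj he) => i; have := coord_ext e ev i.
  rewrite !(innerBl, innerDl, innerZl, innerNl) => ->; ring.
have e2 : v' + (v + z) =ae (2 / tau) *: (u' - u).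
  apply: (coord_inj he) => i; have := coord_ext e eu i.
  by rewrite !(innerBl, innerDl, innerZl, innerNl) => ->; field.
have h1 : norm_L2 v' ^+ 2 - norm_L2 (v + z) ^+ 2 = inner (v' - (v + z)) (v' + (v + z)).
  move: (v + z) => w; rewrite !norm_L2_sqr innerBl !innerDr [inner w v']innerC.
  by set a := inner v' v'; set b := inner v' w; set c := inner w w; ring.
have h2 : inner1 lam e (u + u') (u' - u) = norm1 u' ^+ 2 - norm1 u ^+ 2.
  rewrite !norm_dotH1_sqr (inner1Dl he _ hu hu') [inner1 lam e u (u' - u)]inner1C
    [inner1 lam e u' (u' - u)]inner1C.
  rewrite (inner1Bl he u hu' hu) (inner1Bl he u' hu' hu) [inner1 lam e u u']inner1C.
  by set a := inner1 lam e u' u'; set b := inner1 lam e u' u; set c := inner1 lam e u u; ring.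
have h3 : inner1 lam e (u + u') (u' - u) = - inner (lap (u + u')) (u' - u).
  by apply: (green he hS); exact: dotHB.
move: h1; rewrite (eq_L2_inner _ e1) innerC (eq_L2_inner _ e2) innerZl => h1.
rewrite (innerBr (u' - u)) !(innerZr _ (u' - u)) ![inner (u' - u) _]innerC in h1.
have h4 : 2 / tau * (tau / 2 * inner (lap (u + u')) (u' - u) - tau * inner F (u' - u)) =
    inner (lap (u + u')) (u' - u) - 2 * inner F (u' - u).
  by set a := inner _ _; set b := inner F _; field.
by rewrite h4 in h1; lra.
Qed.

(** Eliminating v' from the midpoint equations in the i-th mode. *)
Lemma midpoint_step_coord (tau : R) u v u' v' z F i : tau != 0 -> dotH 2 (u + u') ->
  u' =ae u + (tau / 2) *: (v + v') + (tau / 2) *: z ->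
  v' =ae v + (tau / 2) *: lap (u + u') - tau *: F + z ->
  inner u' (e i) = (inner u (e i) + tau * (inner v (e i) + inner z (e i))
     - tau ^+ 2 / 4 * lam i * inner u (e i)) / (1 + tau ^+ 2 / 4 * lam i)
     - tau ^+ 2 / 2 * inner F (e i) / (1 + tau ^+ 2 / 4 * lam i) /\
  inner v' (e i) = 2 / tau * (inner u' (e i) - inner u (e i)) - inner v (e i) - inner z (e i).
Proof.
move=> tau0 hS eu ev; have := coord_ext e eu i; have := coord_ext e ev i.
rewrite !(innerDl, innerBl, innerZl) (laplacian_coord he _ hS) innerNl innerZl innerDl.
set a := inner u' _; set b := inner v' _; set a0 := inner u _; set b0 := inner v _.
set c := inner z _; set f0 := inner F _ => h1 h2.
have lam0 : 0 < lam i by exact: (eigenvalue_gt0 he).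
have den : 1 + tau ^+ 2 / 4 * lam i != 0.
  by rewrite gt_eqF// addr_gt0// mulr_gt0// divr_gt0// exprn_even_gt0.
split; last by rewrite h2; field.
apply: (mulIf den); rewrite mulrBl !divfK//.
rewrite mulrDr mulr1 {1}h2 h1. by field.
Qed.

(** The part of u' caused by a force f in the midpoint equations: by
    midpoint_step_coord it is linear in f, mode by mode. *)
Definition midpoint_response (tau : R) f : H := xget 0 [set k | forall i,
  inner k (e i) = - (tau ^+ 2 / 2 * inner f (e i) / (1 + tau ^+ 2 / 4 * lam i))].

Lemma midpoint_response_coord (tau : R) f i : inner (midpoint_response tau f) (e i) =
  - (tau ^+ 2 / 2 * inner f (e i) / (1 + tau ^+ 2 / 4 * lam i)).
Proof.
move: i; apply: (@xgetPex _ 0 [set k | forall i,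
  inner k (e i) = - (tau ^+ 2 / 2 * inner f (e i) / (1 + tau ^+ 2 / 4 * lam i))]).
apply: (riesz_fischer he (M := (tau ^+ 2 / 2) ^+ 2 * inner f f)) => n.
apply: (@le_trans _ _ (\sum_(i < n) (tau ^+ 2 / 2) ^+ 2 * inner f (e i) ^+ 2)); last first.
  by rewrite -mulr_sumr ler_wpM2l ?sqr_ge0// (bessel he).
apply: ler_sum => i _; rewrite sqrrN -exprMn expr_div_n.
have den : 1 <= 1 + tau ^+ 2 / 4 * lam i.
  by rewrite lerDl mulr_ge0 ?divr_ge0 ?sqr_ge0// ltW// (eigenvalue_gt0 he).
rewrite ler_piMr ?sqr_ge0// invf_le1 ?exprn_gt0 ?(lt_le_trans _ den)//.
by rewrite exprn_ege1.
Qed.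

Lemma inner_midpoint_response_le0 (tau : R) f : inner f (midpoint_response tau f) <= 0.
Proof.
have c := @parseval _ _ _ _ _ he f (midpoint_response tau f).
rewrite -(cvg_lim _ c)//; apply: limr_le; first by apply/cvg_ex; eexists; exact: c.
apply: nearW => n; apply: sumr_le0 => i _; rewrite midpoint_response_coord mulrN oppr_le0.
set a := inner f (e i); set den := 1 + _.
have den0 : 0 <= den.
  by rewrite addr_ge0// mulr_ge0 ?divr_ge0 ?sqr_ge0// ltW// (eigenvalue_gt0 he).
have -> : a * (tau ^+ 2 / 2 * a / den) = tau ^+ 2 / 2 * a ^+ 2 / den by ring.
by rewrite divr_ge0// mulr_ge0 ?divr_ge0 ?sqr_ge0.
Qed.

End energy_step.

Section exponential_coordinates.
Variables (R : realType) (d : nat) (O : polygonal_domain R d).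
Local Notation H := (L2 O).
Variables (lam : nat -> R) (e : nat -> H).
Hypothesis he : dirichlet_eigenbasis lam e.
Variable E : R -> H * H -> H * H.
Hypothesis hE : wave_group lam e E.
Implicit Types (f x y z : H) (X Y Z : H * H).
Local Notation "<< X , Y >>" := (inner_HH1 lam e X Y).
Local Notation "X =hh Y" := (eq_HH X Y) (at level 70).
Local Notation response := (wave_response lam e E).

Lemma inner_HH1_snd z X : << (0, z), X >> = inner z X.2.
Proof.
rewrite inner_HH1.unlock /= (_ : inner1 lam e 0 X.1 = 0) ?add0r//.
by rewrite -(scale0r (0 : H)) (inner1Zl he) ?mul0r//; exact: dotH0.
Qed.

Lemma wave_response_coord1 t f i : inner (response t f).1 (e i) =
  (inner f (E (- t) (e i, 0)).1 - inner f (e i)) / lam i.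
Proof.
have hp := wave_dom_HH1 he (force_potential_dom he f).
rewrite innerBl (wave_group_coord1 he hE _ _ hp) force_potential_coord//.
rewrite inner_HH1C inner_force_potential//; last exact: (wave_group_stable hE _ (HH1_e1 he i)).
by rewrite mulrBl.
Qed.

Lemma wave_response_coord2 t f i : inner (response t f).2 (e i) =
  inner f (E (- t) (0, e i)).1.
Proof.
have hp := wave_dom_HH1 he (force_potential_dom he f).
rewrite innerBl (wave_group_coord2 he hE _ _ hp) inner0l subr0.
rewrite inner_HH1C inner_force_potential//.
exact: (wave_group_stable hE _ (HH1_snd lam e (e i))).
Qed.

(** Like the midpoint scheme, the exponential scheme is affine in the scalar a that
    multiplies the force, with coefficients that are pairings with fixed vectors. *)
Lemma exponential_step_coord t X z a f X' Y i : HH1 lam e X -> wave_dom lam e Y ->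
  wave_op lam e Y =hh E t (0, - (a *: f)) - (0, - (a *: f)) ->
  X' =hh E t X + Y + E t (0, z) ->
  inner X'.1 (e i) = (<< X, E (- t) (e i, 0) >> + inner z (E (- t) (e i, 0)).2) / lam i
    + a * inner (response t f).1 (e i) /\
  inner X'.2 (e i) = << X, E (- t) (0, e i) >> + inner z (E (- t) (0, e i)).2
    + a * inner (response t f).2 (e i).
Proof.
move=> hX hY eY [e1 e2]; have hz := HH1_snd lam e z.
have [r1 r2] := eq_HH_trans he (wave_responseP he hE hY eY) (wave_responseZ he hE t a f).
move: (response t f) r1 r2 => r r1 r2; split.
  rewrite (coord_ext e e1) !innerDl (coord_ext e r1) innerZl.
  rewrite (wave_group_coord1 he hE _ _ hX) (wave_group_coord1 he hE _ _ hz) inner_HH1_snd.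
  by rewrite mulrDl addrAC.
rewrite (coord_ext e e2) !innerDl (coord_ext e r2) innerZl.
rewrite (wave_group_coord2 he hE _ _ hX) (wave_group_coord2 he hE _ _ hz) inner_HH1_snd.
by rewrite addrAC.
Qed.

End exponential_coordinates.

(** * Measurability of the implicit multiplier *)

Section ae_measurability.
Context dO (Om : measurableType dO) (R : realType) (P : probability Om R).
Variable G : set (set Om).
Local Notation TG := (g_sigma_algebraType G).
Implicit Types X Y : Om -> R.

(** Noise increments are only determined almost surely, so measurability with
    respect to G is tracked up to null events and recovered from the completion at
    the end. *)
Definition ae_measurable X :=
  exists2 Y, measurable_fun setT (Y : TG -> R) & {ae P, forall w, X w = Y w}.

Lemma ae_measurable_ext X Y :
  {ae P, forall w, X w = Y w} -> ae_measurable Y -> ae_measurable X.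
Proof.
move=> h [Z mZ YZ]; exists Z => //.
by apply: filterS2 h YZ => w -> ->.
Qed.

Lemma measurable_ae X : measurable_fun setT (X : TG -> R) -> ae_measurable X.
Proof. by move=> mX; exists X => //; exact: aeW. Qed.

Lemma ae_measurableD X Y : ae_measurable X -> ae_measurable Y ->
  ae_measurable (fun w => X w + Y w).
Proof.
move=> [X' mX eX] [Y' mY eY]; exists (fun w => X' w + Y' w).
  exact: (measurable_funD mX mY).
by apply: filterS2 eX eY => w -> ->.
Qed.

Lemma ae_measurableM X Y : ae_measurable X -> ae_measurable Y ->
  ae_measurable (fun w => X w * Y w).
Proof.
move=> [X' mX eX] [Y' mY eY]; exists (fun w => X' w * Y' w).
  exact: (measurable_funM mX mY).
by apply: filterS2 eX eY => w -> ->.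
Qed.

Lemma ae_measurable_cst a : ae_measurable (fun=> a).
Proof. by apply: measurable_ae; exact: measurable_cst. Qed.

Lemma ae_measurableZ a X : ae_measurable X -> ae_measurable (fun w => a * X w).
Proof. by apply: ae_measurableM; exact: ae_measurable_cst. Qed.

Lemma ae_measurableB X Y : ae_measurable X -> ae_measurable Y ->
  ae_measurable (fun w => X w - Y w).
Proof.
move=> mX mY; apply: ae_measurableD => //.
rewrite (_ : (fun w => - Y w) = (fun w => -1 * Y w)); first exact: ae_measurableZ.
by apply/funext => w; rewrite mulN1r.
Qed.

Lemma ae_measurable_lim (Xn : nat -> Om -> R) X : (forall n, ae_measurable (Xn n)) ->
  {ae P, forall w, Xn n w @[n --> \oo] --> X w} -> ae_measurable X.
Proof.
move=> mX XnX.
have /choice[Y hY] : forall n, exists Y,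
    measurable_fun setT (Y : TG -> R) /\ {ae P, forall w, Xn n w = Y w}.
  by move=> n; have [Y] := mX n; exists Y.
pose h w := fine (limn_esup (fun n => (Y n w)%:E)).
exists h.
  have m : measurable_fun setT (fun w : TG => limn_esup (fun n => (Y n w)%:E)).
    by apply: measurable_fun_limn_esup => n; apply/measurable_EFinP; exact: (hY n).1.
  by apply: (@measurableT_comp _ _ _ _ _ _ fine) m; exact: fine_measurable.
have XY : {ae P, forall w, forall n, Xn n w = Y n w}.
  by apply: (@ae_foralln _ _ _ P (fun n w => Xn n w = Y n w)) => n; exact: (hY n).2.
apply: filterS2 XnX XY => w cw ew; rewrite /h.
have : (Y n w)%:E @[n --> \oo] --> (X w)%:E.
  apply: cvg_EFin; first exact: nearW.
  rewrite (_ : fine \o _ = (fun n => Xn n w))//.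
  by apply/funext => n /=; rewrite ew.
by move/cvg_limn_einf_sup => [_ ->].
Qed.

End ae_measurability.

Section recover_multiplier.
Variables (R : realType) (d : nat) (O : polygonal_domain R d).
Local Notation H := (L2 O).
Variables (lam : nat -> R) (e : nat -> H).
Hypothesis he : dirichlet_eigenbasis lam e.
Context dO (Om : measurableType dO) (P : probability Om R).
Variable G : set (set Om).
Local Notation TG := (g_sigma_algebraType G).

(** The implicit auxiliary variable enters the new position u' affinely, through the
    scalar multiplier (q + q') / 2 / r and a response of nonpositive work. Hence the
    multiplier solves a scalar linear equation with positive leading coefficient,
    and inherits the measurability of the data. *)
Lemma multiplier_ae_measurable (f kap u u' : Om -> H) (q q' r : Om -> R)
    (alpha : nat -> Om -> R) :
  coord_measurable e (f : TG -> H) -> coord_measurable e (kap : TG -> H) ->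
  coord_measurable e (u : TG -> H) ->
  measurable_fun setT (q : TG -> R) -> measurable_fun setT (r : TG -> R) ->
  (forall w, 0 < r w) -> (forall w, inner (f w) (kap w) <= 0) ->
  (forall i, ae_measurable P G (alpha i)) ->
  {ae P, forall w, q' w = q w + inner (f w) (u' w - u w) / (2 * r w) /\
    forall i, inner (u' w) (e i) =
      alpha i w + (q w + q' w) / 2 / r w * inner (kap w) (e i)} ->
  ae_measurable P G (fun w => (q w + q' w) / 2 / r w).
Proof.
move=> mf mk mu mq mr r0 k0 ma step.
pose s w := (q w + q' w) / 2 / r w.
pose k w := inner (f w) (kap w).
pose a w := inner (f w) (u' w - u w) - s w * k w.
(* Eliminating q' between q' = q + (a + s * k) / (2 * r) and q + q' = 2 * r * s leaves
   pos * s = 2 * q + a / (2 * r). The power -1 is the inverse of a positive number. *)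
pose pos w := 2 * r w - k w * (2 * r w) `^ (-1).
have mr2 : measurable_fun setT ((fun w => (2 * r w) `^ (-1)) : TG -> R).
  by apply: (measurableT_comp (measurable_powR (-1))); exact: measurable_funM.
have mpos : measurable_fun setT (pos : TG -> R).
  apply: measurable_funB; first exact: measurable_funM.
  by apply: measurable_funM => //; exact: (coord_measurable_inner he).
have r2 w : (2 * r w) `^ (-1) = (2 * r w)^-1 by rewrite powR_inv1// ltW// mulr_gt0.
have pos0 w : 0 < pos w.
  have r2w : 0 < 2 * r w by rewrite mulr_gt0.
  rewrite /pos r2 subr_gt0; apply: le_lt_trans r2w.
  by rewrite pmulr_lle0 ?invr_gt0 ?mulr_gt0//; exact: k0.
have mas : ae_measurable P G a.
  apply: (@ae_measurable_lim _ _ _ _ _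
    (fun n w => \sum_(i < n) inner (f w) (e i) * (alpha i w - inner (u w) (e i)))).
    elim=> [|n IH].
      by under eq_fun do rewrite big_ord0; exact: ae_measurable_cst.
    under eq_fun do rewrite big_ord_recr/=.
    apply: ae_measurableD => //; apply: ae_measurableM; first exact: measurable_ae.
    by apply: ae_measurableB => //; exact: measurable_ae.
  apply: filterS step => w [_ hu].
  have c1 := @parseval _ _ _ _ _ he (f w) (u' w - u w).
  have c2 := @parseval _ _ _ _ _ he (f w) (kap w).
  rewrite (_ : (fun n => _) = (fun n =>
    \sum_(j < n) inner (f w) (e j) * inner (u' w - u w) (e j)
    - s w * \sum_(j < n) inner (f w) (e j) * inner (kap w) (e j))).
    by apply: cvgB c1 _; exact: cvgMl_tmp.
  apply/funext => n; rewrite mulr_sumr -sumrB; apply: eq_bigr => i _.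
  by rewrite innerBl hu -/(s w); ring.
apply: (@ae_measurable_ext _ _ _ _ _ _
  (fun w => (2 * q w + a w * (2 * r w) `^ (-1)) * (pos w) `^ (-1))).
  apply: filterS step => w [hq _]; rewrite -/(s w).
  rewrite [pos w `^ _]powR_inv1; last exact: ltW.
  have p0 : pos w != 0 by rewrite gt_eqF.
  apply: (mulIf p0); rewrite divfK// /pos r2 /a.
  have : 2 * (r w * s w) = q w + q' w by rewrite /s; field; rewrite gt_eqF.
  rewrite hq; set b := inner _ _; move: (s w) (k w) => sw kw h.
  have r0' : r w != 0 by rewrite gt_eqF.
  have -> : sw * (2 * r w - kw / (2 * r w)) = 2 * (r w * sw) - sw * kw / (2 * r w) by field.
  by rewrite h; field.
apply: ae_measurableM; last first.
  by apply: measurable_ae; apply: (measurableT_comp (measurable_powR (-1))).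
apply: ae_measurableD; first by apply: ae_measurableZ; exact: measurable_ae.
by apply: ae_measurableM => //; exact: measurable_ae.
Qed.

End recover_multiplier.

(** * Adaptedness and the averaged energy law *)

Section sav_dynamics.
Variables (R : realType) (d : nat) (O : polygonal_domain R d).
Local Notation H := (L2 O).
Variables (lam : nat -> R) (e : nat -> H).
Hypothesis he : dirichlet_eigenbasis lam e.
Context dO (Om : measurableType dO) (P : probability Om R).
Variables (Fil : R -> set (set Om)) (beta : nat -> R -> Om -> R).
Hypothesis hFil : filtration Fil.
Hypothesis hbeta : wiener_coordinates P Fil beta.
Local Notation dotH := (dotH lam e).
Local Notation norm1 := (norm_dotH lam e 1).

Variables (Qh f : H -> H) (g : H * ('I_d -> H) -> H -> H) (b2 b3 : mpoly.mpoly 2 R).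
Hypothesis hg : forall x w, dotH 1 x -> hilbert_schmidt_Q e Qh (g (x, w)).
Hypothesis f_lipschitz : forall x y, dotH 1 x -> dotH 1 y ->
  norm_L2 (f x - f y) <= eval2 b2 (norm1 x) (norm1 y) * norm1 (x - y).
Hypothesis g_lipschitz : forall x y, dotH 1 x -> dotH 1 y ->
  (hs_norm e (fun z => (g (Theta x) (Qh z) - g (Theta y) (Qh z))%R) <=
    (eval2 b3 (norm1 x) (norm1 y) * norm1 (x - y))%:E)%E.
Variables (Ft : R -> R) (c delta0 : R).
Hypothesis c0 : 0 < c.
Hypothesis Ft_derivable : forall x, derivable Ft x 1.
Hypothesis F_positive : forall x, dotH 1 x -> c <= potential Ft x + delta0.

Section coefficients.
Context dT (T : measurableType dT) (X : T -> H).
Hypothesis X1 : forall w, dotH 1 (X w).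
Hypothesis mX : coord_measurable e X.

Lemma measurable_force : coord_measurable e (fun w => f (X w)).
Proof. exact: (coord_measurable_lipschitz he (fun r => eval2_bound b2 r) f_lipschitz). Qed.

Lemma measurable_diffusion k : coord_measurable e (fun w => g (Theta (X w)) (Qh (e k))).
Proof.
apply: (coord_measurable_lipschitz he (Phi := fun x => g (Theta x) (Qh (e k)))
  (fun r => eval2_bound b3 r)) => // x y hx hy.
exact: (hs_norm_ge k (g_lipschitz hx hy)).
Qed.

Lemma measurable_root :
  measurable_fun setT (fun w => Num.sqrt (potential Ft (X w) + delta0)).
Proof.
have msqrt : measurable_fun setT (Num.sqrt : R -> R).
  by apply: continuous_measurable_fun; exact: sqrt_continuous.
apply: (measurableT_comp msqrt); apply: measurable_funD => //.
apply: (measurable_potential he mX) => x.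
by apply: differentiable_continuous; apply/derivable1_diffP.
Qed.

End coefficients.

Lemma diffusion_bound x : dotH 1 x ->
  exists M, forall n, \sum_(k < n) norm_L2 (g (Theta x) (Qh (e k))) ^+ 2 <= M.
Proof. by move=> hx; have [_ /hs_norm_bound] := hg (Theta x).2 hx. Qed.

Variables (tau : R) (N : nat) (extrapolate : bool).
Variables (u v : nat -> Om -> H) (q : nat -> Om -> R).
Hypothesis tau0 : 0 < tau.
Hypothesis states : random_states lam e N u v q.
Local Notation C n := (completion P (Fil (n%:R * tau))).
Local Notation TC n := (g_sigma_algebraType (C n)).
Local Notation uh := (uhat extrapolate u).
Local Notation root := (sav_root Ft delta0 extrapolate u).
Local Notation force := (sav_force f Ft delta0 extrapolate u q).

Let time_ge0 n : 0 <= n%:R * tau.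
Proof. by rewrite mulr_ge0// ltW. Qed.

Let time_lt n : n%:R * tau < n.+1%:R * tau.
Proof. by rewrite ltr_pM2r// ltr_nat. Qed.

Let C_sigma n : sigma_algebra setT (C n).
Proof. by apply: completion_sigma; exact: filtration_sigma. Qed.

Let C_mono n : C n `<=` C n.+1.
Proof. by apply: completion_mono; apply: filtration_mono => //; exact: ltW. Qed.

Let TC_mono n (X : Om -> R) : measurable_fun setT (X : TC n -> R) ->
  measurable_fun setT (X : TC n.+1 -> R).
Proof.
by move=> /(measurable_wrtP X (C_sigma n)) h; apply/measurable_wrtP => //;
  exact: measurable_wrt_sub h.
Qed.

Let u1 n w : (n <= N)%N -> dotH 1 (u n w).
Proof. by move=> nN; have [h _ _ _] := states nN; exact: (h w). Qed.

(** The previous position is included because the extrapolation uses it. *)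
Definition adapted n := [/\ coord_measurable e (u n : TC n -> H),
  coord_measurable e (u n.-1 : TC n -> H), coord_measurable e (v n : TC n -> H) &
  measurable_fun setT (q n : TC n -> R)].

Let uhat1 n w : (n <= N)%N -> dotH 1 (uh n w).
Proof.
move=> nN; have hu := u1 w nN; rewrite /uhat; case: ifP => // _.
apply: dotHZ; apply: dotHB; first exact: dotHZ.
by apply: u1; exact: leq_trans (leq_pred n) nN.
Qed.

Let uhat_measurable n : adapted n -> coord_measurable e (uh n : TC n -> H).
Proof.
move=> [mu mu' _ _]; rewrite /uhat; case: (extrapolate) => // i.
rewrite (_ : (fun w => _) = (fun w =>
  2^-1 * (3 * inner (u n w) (e i) - inner (u n.-1 w) (e i)))).
  apply: measurable_funM => //; apply: measurable_funB => //.
  by apply: measurable_funM.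
by apply/funext => w; rewrite innerZl innerBl innerZl.
Qed.

Let root_gt0 n w : (n <= N)%N -> 0 < root n w.
Proof.
by move=> nN; rewrite sqrtr_gt0 (lt_le_trans c0)// F_positive//; exact: uhat1.
Qed.

(** Almost sure limits of finite noise sums. *)
Let noise_ae_measurable n Z y : (n <= N)%N -> adapted n ->
  noise_step e Qh P beta g tau u n Z ->
  ae_measurable P (C n.+1) (fun w => inner (Z w) y).
Proof.
move=> nN [mu _ _ _] hZ.
pose xi := increment beta (n%:R * tau) (n.+1%:R * tau).
pose K k w := g (Theta (u n w)) (Qh (e k)).
apply: (@ae_measurable_lim _ _ _ _ _ (fun m w => inner (noise_sum xi K m w) y)).
  move=> m; apply: measurable_ae.
  rewrite (_ : (fun w => _) = (fun w => \sum_(k < m) xi k w * inner (K k w) y)).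
    apply: measurable_sum => k; apply: measurable_funM.
      apply/measurable_wrtP => //.
      exact: (increment_adapted hFil hbeta (time_ge0 n) (time_lt n)).
    apply: TC_mono; apply: (coord_measurable_innerl he).
    by apply: (measurable_diffusion _ mu) => w; exact: u1.
  by apply/funext => w; rewrite inner_suml; apply: eq_bigr => k _; rewrite innerZl.
apply: filterS hZ => w hw; apply: cvg_inner.
by under eq_fun do rewrite norm_L2_distC.
Qed.

(** The iterates are random variables, and for these almost sure measurability with
    respect to a completion is measurability. *)
Let recover n (X : Om -> R) : measurable_wrt measurable X ->
  ae_measurable P (C n) X -> measurable_fun setT (X : TC n -> R).
Proof.
move=> mX [Y mY XY]; apply/(measurable_wrtP X (C_sigma n)).
have h := @completion_ae_eq _ _ _ P (Fil (n%:R * tau)) X Y.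
apply: (h _ _ XY).
  by move=> _ A mA; rewrite setTI; exact: mX.
exact/(measurable_wrtP Y (C_sigma n)).
Qed.

(** Both schemes express the new state affinely in the scalar multiplier of the force.
    Its coefficients kap and rho are known before the step, whereas alpha and gam also
    involve the noise increment. *)
Let affine_step_adapted n (alpha gam rho : nat -> Om -> R) (kap : Om -> H) :
  (n < N)%N -> adapted n ->
  (forall i, ae_measurable P (C n.+1) (alpha i)) ->
  (forall i, ae_measurable P (C n.+1) (gam i)) ->
  coord_measurable e (kap : TC n -> H) ->
  (forall i, measurable_fun setT (rho i : TC n -> R)) ->
  (forall w, inner (f (uh n w)) (kap w) <= 0) ->
  {ae P, forall w, sav_update f Ft delta0 extrapolate u q n w /\ forall i,
    inner (u n.+1 w) (e i) = alpha i w + (q n w + q n.+1 w) / 2 / root n w * inner (kap w) (e i) /\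
    inner (v n.+1 w) (e i) = gam i w + (q n w + q n.+1 w) / 2 / root n w * rho i w} ->
  adapted n.+1.
Proof.
move=> nN an ma mg mk mr k0 step.
have [mu mu' mv mq] := an.
have mroot : measurable_fun setT (root n : TC n -> R).
  by apply: (measurable_root (uhat_measurable an)).
pose s w := (q n w + q n.+1 w) / 2 / root n w.
have up n' (X : Om -> R) : measurable_fun setT (X : TC n' -> R) -> ae_measurable P (C n'.+1) X.
  by move=> mX; apply: measurable_ae; exact: TC_mono.
have ms : ae_measurable P (C n.+1) s.
  apply: (@multiplier_ae_measurable _ _ _ _ _ he _ _ _ _ (fun w => f (uh n w)) kap
    (u n) (u n.+1) _ _ _ alpha) => //.
  - move=> i; apply: TC_mono; apply: (measurable_force _ (uhat_measurable an)) => w.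
    exact: uhat1 (ltnW nN).
  - by move=> i; apply: TC_mono; exact: mk.
  - by move=> i; apply: TC_mono; exact: mu.
  - exact: TC_mono.
  - exact: TC_mono.
  - by move=> w; exact: root_gt0 (ltnW nN).
  - by apply: filterS step => w [hq h]; split => // i; exact: (h i).1.
have [_ su sv sq] := states nN.
split.
- move=> i; apply: recover; first exact: su.
  apply: (@ae_measurable_ext _ _ _ _ _ _ (fun w => alpha i w + s w * inner (kap w) (e i))).
    by apply: filterS step => w [_ /(_ i)[]].
  by apply: ae_measurableD => //; apply: ae_measurableM => //; exact: up.
- by move=> i; apply: TC_mono; exact: mu.
- move=> i; apply: recover; first exact: sv.
  apply: (@ae_measurable_ext _ _ _ _ _ _ (fun w => gam i w + s w * rho i w)).
    by apply: filterS step => w [_ /(_ i)[]].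
  by apply: ae_measurableD => //; apply: ae_measurableM => //; exact: up.
- apply: recover => //.
  apply: (@ae_measurable_ext _ _ _ _ _ _ (fun w => 2 * (s w * root n w) - q n w)).
    apply: aeW => w; rewrite /s divfK ?gt_eqF ?root_gt0 ?(ltnW nN)//.
    by rewrite mulrC divfK// addrAC subrr add0r.
  apply: ae_measurableB; last exact: up.
  by apply: ae_measurableZ; apply: ae_measurableM => //; exact: up.
Qed.

Local Notation noise := (noise_step e Qh P beta g tau u).

Lemma midpoint_adapted n Z : (n < N)%N -> adapted n -> noise n Z ->
  {ae P, forall w,
    [/\ sav_update f Ft delta0 extrapolate u q n w,
        u n.+1 w =ae u n w + (tau / 2) *: (v n w + v n.+1 w) + (tau / 2) *: Z w,
        dotH 2 (u n w + u n.+1 w) &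
        v n.+1 w =ae v n w + (tau / 2) *: laplacian lam e (u n w + u n.+1 w)
          - tau *: force n w + Z w]} ->
  adapted n.+1.
Proof.
move=> nN an hZ step; have [mu mu' mv mq] := an.
have mZ i := noise_ae_measurable (e i) (ltnW nN) an hZ.
have up n' (X : Om -> R) : measurable_fun setT (X : TC n' -> R) -> ae_measurable P (C n'.+1) X.
  by move=> mX; apply: measurable_ae; exact: TC_mono.
have mf : coord_measurable e ((fun w => f (uh n w)) : TC n -> H).
  apply: (measurable_force _ (uhat_measurable an)) => w; exact: uhat1 (ltnW nN).
pose den i := 1 + tau ^+ 2 / 4 * lam i.
pose alpha i w := (inner (u n w) (e i) + tau * (inner (v n w) (e i) + inner (Z w) (e i))
     - tau ^+ 2 / 4 * lam i * inner (u n w) (e i)) / den i.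
pose kap w := midpoint_response lam e tau (f (uh n w)).
have mk : coord_measurable e (kap : TC n -> H).
  move=> i; rewrite (_ : (fun w => _) = (fun w =>
    - (tau ^+ 2 / 2) / den i * inner (f (uh n w)) (e i))).
    by apply: measurable_funM => //; exact: mf.
  by apply/funext => w; rewrite (midpoint_response_coord he) -/(den i); ring.
have ma i : ae_measurable P (C n.+1) (alpha i).
  rewrite (_ : alpha i = (fun w => (den i)^-1 * (inner (u n w) (e i) +
     tau * (inner (v n w) (e i) + inner (Z w) (e i))
     - tau ^+ 2 / 4 * lam i * inner (u n w) (e i)))); last first.
    by apply/funext => w; rewrite /alpha mulrC.
  apply: ae_measurableZ; apply: ae_measurableB; last first.
    by apply: ae_measurableZ; exact: up.
  apply: ae_measurableD; first exact: up.
  by apply: ae_measurableZ; apply: ae_measurableD => //; exact: up.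
apply: (@affine_step_adapted _ alpha (fun i w => 2 / tau * (alpha i w - inner (u n w) (e i))
   - inner (v n w) (e i) - inner (Z w) (e i)) (fun i w => 2 / tau * inner (kap w) (e i)) kap) => //.
- move=> i; apply: ae_measurableB => //; apply: ae_measurableB; last exact: up.
  by apply: ae_measurableZ; apply: ae_measurableB => //; exact: up.
- by move=> i; apply: measurable_funM.
- by move=> w; exact: (inner_midpoint_response_le0 he).
apply: filterS step => w [hq eu hS ev]; split=> // i.
have [-> ->] := midpoint_step_coord he i (lt0r_neq0 tau0) hS eu ev.
rewrite (midpoint_response_coord he) /sav_force innerZl /alpha -/(den i).
by split; ring.
Qed.

Variable E : R -> H * H -> H * H.
Hypothesis hE : wave_group lam e E.
Local Notation response := (wave_response lam e E).

Let pairing_measurable n X : (n <= N)%N -> adapted n ->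
  measurable_fun setT ((fun w => inner_HH1 lam e (u n w, v n w) X) : TC n -> R).
Proof.
move=> nN [mu _ mv _]; rewrite inner_HH1.unlock /= inner1.unlock.
apply: measurable_funD; apply: (coord_measurable_innerl he) => //.
by apply: coord_measurable_powL => // w; exact: u1.
Qed.

Lemma exponential_adapted n Z : (n < N)%N -> adapted n -> noise n Z ->
  {ae P, forall w, sav_update f Ft delta0 extrapolate u q n w /\ exists Y : H * H,
    [/\ wave_dom lam e Y,
        eq_HH (wave_op lam e Y) (E tau (0, - force n w) - (0, - force n w)) &
        eq_HH (u n.+1 w, v n.+1 w) (E tau (u n w, v n w) + Y + E tau (0, Z w))]} ->
  adapted n.+1.
Proof.
move=> nN an hZ step; have nN' := ltnW nN.
have mZ y := noise_ae_measurable y nN' an hZ.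
have mf : coord_measurable e ((fun w => f (uh n w)) : TC n -> H).
  by apply: (measurable_force _ (uhat_measurable an)) => w; exact: uhat1.
have mfy y : measurable_fun setT ((fun w => inner (f (uh n w)) y) : TC n -> R).
  exact: (coord_measurable_innerl he).
have mr1 i : measurable_fun setT
    ((fun w => inner (response tau (f (uh n w))).1 (e i)) : TC n -> R).
  rewrite (_ : (fun w => _) = (fun w => (inner (f (uh n w)) (E (- tau) (e i, 0)).1
      - inner (f (uh n w)) (e i)) / lam i)).
    by apply: measurable_funM => //; exact: measurable_funB.
  by apply/funext => w; rewrite (wave_response_coord1 he hE).
have mr2 i : measurable_fun setT
    ((fun w => inner (response tau (f (uh n w))).2 (e i)) : TC n -> R).
  rewrite (_ : (fun w => _) = (fun w => inner (f (uh n w)) (E (- tau) (0, e i)).1)) //.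
  by apply/funext => w; rewrite (wave_response_coord2 he hE).
have mp X : ae_measurable P (C n.+1) (fun w => inner_HH1 lam e (u n w, v n w) X).
  by apply: measurable_ae; apply: TC_mono; exact: pairing_measurable.
apply: (@affine_step_adapted _
  (fun i w => (inner_HH1 lam e (u n w, v n w) (E (- tau) (e i, 0))
     + inner (Z w) (E (- tau) (e i, 0)).2) / lam i)
  (fun i w => inner_HH1 lam e (u n w, v n w) (E (- tau) (0, e i))
     + inner (Z w) (E (- tau) (0, e i)).2)
  (fun i w => inner (response tau (f (uh n w))).2 (e i))
  (fun w => (response tau (f (uh n w))).1)) => //.
- move=> i; apply: ae_measurableM; last exact: ae_measurable_cst.
  exact: ae_measurableD.
- by move=> i; exact: ae_measurableD.
- by move=> w; exact: (inner_wave_response_le0 he hE).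
apply: filterS step => w [hq [Y [hY eY eX]]]; split=> // i.
exact: (@exponential_step_coord _ _ _ _ _ he _ hE tau (u n w, v n w) (Z w)
  ((q n w + q n.+1 w) / 2 / root n w) (f (uh n w)) (u n.+1 w, v n.+1 w) Y i (u1 w nN') hY eY eX).
Qed.

Hypothesis u0 : measurable_L2_wrt (Fil 0) (u 0%N).
Hypothesis v0 : measurable_L2_wrt (Fil 0) (v 0%N).
Hypothesis q0 : measurable_wrt (Fil 0) (q 0%N).

Let adapted0 : adapted 0.
Proof.
have F0 (X : Om -> R) : measurable_wrt (Fil 0) X -> measurable_fun setT (X : TC 0 -> R).
  move=> mX; apply/(measurable_wrtP X (C_sigma 0)); move: mX; apply: measurable_wrt_sub.
  by rewrite mul0r; apply: sub_completion; exact: filtration_sub.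
by split; [move=> i|move=> i|move=> i|]; apply: F0.
Qed.

Hypothesis scheme :
  midpoint_SAV lam e Qh P beta f g Ft delta0 tau N extrapolate u v q \/
  exponential_SAV lam e Qh P beta f g Ft delta0 tau N extrapolate u v q E.

Let scheme_adapted n : (n <= N)%N -> adapted n.
Proof.
elim: n => [//|n IH nN]; have {}IH := IH (ltnW nN).
case: scheme => [] [_ /(_ _ nN)[Z hZ step]].
  exact: (midpoint_adapted nN IH hZ step).
exact: (exponential_adapted nN IH hZ step).
Qed.

(** Along either scheme the energy changes only through the noise. *)
Let scheme_energy n : (n < N)%N -> exists2 Z, noise n Z & {ae P, forall w,
  norm1 (u n.+1 w) ^+ 2 + norm_L2 (v n.+1 w) ^+ 2 + 2 * q n.+1 w ^+ 2 =
  norm1 (u n w) ^+ 2 + norm_L2 (v n w + Z w) ^+ 2 + 2 * q n w ^+ 2}.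
Proof.
move=> nN; have nN' := ltnW nN.
case: scheme => [] [_ /(_ _ nN)[Z hZ step]]; exists Z => //; apply: filterS step => w.
  move=> [hq eu hS ev]; have r0 := lt0r_neq0 (root_gt0 w nN').
  have := midpoint_step_energy he (lt0r_neq0 tau0) (u1 w nN') (u1 w nN) hS eu ev.
  have := sav_work r0 hq; rewrite -/(sav_force f Ft delta0 extrapolate u q n w) => ->.
  by move: (q n w) (q n.+1 w) => a b; lra.
move=> [hq [Y [hY eY eX]]]; have r0 := lt0r_neq0 (root_gt0 w nN').
have := exponential_step_energy he hE (X := (u n w, v n w)) (X' := (u n.+1 w, v n.+1 w))
  (u1 w nN') (u1 w nN) hY eY eX.
have := sav_work r0 hq; rewrite -/(sav_force f Ft delta0 extrapolate u q n w) => ->.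
rewrite inner_HH1.unlock /= !norm_dotH1_sqr !norm_L2_sqr addr0.
by move: (q n w) (q n.+1 w) => a b; lra.
Qed.

Let coords n : (n <= N)%N -> [/\ coord_measurable e (u n),
  coord_measurable e (v n) & measurable_fun setT (q n)].
Proof.
move=> /states[_ mu mv mq]; split; [move=> i|move=> i|] => _ A mA; rewrite setTI.
- exact: mu.
- exact: mv.
- exact: mq.
Qed.

Let half_mean (a b : Om -> R) : measurable_fun setT a -> measurable_fun setT b ->
  (forall w, 0 <= a w) -> (forall w, 0 <= b w) ->
  (\int[P]_w (a w + b w / 2)%:E = \int[P]_w (a w)%:E + (2^-1)%:E * \int[P]_w (b w)%:E)%E.
Proof.
move=> ma mb a0 b0; have mE (h : Om -> R) : measurable_fun setT h ->
    measurable_fun setT (EFin \o h) by move/measurable_EFinP.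
rewrite -ge0_integralZl_EFin ?invr_ge0//; [|by move=> w _; rewrite lee_fin|exact: mE].
rewrite -ge0_integralD//.
- by apply: eq_integral => w _; rewrite EFinD mulrC EFinM.
- by move=> w _; rewrite lee_fin.
- exact: mE.
- by move=> w _; rewrite -EFinM lee_fin mulr_ge0 ?invr_ge0.
- rewrite (_ : (fun w => _) = EFin \o (fun w => 2^-1 * b w))//.
  by apply: mE; exact: measurable_funM.
Qed.

(** By the energy balance, the energy after the step is that of (u n, v n + Z, q n).
    The increment Z is independent of the data at time n * tau, so Ito's isometry gives
    the mean of the kinetic energy of v n + Z. *)
Theorem energy_evolution n : (n < N)%N ->
  ('E_P[fun w => modified_energy lam e (u n.+1 w) (v n.+1 w) (q n.+1 w)]
   = 'E_P[fun w => modified_energy lam e (u n w) (v n w) (q n w)]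
     + (tau / 2)%:E *
       \int[P]_w let K := g (Theta (u n w)) \o Qh in trace e (K \o adjoint K))%E.
Proof.
move=> nN; have nN' := ltnW nN; have [mu _ mv _] := scheme_adapted nN'.
have [Z hZ energy] := scheme_energy nN.
have [mu_ mv_ mq_] := coords nN'; have [mu' mv' mq'] := coords nN.
have mnorm1 (X : Om -> H) : (forall w, dotH 1 (X w)) -> coord_measurable e X ->
    measurable_fun setT (fun w => norm1 (X w) ^+ 2).
  move=> X1 mX; apply: measurable_funX; apply: (coord_measurable_norm he).
  exact: coord_measurable_powL.
have mnorm (X : Om -> H) : coord_measurable e X ->
    measurable_fun setT (fun w => norm_L2 (X w) ^+ 2).
  by move=> mX; apply: measurable_funX; exact: (coord_measurable_norm he).
pose pot w := norm1 (u n w) ^+ 2 / 2 + q n w ^+ 2.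
have mpot : measurable_fun setT pot.
  apply: measurable_funD; last exact: measurable_funX.
  by apply: measurable_funM => //; apply: mnorm1 => // w; exact: u1.
have pot0 w : 0 <= pot w by rewrite addr_ge0 ?divr_ge0 ?sqr_ge0.
(* The a.e. value of norm_L2 (v n + Z) ^+ 2, written with measurable terms only. *)
pose Nz w := Num.max (2 * (modified_energy lam e (u n.+1 w) (v n.+1 w) (q n.+1 w) - pot w)) 0.
have mV : measurable_fun setT
    (fun w => modified_energy lam e (u n.+1 w) (v n.+1 w) (q n.+1 w)).
  apply: measurable_funD; last exact: measurable_funX.
  apply: measurable_funD; apply: measurable_funM => //; last exact: mnorm.
  by apply: mnorm1 => // w; exact: u1.
have mNz : measurable_fun setT Nz.
  by apply: measurable_maxr => //; apply: measurable_funM => //; exact: measurable_funB.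
have Nz0 w : 0 <= Nz w by rewrite le_max lexx orbT.
have NzE : {ae P, forall w, Nz w = norm_L2 (v n w + Z w) ^+ 2 /\
    modified_energy lam e (u n.+1 w) (v n.+1 w) (q n.+1 w) = pot w + Nz w / 2}.
  apply: filterS energy => w ew.
  have e1 : 2 * (modified_energy lam e (u n.+1 w) (v n.+1 w) (q n.+1 w) - pot w)
      = norm_L2 (v n w + Z w) ^+ 2.
    rewrite /modified_energy /pot; move: ew; set a := norm1 _ ^+ 2; set b := norm_L2 _ ^+ 2.
    by set a' := norm1 _ ^+ 2; set b' := norm_L2 _ ^+ 2; move=> ew; lra.
  have e2 : Nz w = norm_L2 (v n w + Z w) ^+ 2 by rewrite /Nz e1; apply/max_idPl; exact: sqr_ge0.
  by split=> //; rewrite e2 -e1; lra.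
pose xi := increment beta (n%:R * tau) (n.+1%:R * tau).
have step_tau : n.+1%:R * tau - n%:R * tau = tau by rewrite -mulrBl -natrB// subSnn mul1r.
have moment : (\int[P]_w (Nz w)%:E = \int[P]_w (norm_L2 (v n w) ^+ 2)%:E + tau%:E *
    \int[P]_w (\sum_(0 <= k <oo) (norm_L2 (g (Theta (u n w)) (Qh (e k))) ^+ 2)%:E))%E.
  have m1 := measurable_increment hbeta (time_ge0 n) (time_lt n).
  have m2 k (A : set R) : measurable A -> P (xi k @^-1` A) = normal_prob 0 (Num.sqrt tau) A.
    by move=> mA; rewrite -[in RHS]step_tau; exact: (increment_law hbeta (time_ge0 n) (time_lt n) k mA).
  have m3 := increment_pair hbeta (time_ge0 n) (time_lt n).
  have m4 := increment_independent hFil hbeta (time_ge0 n) (time_lt n).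
  apply: (second_moment he tau0 m1 m2 m3 (C_sigma n) (@completion_measurable _ _ _ P _) m4
    (K := fun k w => g (Theta (u n w)) (Qh (e k)))) => //.
  - by move=> k; apply: (measurable_diffusion _ mu) => w; exact: u1.
  - by move=> w; exact: (diffusion_bound (u1 w nN')).
  - by apply: filterS2 NzE hZ => w [h _] hz; exists (Z w).
rewrite !expectation.unlock.
have -> : (\int[P]_w (modified_energy lam e (u n.+1 w) (v n.+1 w) (q n.+1 w))%:E =
    \int[P]_w (pot w + Nz w / 2)%:E)%E.
  apply: ge0_ae_eq_integral => //.
  - exact/measurable_EFinP.
  - by apply/measurable_EFinP; apply: measurable_funD => //; exact: measurable_funM.
  - by move=> w _; rewrite lee_fin addr_ge0 ?sqr_ge0// addr_ge0// divr_ge0 ?sqr_ge0.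
  - by move=> w _; rewrite lee_fin addr_ge0// divr_ge0.
  - by apply: filterS NzE => w [_ ->].
have -> : (\int[P]_w (modified_energy lam e (u n w) (v n w) (q n w))%:E =
    \int[P]_w (pot w + norm_L2 (v n w) ^+ 2 / 2)%:E)%E.
  by apply: eq_integral => w _; rewrite /modified_energy /pot addrAC.
rewrite half_mean// half_mean//; last 2 first.
- exact: mnorm.
- by move=> w; exact: sqr_ge0.
rewrite moment ge0_muleDr; last 2 first.
- by apply: integral_ge0 => w _; rewrite lee_fin sqr_ge0.
- apply: mule_ge0; first by rewrite lee_fin ltW.
  by apply: integral_ge0 => w _; apply: nneseries_ge0 => k _ _; rewrite lee_fin sqr_ge0.
rewrite muleA -EFinM [2^-1 * tau]mulrC addeA; congr (_ + _ * _)%E.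
apply: eq_integral => w _; have [bl hs] := hg (Theta (u n w)).2 (u1 w nN').
by symmetry; exact: (trace_adjoint he bl hs).
Qed.

End sav_dynamics.

Theorem proposition3p1 (R : realType) (d : nat) (hd : (0 < d <= 3)%N)
    (O : polygonal_domain R d)
    (lam : nat -> R) (e : nat -> L2 O) (he : dirichlet_eigenbasis lam e)
    (dO : measure_display) (Om : measurableType dO) (P : probability Om R)
    (Fil : R -> set (set Om)) (hFil : filtration Fil)
    (beta : nat -> R -> Om -> R) (hbeta : wiener_coordinates P Fil beta)
    (Q Qh : L2 O -> L2 O)
    (hQ : covariance_operator e Q) (hQh : square_root Q Qh)
    (hQh_hs : (hs_norm e Qh < +oo)%E)
    (f : L2 O -> L2 O) (g : L2 O * ('I_d -> L2 O) -> L2 O -> L2 O)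
    (hg : forall (u : L2 O) (w : 'I_d -> L2 O), dotH lam e 1 u ->
      hilbert_schmidt_Q e Qh (g (u, w)))
    (k : nat) (hk : (0 < k)%N) (c2 : R) (hc2 : 0 <= c2)
    (b1 : {poly R}) (b2 b3 : mpoly.mpoly 2 R)
    (hb1 : (size b1).-1 = (2 * k).+1)
    (hb2 : total_degree b2 = (2 * k)%N) (hb3 : total_degree b3 = k)
    (f_growth : forall u, dotH lam e 1 u ->
      norm_L2 (f u) <= b1.[norm_dotH lam e 1 u])
    (f_lipschitz : forall u u', dotH lam e 1 u -> dotH lam e 1 u' ->
      norm_L2 (f u - f u') <=
        eval2 b2 (norm_dotH lam e 1 u) (norm_dotH lam e 1 u')
        * norm_dotH lam e 1 (u - u'))
    (g_growth : forall u, dotH lam e 1 u ->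
      (hs_norm e (fun x => g (Theta u) (Qh x)) <=
        c2%:E * (1 + norm_Lp (2 * k + 2) u ^+ k.+1
                   + (norm_dotH lam e 1 u)%:E))%E)
    (g_lipschitz : forall u u', dotH lam e 1 u -> dotH lam e 1 u' ->
      (hs_norm e (fun x => (g (Theta u) (Qh x) - g (Theta u') (Qh x))%R) <=
        (eval2 b3 (norm_dotH lam e 1 u) (norm_dotH lam e 1 u')
         * norm_dotH lam e 1 (u - u'))%:E)%E)
    (Ft : R -> R) (c c3 c4 delta0 : R)
    (hc : 0 < c) (hc3 : 0 < c3) (hc4 : 0 < c4) (hdelta0 : 0 < delta0)
    (Ft_derivable : forall x, derivable Ft x 1)
    (Ft_integrable : forall u : L2 O, dotH lam e 1 u ->
      (domain_measure O).-integrable setT (EFin \o (Ft \o u)))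
    (f_gradient : forall u : L2 O, dotH lam e 1 u ->
      (f u : euclid R d -> R) = (derive1 Ft \o u) %[ae domain_measure O])
    (F_positive : forall u : L2 O, dotH lam e 1 u ->
      c <= potential Ft u + delta0)
    (F_coercive : forall u : L2 O, dotH lam e 1 u ->
      ((c3 * norm_L2 u ^+ 2)%:E + c4%:E * norm_Lp (2 * k + 2) u ^+ (2 * k + 2)
        <= (potential Ft u + delta0)%:E)%E)
    (E : R -> L2 O * L2 O -> L2 O * L2 O) (hE : wave_group lam e E)
    (T : R) (hT : 0 < T) (N : nat) (hN : (0 < N)%N) (tau : R) (htau : tau = T / N%:R)
    (extrapolate : bool)
    (u v : nat -> Om -> L2 O) (q : nat -> Om -> R)
    (hu0 : measurable_L2_wrt (Fil 0) (u 0%N))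
    (hv0 : measurable_L2_wrt (Fil 0) (v 0%N))
    (hq0 : measurable_wrt (Fil 0) (q 0%N))
    (hX0 : forall w, HH1 lam e (u 0%N w, v 0%N w))
    (hscheme :
      midpoint_SAV lam e Qh P beta f g Ft delta0 tau N extrapolate u v q \/
      exponential_SAV lam e Qh P beta f g Ft delta0 tau N extrapolate u v q E) :
  forall n, (n < N)%N ->
    ('E_P[fun w => modified_energy lam e (u n.+1 w) (v n.+1 w) (q n.+1 w)]
     = 'E_P[fun w => modified_energy lam e (u n w) (v n w) (q n w)]
       + (tau / 2)%:E *
         \int[P]_w let K := g (Theta (u n w)) \o Qh in
                   trace e (K \o adjoint K))%E.
Proof.
have tau0 : 0 < tau by rewrite htau divr_gt0// ltr0n.
have states : random_states lam e N u v q by case: hscheme => [] [].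
exact: (energy_evolution he hFil hbeta hg f_lipschitz g_lipschitz hc Ft_derivable F_positive
  tau0 states hE hu0 hv0 hq0 hscheme).
Qed.
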